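(* Let $v$ be a viscosity solution of $H(x,c+v_x(x))=h(c)$ on $\mathbb{T}^n$. Then: (i) For each $x\in\mathbb{T}^n$ there exists $\xi\in\mathbb{R}^n$ such that every accumulation point of $\{\phi^s_L(x,\xi)\}_{s\le0}$ as $s\to-\infty$ belongs to $\tilde{\mathcal{M}}_\alpha(v;c)$; if $v$ is differentiable at $x$, one can take $\xi=H_p(x,c+v_x(x))$. (ii) $\phi^s_L(\tilde{\mathcal{M}}_\alpha(v;c))=\tilde{\mathcal{M}}_\alpha(v;c)$ for all $s\in\mathbb{R}$. (iii) For each $x\in\mathbb{T}^n$ there exists $p\in\mathbb{R}^n$ such that $\phi^s_H(x,p)\in\mathrm{graph}(c+v_x)$ for all $s<0$ and every accumulation point of $\{\phi^s_H(x,p)\}_{s\le0}$ as $s\to-\infty$ belongs to $\tilde{\mathcal{M}}^\ast_\alpha(v;c)$; if $v$ is differentiable at $x$, one can take $p=c+v_x(x)$. (iv) $\tilde{\mathcal{M}}^\ast_\alpha(v;c)\subset\mathrm{graph}(c+v_x)$ and $\phi^s_H(\tilde{\mathcal{M}}^\ast_\alpha(v;c))=\tilde{\mathcal{M}}^\ast_\alpha(v;c)$ for all $s\in\mathbb{R}$.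
   Context: $H:\mathbb{T}^n\times\mathbb{R}^n\to\mathbb{R}$ is $C^2$, $H_{pp}$ is positive definite, and $H(x,p)/|p|\to+\infty$ as $|p|\to\infty$ uniformly in $x$; $L(x,\xi)=\sup_p\{\xi\cdot p-H(x,p)\}$. $c\in\mathbb{R}^n$ is fixed and $h(c)$ is the unique constant for which $H(x,c+v_x)=h(c)$ has a viscosity solution on $\mathbb{T}^n$. $\phi^s_L$ is the flow on $\mathbb{T}^n\times\mathbb{R}^n$ of the Euler–Lagrange equation $\frac{d}{ds}L_\xi(x,x')=L_x(x,x')$, $\phi^s_L(x(0),x'(0))=(x(s),x'(s))$; $\phi^s_H$ is the flow of $x'=H_p(x,p)$, $p'=-H_x(x,p)$. Every viscosity solution $v$ is Lipschitz and satisfies $v(x)=\inf\{\int_{-T}^0(L(\gamma,\gamma')-c\cdot\gamma'+h(c))\,ds+v(\gamma(-T))\}$ over absolutely continuous $\gamma:[-T,0]\to\mathbb{T}^n$ with $\gamma(0)=x$, for all $T>0$. A minimizing curve for $v(x)$ is $\gamma^\ast:(-\infty,0]\to\mathbb{T}^n$, $\gamma^\ast(0)=x$, whose restriction to every $[-T,0]$ attains this infimum. $\mathcal{M}_\alpha(v;c)$ is the closure of the set of all $\alpha$-limit points (limits of $\gamma^\ast(\tau_j)$ with $\tau_j\to-\infty$) of all minimizing curves for $v(x)$, $x\in\mathbb{T}^n$. The function $v$ is differentiable at each point of $\mathcal{M}_\alpha(v;c)$, and $\tilde{\mathcal{M}}_\alpha(v;c):=\{(x,H_p(x,c+v_x(x))):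 x\in\mathcal{M}_\alpha(v;c)\}$, $\tilde{\mathcal{M}}^\ast_\alpha(v;c):=\{(x,c+v_x(x)):x\in\mathcal{M}_\alpha(v;c)\}$. $\mathrm{graph}(c+v_x):=\{(x,c+v_x(x)): x\in\mathbb{T}^n,\ v \text{ differentiable at } x\}$. *)

(* Defs.v *)
(* T^n is represented by its universal cover R^n = 'rV[R]_n:
   functions on T^n are Z^n-periodic functions on 'rV[R]_n, subsets of T^n
   (resp. of T^n x R^n) are represented by the set of all their lifts. *)
From HB Require Import structures.
From mathcomp Require Import all_boot all_order all_algebra.
From mathcomp Require Import all_classical all_reals all_analysis.
Set Implicit Arguments. Unset Strict Implicit. Unset Printing Implicit Defensive.
Import Order.TTheory GRing.Theory Num.Theory.
Import numFieldNormedType.Exports.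
Local Open Scope classical_set_scope.
Local Open Scope ring_scope.

Section Defs.
Variables (R : realType) (n : nat).
Notation V := 'rV[R]_n.

Definition dotv (u w : V) : R := (u *m w^T) 0 0.

Definition intvec (k : V) : Prop := forall i, k 0 i \is a Num.int.

Definition grad (f : V -> R) (x : V) : V := \row_i ('D_(delta_mx 0 i) f x).

Definition Hp (H : V -> V -> R) (x p : V) : V := grad (H x) p.
Definition Hx (H : V -> V -> R) (x p : V) : V := grad (fun y => H y p) x.

Definition Hpp (H : V -> V -> R) (x p : V) : 'M[R]_n :=
  \matrix_(i, j) 'D_((0 : V), (delta_mx 0 j : V))
                   ('D_((0 : V), (delta_mx 0 i : V)) (fun z : V * V => H z.1 z.2)) (x, p).

Definition posdef (A : 'M[R]_n) : Prop :=
  forall w : V, w != 0 -> 0 < (w *m A *m w^T) 0 0.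

Definition C2 (F : V * V -> R) : Prop :=
  (forall z, differentiable F z) /\
  (forall u z, differentiable ('D_u F) z) /\
  (forall u w, continuous ('D_w ('D_u F))).

Definition C1 (f : V -> R) : Prop :=
  (forall y, differentiable f y) /\ continuous (grad f).

Definition superlinear (H : V -> V -> R) : Prop :=
  forall M : R, exists R0 : R, forall x p : V, R0 < `|p| -> M <= H x p / `|p|.

Definition periodic_x (H : V -> V -> R) : Prop :=
  forall k x p, intvec k -> H (x + k) p = H x p.

Definition periodicT (v : V -> R) : Prop :=
  forall k x, intvec k -> v (x + k) = v x.

Definition Lag (H : V -> V -> R) (x xi : V) : R :=
  sup (range (fun p : V => dotv xi p - H x p)).

Definition Lxi (H : V -> V -> R) (x xi : V) : V := grad (Lag H x) xi.
Definition Lx (H : V -> V -> R) (x xi : V) : V := grad (fun y => Lag H y xi) x.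

Definition visc_sol (H : V -> V -> R) (c : V) (a : R) (v : V -> R) : Prop :=
  continuous v /\
  (forall (phi : V -> R) (x0 : V), C1 phi ->
     (\forall y \near x0, v y - phi y <= v x0 - phi x0) ->
     H x0 (c + grad phi x0) <= a) /\
  (forall (phi : V -> R) (x0 : V), C1 phi ->
     (\forall y \near x0, v x0 - phi x0 <= v y - phi y) ->
     a <= H x0 (c + grad phi x0)).

Definition ACon (g : R -> V) (s t : R) : Prop :=
  forall e : R, 0 < e -> exists2 d : R, 0 < d &
    forall (k : nat) (a b : nat -> R),
      (forall i, (i < k)%N -> s <= a i /\ a i <= b i /\ b i <= t) ->
      (forall i j, (i < k)%N -> (j < k)%N -> i <> j -> b i <= a j \/ b j <= a i) ->
      \sum_(i < k) (b i - a i) < d ->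
      \sum_(i < k) `|g (b i) - g (a i)| < e.

Definition action (H : V -> V -> R) (c : V) (a : R) (g : R -> V) (T : R) : \bar R :=
  (\int[lebesgue_measure]_(s in `[(- T)%R, 0%R]%classic)
     (Lag H (g s) (derive1 g s) - dotv c (derive1 g s) + a)%:E)%E.

Definition minimizing (H : V -> V -> R) (c : V) (a : R) (v : V -> R) (x : V)
    (g : R -> V) : Prop :=
  g 0 = x /\
  forall T : R, 0 < T ->
    ACon g (- T) 0 /\
    forall eta : R -> V, ACon eta (- T) 0 -> eta 0 = x ->
      (action H c a g T + (v (g (- T)))%:E <= action H c a eta T + (v (eta (- T)))%:E)%E.

Definition alpha_limit (g : R -> V) (y : V) : Prop :=
  exists (tau : nat -> R) (k : nat -> V),
    tau @ \oo --> -oo /\ (forall j, intvec (k j)) /\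
    (fun j => g (tau j) - k j) @ \oo --> y.

Definition Malpha H c a v : set V :=
  closure [set y | exists x g, minimizing H c a v x g /\ alpha_limit g y].

Definition Mtilde H c a v : set (V * V) :=
  [set z | Malpha H c a v z.1 /\ z.2 = Hp H z.1 (c + grad v z.1)].

Definition Mtilde_star H c a v : set (V * V) :=
  [set z | Malpha H c a v z.1 /\ z.2 = c + grad v z.1].

Definition graphv (c : V) (v : V -> R) : set (V * V) :=
  [set z | differentiable v z.1 /\ z.2 = c + grad v z.1].

Definition accum (f : R -> V * V) (z : V * V) : Prop :=
  exists (tau : nat -> R) (k : nat -> V),
    tau @ \oo --> -oo /\ (forall j, intvec (k j)) /\
    (fun j => (f (tau j)).1 - k j) @ \oo --> z.1 /\
    (fun j => (f (tau j)).2) @ \oo --> z.2.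

Definition is_Hflow (H : V -> V -> R) (phi : R -> V * V -> V * V) : Prop :=
  forall z, phi 0 z = z /\
    forall s : R, is_derive s (1 : R) (fun t => (phi t z).1) (Hp H (phi s z).1 (phi s z).2) /\
              is_derive s (1 : R) (fun t => (phi t z).2) (- Hx H (phi s z).1 (phi s z).2).

Definition is_ELflow (H : V -> V -> R) (phi : R -> V * V -> V * V) : Prop :=
  forall z, phi 0 z = z /\
    forall s : R, is_derive s (1 : R) (fun t => (phi t z).1) (phi s z).2 /\
              is_derive s (1 : R) (fun t => Lxi H (phi t z).1 (phi t z).2)
                            (Lx H (phi s z).1 (phi s z).2).
End Defs.

(* Main.v *)
(* A viscosity solution satisfies one-step inequalities: comparing it with the
   test functions x |-> v y + t L(y, (x - y) / t) - c.(x - y) + t a shows that v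
   is dominated by the action of short segments up to C t^2, and that every
   point is reached by a segment attaining equality up to C t^2.  Concatenating
   such segments and passing to a cluster point (Tychonoff) gives, through every
   point, a curve calibrated up to a quadratic error.  Along such a curve v has
   a super- and a subdifferential, hence is differentiable at times s < 0, and
   the momentum c + grad v solves Hamilton's equations together with the curve.

   Absolutely continuous functions are integrals of their derivatives (total
   variation, Lebesgue-Stieltjes measure, Radon-Nikodym), so v(g 0) - v(g (-T))
   is at most the action of g; hence calibrated curves minimize.  Conversely, if
   g minimizes, then on any [r, s] the derivative of an affine minorant of the
   Lagrangian may replace that of v along g, and g is calibrated, with constants
   that do not depend on g.

   Being calibrated for all times is a closed condition on an orbit, invariant
   under the flow, and it forces the momentum to be c + grad v.  It passes from
   the shifted orbits of minimizers to their alpha-limits, where the momenta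
   therefore converge; this gives the accumulation and invariance statements for
   the Hamiltonian flow, and the Legendre transform conjugates it to the
   Euler-Lagrange flow. *)
Require Import Defs.
From HB Require Import structures.
From mathcomp Require Import all_boot all_order all_algebra.
From mathcomp Require Import all_classical all_reals all_analysis.
From mathcomp Require Import measurable_realfun ring lra.
Import Order.TTheory GRing.Theory Num.Theory.
Import numFieldNormedType.Exports.
Local Open Scope classical_set_scope.
Local Open Scope ring_scope.
Set Implicit Arguments. Unset Strict Implicit. Unset Printing Implicit Defensive.

(** Freezing the base point of the Lagrangian at one end of a step makes the cost a [C1] function of
    either end. The price is that [H] is controlled at one end of the step and needed at the other,
    at distance [O(t)]; integrated over the duration, this is the error [C t^2].

    The superdifferential of [v], its subdifferential and the momentum equation come from one
    estimate, [n_step]: the chain of steps is translated by [h] times an affine weight in time,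
    which vanishes at the first end, vanishes at the last end, or is constant.

    The Lagrangian along an absolutely continuous curve is not shown to be measurable, so its
    integral is never split over subintervals; only densities of absolutely continuous functions
    are. The closure in [Malpha] mixes limits of different minimizers, which is why the calibration
    constants have to be common to all of them. *)

Section RowVectors.
Variables (R : realType) (n : nat).
Notation V := 'rV[R]_n.
Implicit Types (u w x y p q : V) (r : R).

Lemma dotvE u w : dotv u w = \sum_i u 0 i * w 0 i.
Proof. by rewrite /dotv mxE; apply: eq_bigr => i _; rewrite mxE. Qed.

Lemma dotvC u w : dotv u w = dotv w u.
Proof. by rewrite !dotvE; apply: eq_bigr => i _; rewrite mulrC. Qed.

Lemma dotvDl u u' w : dotv (u + u') w = dotv u w + dotv u' w.
Proof. by rewrite /dotv mulmxDl mxE. Qed.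

Lemma dotvDr u u' w : dotv w (u + u') = dotv w u + dotv w u'.
Proof. by rewrite dotvC dotvDl !(dotvC w). Qed.

Lemma dotvZl r u w : dotv (r *: u) w = r * dotv u w.
Proof. by rewrite /dotv -scalemxAl mxE. Qed.

Lemma dotvZr r u w : dotv u (r *: w) = r * dotv u w.
Proof. by rewrite dotvC dotvZl dotvC. Qed.

Lemma dotvNl u w : dotv (- u) w = - dotv u w.
Proof. by rewrite -scaleN1r dotvZl mulN1r. Qed.

Lemma dotvNr u w : dotv u (- w) = - dotv u w.
Proof. by rewrite dotvC dotvNl dotvC. Qed.

Lemma dotvBl u u' w : dotv (u - u') w = dotv u w - dotv u' w.
Proof. by rewrite dotvDl dotvNl. Qed.

Lemma dotvBr u u' w : dotv w (u - u') = dotv w u - dotv w u'.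
Proof. by rewrite dotvDr dotvNr. Qed.

Lemma dot0v w : dotv 0 w = 0.
Proof. by rewrite /dotv mul0mx mxE. Qed.

Lemma dotv0 w : dotv w 0 = 0.
Proof. by rewrite dotvC dot0v. Qed.

Lemma coordB u w i : (u - w) 0 i = u 0 i - w 0 i.
Proof. by rewrite mxE [X in _ + X]mxE. Qed.

Lemma coord_le_norm u i : `|u 0 i| <= `|u|.
Proof.
rewrite [leRHS]/Num.norm /= mx_normrE.
by apply/bigmax_geP; right => /=; exists (0, i).
Qed.

Lemma norm_le_coord u r : 0 <= r -> (forall i, `|u 0 i| <= r) -> `|u| <= r.
Proof.
move=> r0 ur; rewrite [leLHS]/Num.norm /= mx_normrE.
by apply: bigmax_le => // -[i j] _ /=; rewrite (ord1 i).
Qed.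

Lemma norm_dotv u w : `|dotv u w| <= n%:R * (`|u| * `|w|).
Proof.
rewrite dotvE (le_trans (ler_norm_sum _ _ _))//.
have -> : n%:R * (`|u| * `|w|) = \sum_(i < n) `|u| * `|w|.
  by rewrite sumr_const card_ord mulr_natl.
by apply: ler_sum => i _; rewrite normrM ler_pM ?coord_le_norm.
Qed.

(** [|u|] is the maximum norm, so a signed coordinate vector at a largest entry is norming; norm
    bounds can thus be proved by pairing. *)
Lemma norm_dual u : exists2 e : V, `|e| <= 1 & `|u| <= dotv e u.
Proof.
case: (pselect (exists i, `|u 0 i| = `|u|)) => [[i iu]|].
  exists (Num.sg (u 0 i) *: delta_mx 0 i).
    apply: norm_le_coord => // j; rewrite !mxE eqxx /= normrM.
    rewrite normr_sg; case: (u 0 i == 0); case: (j == i);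
      by rewrite ?normr0 ?normr1 ?mulr0 ?mulr1 ?mul0r.
  rewrite dotvZl dotvE (bigD1 i)//= big1 ?addr0; last first.
    by move=> j /negPf ji; rewrite mxE ji andbF mul0r.
  by rewrite mxE !eqxx mul1r -iu -normrEsg.
(* Only [n = 0] leads here: any index yields one of largest modulus, which attains the norm. *)
move=> Nu; exists 0; rewrite ?normr0// dot0v.
rewrite [leLHS]/Num.norm /= mx_normrE.
apply: bigmax_le => // -[i j] _ /=; rewrite (ord1 i).
apply: contrapT => /negP; rewrite -ltNge => uj; apply: Nu.
have : exists i, forall j, `|u 0 j| <= `|u 0 i|.
  have := @arg_maxP _ _ _ j predT (fun i => `|u 0 i|) isT.
  by case=> k _ kmax; exists k => l; exact: kmax.
case=> k kmax; exists k; apply/eqP; rewrite eq_le coord_le_norm/=.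
exact: norm_le_coord.
Qed.

Lemma dotv_bound u r : (forall e : V, `|e| <= 1 -> dotv e u <= r) -> `|u| <= r.
Proof. by move=> ur; have [e e1 /le_trans] := norm_dual u; apply; exact: ur. Qed.

Lemma dotv_inj u w : (forall h, dotv h u = dotv h w) -> u = w.
Proof.
move=> uw; apply/eqP; rewrite -subr_eq0 -normr_le0.
by apply: dotv_bound => e _; rewrite dotvBr uw subrr.
Qed.

Lemma compact_cball r : compact [set p : V | `|p| <= r].
Proof.
apply: bounded_closed_compact.
  exists r; split; first exact: num_real.
  by move=> M rM p /= /le_trans; apply; exact: ltW.
have -> : [set p : V | `|p| <= r] = (fun p : V => `|p|) @^-1` [set s | s <= r] by [].
apply: closed_comp; last exact: closed_le.
by move=> p _; exact: norm_continuous.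
Qed.

Lemma intvec_shift x : exists2 k : V, intvec k & `|x - k| <= 1.
Proof.
exists (\row_i (Num.floor (x 0 i))%:~R); first by move=> i; rewrite mxE intr_int.
apply: norm_le_coord => // i; rewrite !mxE.
rewrite ger0_norm ?subr_ge0 ?ge_floor//.
by rewrite lerBlDr -[1]/(1%:~R) -intrD addrC ltW// floorD1_gt.
Qed.

Lemma intvecN (k : V) : intvec k -> intvec (- k).
Proof. by move=> Hk i; rewrite mxE rpredN. Qed.

End RowVectors.

(** * Uniform bounds for continuous functions periodic in the base variable *)

Section PeriodicFunctions.
Variables (R : realType) (n : nat) (W : normedModType R).
Notation V := 'rV[R]_n.
Variable (F : V * V -> W).
Hypothesis cF : continuous F.
Hypothesis perF : forall k x p, intvec k -> F (x + k, p) = F (x, p).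

(** Only [z] is confined to [K]: once an integer translation has moved [z] into the unit ball, a
    nearby [z'] may still lie outside. *)
Lemma near_unif_cont (K : set (V * V)) (e : R) : compact K -> 0 < e ->
  exists2 d, 0 < d & forall z z', K z -> `|z - z'| < d -> `|F z - F z'| < e.
Proof.
move=> /compact_near_coveringP Kc e0.
pose P (d : R) (z : V * V) := forall z', `|z - z'| < d -> `|F z - F z'| < e.
have : \forall d \near (0:R)^'+, K `<=` P d.
  apply: Kc => z Kz.
  have e20 : 0 < e / 2 by rewrite divr_gt0.
  have /cvgrPdist_lt/(_ _ e20) : F z' @[z' --> z] --> F z by exact: cF.
  rewrite /= => /nbhs_ballP[d /= d0 dF].
  have dF' z' : `|z - z'| < d -> `|F z - F z'| < e / 2.
    by move=> zz'; apply: dF; rewrite -ball_normE.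
  near=> z1 d1 => z' z'1.
  have d1d : d1 <= d / 2 by near: d1; apply: nbhs_right_le; rewrite divr_gt0.
  have zz1 : `|z - z1| < d / 2.
    have : ball z (d / 2) z1 by near: z1; apply: nbhsx_ballx; rewrite divr_gt0.
    by rewrite -ball_normE.
  rewrite (splitr e) (le_lt_trans (ler_distD (F z) _ _))// ltrD//.
    by rewrite distrC dF'// (lt_le_trans zz1)// ler_pdivrMr// ler_peMr ?ler1n// ltW.
  apply: dF'; rewrite (splitr d) (le_lt_trans (ler_distD z1 _ _))// ltrD//.
  exact: lt_le_trans d1d.
move=> Kd; have [d d0 Hd] : exists2 d : R, 0 < d & K `<=` P d.
  near (0:R)^'+ => d; exists d => //.
  by near: d.
by exists d => // z z' Kz; exact: Hd.
Unshelve. all: by end_near. Qed.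

Lemma periodic_unif_cont (M e : R) : 0 < e ->
  exists2 d, 0 < d & forall x x' p p', `|p| <= M -> `|x - x'| < d ->
    `|p - p'| < d -> `|F (x, p) - F (x', p')| < e.
Proof.
move=> e0.
have := near_unif_cont (compact_setX (@compact_cball R n 1) (@compact_cball R n M)) e0.
case=> d d0 Hd; exists d => // x x' p p' pM xx' pp'.
have [k kint xk] := intvec_shift x.
rewrite -(perF _ p (intvecN kint)) -(perF _ p' (intvecN kint)).
apply: Hd => //=; rewrite prod_normE/=.
by rewrite opprD addrACA subrr addr0 gt_max xx' pp'.
Qed.

Lemma periodic_bounded (M : R) :
  exists2 C, 0 <= C & forall x p, `|p| <= M -> `|F (x, p)| <= C.
Proof.
have cK := compact_setX (@compact_cball R n 1) (@compact_cball R n M).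
have /compact_bounded[C [_ HC]] := continuous_compact (continuous_subspaceT cF) cK.
exists (`|C| + 1); rewrite ?addr_ge0// => x p pM.
have [k kint xk] := intvec_shift x.
rewrite -(perF _ p (intvecN kint)); apply: HC.
  by rewrite (le_lt_trans (ler_norm _))// ltrDl.
by exists (x - k, p).
Qed.

End PeriodicFunctions.

(** * Smooth Hamiltonians *)

Lemma is_derive_line (R : realType) (U W : normedModType R) (f : U -> W)
    (z u : U) (t : R) : differentiable f (z + t *: u) ->
  is_derive t (1 : R) (fun s => f (z + s *: u)) ('D_u f (z + t *: u)).
Proof.
move=> df; have dfu : derivable f (z + t *: u) u by exact: diff_derivable.
have E : (fun h : R => h^-1 *: (((fun s => f (z + s *: u)) \o shift t) (h *: (1 : R))
            - f (z + t *: u)))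
       = (fun h : R => h^-1 *: ((f \o shift (z + t *: u)) (h *: u) - f (z + t *: u))).
  apply/funext => h /=; congr (_ *: (f _ - _)).
  by rewrite [h *: _]mulr1 scalerDl addrCA.
split; first by rewrite /derivable E; exact: dfu.
by rewrite /derive E.
Qed.

Section MeanValue.
Variables (R : realType) (U : normedModType R).

Lemma mean_value_line (f : U -> R) (z u : U) : (forall z, differentiable f z) ->
  exists2 t, 0 < t < 1 & f (z + u) - f z = 'D_u f (z + t *: u).
Proof.
move=> df.
have dl t : is_derive t (1 : R) (fun s => f (z + s *: u)) ('D_u f (z + t *: u)).
  exact: is_derive_line.
have cl : {within `[0, 1], continuous (fun s : R => f (z + s *: u))}.
  apply: continuous_subspaceT => t.
  by apply: differentiable_continuous; apply/derivable1_diffP; case: (dl t).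
have [t t01] := MVT (@ltr01 R) (fun t _ => dl t) cl.
rewrite scale1r scale0r addr0 subr0 mulr1 => E.
by exists t => //; move: t01; rewrite in_itv.
Qed.

End MeanValue.

Section RowContinuity.
Variables (R : realType) (n : nat) (T : topologicalType).

Lemma continuous_row (f : 'I_n -> T -> R) :
  (forall i, continuous (f i)) -> continuous (fun z => \row_i f i z : 'rV[R]_n).
Proof.
move=> cf z; apply/cvgrPdist_le => e e0; near=> y.
apply: norm_le_coord; first exact: ltW.
move=> i; rewrite !mxE; move: i; near: y.
  apply: filter_forall => i.
  by have /cvgrPdist_le/(_ _ e0) : f i y @[y --> z] --> f i z by exact: cf.
Unshelve. all: by end_near. Qed.

End RowContinuity.

Section SmoothHamiltonian.
Variables (R : realType) (n : nat).
Notation V := 'rV[R]_n.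
Notation e1 i := ((delta_mx 0 i : V), (0 : V)).
Notation e2 i := ((0 : V), (delta_mx 0 i : V)).

Lemma derive_pair_sum (G : V * V -> R) (z : V * V) (u w : V) :
  differentiable G z ->
  'D_(u, w) G z = \sum_i u 0 i * 'D_(e1 i) G z + \sum_i w 0 i * 'D_(e2 i) G z.
Proof.
move=> dG; rewrite deriveE//.
have -> : (u, w) = \sum_i u 0 i *: e1 i + \sum_i w 0 i *: e2 i :> V * V.
  apply/eqP; rewrite xpair_eqE /=.
  have -> : (\sum_i u 0 i *: e1 i).1 = u.
    rewrite {2}(row_sum_delta u) (big_morph (@fst V V) (id1 := 0) (op1 := +%R))//.
  have -> : (\sum_i u 0 i *: e1 i).2 = 0.
    rewrite (big_morph (@snd V V) (id1 := 0) (op1 := +%R))//=.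
    by rewrite big1// => i _; rewrite scaler0.
  have -> : (\sum_i w 0 i *: e2 i).1 = 0.
    rewrite (big_morph (@fst V V) (id1 := 0) (op1 := +%R))//=.
    by rewrite big1// => i _; rewrite scaler0.
  have -> : (\sum_i w 0 i *: e2 i).2 = w.
    rewrite {2}(row_sum_delta w) (big_morph (@snd V V) (id1 := 0) (op1 := +%R))//.
  by rewrite addr0 add0r !eqxx.
rewrite linearD !linear_sum; congr (_ + _); apply: eq_bigr => i _;
  by rewrite linearZ/= deriveE.
Qed.

Lemma derive_periodic (G : V * V -> R) (u : V * V) :
  (forall k x p, intvec k -> G (x + k, p) = G (x, p)) ->
  forall k x p, intvec k -> 'D_u G (x + k, p) = 'D_u G (x, p).
Proof.
move=> perG k x p kint.
have E : (fun h : R => h^-1 *: ((G \o shift (x + k, p)) (h *: u) - G (x + k, p)))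
       = (fun h : R => h^-1 *: ((G \o shift (x, p)) (h *: u) - G (x, p))).
  apply/funext => h /=; rewrite (perG k x p kint).
  rewrite (_ : h *: u + (x + k, p) = ((h *: u + (x, p)).1 + k, (h *: u + (x, p)).2)).
    by rewrite (perG k _ _ kint) -surjective_pairing.
  by congr pair; rewrite /= addrA.
by rewrite /derive E.
Qed.

(** Partial derivatives inherit the periodicity, hence are bounded wherever [|p| <= M]. This
    condition is convex, so it holds along the whole segment used by the mean value theorem. *)
Lemma locally_lipschitz (G : V * V -> R) :
  (forall z, differentiable G z) ->
  (forall k x p, intvec k -> G (x + k, p) = G (x, p)) ->
  (forall i, continuous ('D_(e1 i) G)) -> (forall i, continuous ('D_(e2 i) G)) ->
  forall M, exists2 K, 0 <= K & forall x x' p p', `|p| <= M -> `|p'| <= M ->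
    `|G (x, p) - G (x', p')| <= K * (`|x - x'| + `|p - p'|).
Proof.
move=> dG perG c1 c2 M.
pose D i z := `|'D_(e1 i) G z| + `|'D_(e2 i) G z|.
have bD i : exists2 C, 0 <= C & forall x p, `|p| <= M -> D i (x, p) <= C.
  have [C C0 HC] := periodic_bounded (c1 i) (derive_periodic _ perG) M.
  have [C' C'0 HC'] := periodic_bounded (c2 i) (derive_periodic _ perG) M.
  exists (C + C'); first exact: addr_ge0.
  by move=> x p pM; apply: lerD; [exact: HC|exact: HC'].
pose C i := sval (cid2 (bD i)).
have C0 i : 0 <= C i by rewrite /C; case: cid2.
have HC i x p : `|p| <= M -> D i (x, p) <= C i by rewrite /C; case: cid2 => /= ? ? ; exact.
exists (\sum_i C i); first exact: sumr_ge0.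
move=> x x' p p' pM p'M.
have [t /andP[t0 t1]] := mean_value_line (x', p') (x - x', p - p') dG.
have -> : (x', p') + (x - x', p - p') = (x, p) :> V * V.
  by congr pair; rewrite /= addrC subrK.
move=> ->; rewrite derive_pair_sum// -big_split/= mulr_suml.
apply: le_trans (ler_norm_sum _ _ _) _; apply: ler_sum => i _.
set z := (x', p') + _.
have zM : `|z.2| <= M.
  rewrite /z/=.
  have -> : p' + t *: (p - p') = t *: p + (1 - t) *: p'.
    by rewrite scalerBr scalerBl scale1r addrCA.
  have t1' : 0 <= 1 - t by rewrite subr_ge0 ltW.
  apply: le_trans (ler_normD _ _) _.
  rewrite !normrZ (ger0_norm (ltW t0)) (ger0_norm t1').
  apply: le_trans (lerD (ler_wpM2l (ltW t0) pM) (ler_wpM2l t1' p'M)) _.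
  by rewrite -mulrDl addrC subrK mul1r.
have Hz : D i z <= C i by rewrite (surjective_pairing z) HC.
have ux : `|(x - x') 0 i| <= `|x - x'| + `|p - p'|.
  by rewrite (le_trans (coord_le_norm _ _))// lerDl.
have wx : `|(p - p') 0 i| <= `|x - x'| + `|p - p'|.
  by rewrite (le_trans (coord_le_norm _ _))// lerDr.
have aux (a b c d m : R) : `|a| <= m -> `|c| <= m ->
    `|a * b + c * d| <= (`|b| + `|d|) * m.
  move=> am cm; apply: le_trans (ler_normD _ _) _.
  by rewrite !normrM mulrDl lerD// mulrC ler_wpM2l.
apply: le_trans (aux _ _ _ _ _ ux wx) _.
by rewrite ler_wpM2r// addr_ge0.
Qed.

Variable H : V -> V -> R.
Let F (z : V * V) := H z.1 z.2.

Lemma HpE x p i : Hp H x p 0 i = 'D_(e2 i) F (x, p).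
Proof.
rewrite mxE.
have E : (fun h : R => h^-1 *: ((H x \o shift p) (h *: delta_mx 0 i) - H x p))
       = (fun h : R => h^-1 *: ((F \o shift (x, p)) (h *: e2 i) - F (x, p))).
  by apply/funext => h /=; rewrite /F/= scaler0 add0r.
by rewrite /derive E.
Qed.

Lemma HxE x p i : Hx H x p 0 i = 'D_(e1 i) F (x, p).
Proof.
rewrite mxE.
have E : (fun h : R => h^-1 *: (((H ^~ p) \o shift x) (h *: delta_mx 0 i) - H x p))
       = (fun h : R => h^-1 *: ((F \o shift (x, p)) (h *: e1 i) - F (x, p))).
  by apply/funext => h /=; rewrite /F/= scaler0 add0r.
by rewrite /derive E.
Qed.

Hypothesis C2F : C2 F.
Hypothesis perH : periodic_x H.

Let dF z : differentiable F z. Proof. by case: C2F. Qed.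
Let ddF u z : differentiable ('D_u F) z. Proof. by case: C2F => _ []. Qed.
Let cddF u w : continuous ('D_w ('D_u F)). Proof. by case: C2F => _ []. Qed.
Let perF k x p : intvec k -> F (x + k, p) = F (x, p).
Proof. exact: perH. Qed.

Lemma derive_Ham x p u w : 'D_(u, w) F (x, p) = dotv u (Hx H x p) + dotv w (Hp H x p).
Proof.
rewrite (derive_pair_sum u w (dF (x, p))) !dotvE.
by congr (_ + _); apply: eq_bigr => i _; rewrite (HxE, HpE).
Qed.

Lemma continuous_Ham : continuous F.
Proof. by move=> z; apply: differentiable_continuous. Qed.

Lemma continuous_Hp : continuous (fun z : V * V => Hp H z.1 z.2).
Proof.
rewrite (_ : (fun z => _) = (fun z => \row_i 'D_(e2 i) F z)); last first.
  by apply/funext => -[x p] /=; apply/rowP => i; rewrite HpE mxE.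
by apply: continuous_row => i z; apply: differentiable_continuous.
Qed.

Lemma continuous_Hx : continuous (fun z : V * V => Hx H z.1 z.2).
Proof.
rewrite (_ : (fun z => _) = (fun z => \row_i 'D_(e1 i) F z)); last first.
  by apply/funext => -[x p] /=; apply/rowP => i; rewrite HxE mxE.
by apply: continuous_row => i z; apply: differentiable_continuous.
Qed.

Lemma Hp_periodic k x p : intvec k -> Hp H (x + k) p = Hp H x p.
Proof. by move=> ki; apply/rowP => i; rewrite !HpE derive_periodic. Qed.

Lemma Hx_periodic k x p : intvec k -> Hx H (x + k) p = Hx H x p.
Proof. by move=> ki; apply/rowP => i; rewrite !HxE derive_periodic. Qed.

Lemma Ham_lipschitz M : exists2 K, 0 <= K & forall x x' p p',
  `|p| <= M -> `|p'| <= M -> `|H x p - H x' p'| <= K * (`|x - x'| + `|p - p'|).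
Proof.
apply: (locally_lipschitz dF perF) => i z; exact: differentiable_continuous.
Qed.

Lemma gradHam_lipschitz M : exists2 K, 0 <= K & forall x x' p p',
  `|p| <= M -> `|p'| <= M ->
  `|Hp H x p - Hp H x' p'| <= K * (`|x - x'| + `|p - p'|) /\
  `|Hx H x p - Hx H x' p'| <= K * (`|x - x'| + `|p - p'|).
Proof.
have lip u := locally_lipschitz (ddF u) (derive_periodic u perF)
  (fun i => @cddF u (e1 i)) (fun i => @cddF u (e2 i)) M.
pose C u := sval (cid2 (lip u)).
have C0 u : 0 <= C u by rewrite /C; case: cid2.
have HC u x x' p p' : `|p| <= M -> `|p'| <= M ->
    `|'D_u F (x, p) - 'D_u F (x', p')| <= C u * (`|x - x'| + `|p - p'|).
  by rewrite /C; case: cid2 => /= ? ? h; exact: h.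
have S0 (f : 'I_n -> V * V) j : C (f j) <= \sum_i C (f i).
  by rewrite (bigD1 j)//= lerDl sumr_ge0.
exists (\sum_i C (e1 i) + \sum_i C (e2 i)); first by rewrite addr_ge0 ?sumr_ge0.
move=> x x' p p' pM p'M; split; apply: norm_le_coord => [|i];
  rewrite ?mulr_ge0 ?addr_ge0 ?sumr_ge0//.
  rewrite coordB !HpE; apply: le_trans (HC _ _ _ _ _ _ _) _ => //.
  rewrite ler_wpM2r ?addr_ge0// (le_trans (S0 (fun i => e2 i) i))//.
  by rewrite lerDr sumr_ge0.
rewrite coordB !HxE; apply: le_trans (HC _ _ _ _ _ _ _) _ => //.
rewrite ler_wpM2r ?addr_ge0// (le_trans (S0 (fun i => e1 i) i))//.
by rewrite lerDl sumr_ge0.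
Qed.

Hypothesis posH : forall x p, posdef (Hpp H x p).

Lemma derive2_Ham x p w :
  'D_(0, w) ('D_(0, w) F) (x, p) = (w *m Hpp H x p *m w^T) 0 0.
Proof.
have z0 i : (0 : V) 0 i = 0 by rewrite mxE.
have sum2 (G : V * V -> R) z : differentiable G z ->
    'D_(0, w) G z = \sum_i w 0 i * 'D_(e2 i) G z.
  move=> dG; rewrite (derive_pair_sum 0 w dG).
  rewrite [X in X + _]big1; last by move=> i _; rewrite z0 mul0r.
  exact: add0r.
have E : 'D_(0, w) F = \sum_i (w 0 i \*: 'D_(e2 i) F).
  by apply/funext => z; rewrite (sum2 _ _ (dF z)) fct_sumE; apply: eq_bigr => i _.
have D (i : 'I_n) z u : derivable ('D_(e2 i) F) z u by exact: diff_derivable.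
rewrite E derive_sum => [|i]; last exact: derivableZ.
rewrite -mulmxA mxE; apply: eq_bigr => i _.
rewrite (deriveZ _ (D i _ _)); congr (_ * _).
rewrite (sum2 _ _ (ddF _ _)) mxE; apply: eq_bigr => j _.
by rewrite !mxE mulrC.
Qed.

(** The mean value theorem for the derivative of [H x] in the direction [p - q] produces the
    quadratic form of [Hpp] at an intermediate momentum. *)
Lemma Hp_strict_mono x p q : p != q -> 0 < dotv (p - q) (Hp H x p - Hp H x q).
Proof.
move=> pq; pose w := p - q.
have w0 : w != 0 by rewrite subr_eq0.
have [t _ E] := mean_value_line (x, q) (0, w) (ddF (0, w)).
have Hw p' : 'D_(0, w) F (x, p') = dotv w (Hp H x p').
  by rewrite derive_Ham dot0v add0r.
rewrite dotvBr -!Hw; have <- : (x, q) + (0, w) = (x, p).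
  by congr pair; rewrite /= ?addr0// addrC subrK.
rewrite E (_ : _ + _ = (x, q + t *: w)); last by congr pair; rewrite /= scaler0 addr0.
by rewrite derive2_Ham; exact: posH.
Qed.

Lemma Hp_inj x p q : Hp H x p = Hp H x q -> p = q.
Proof.
move=> pq; apply/eqP; apply: contraT => /(Hp_strict_mono x).
by rewrite pq subrr dotv0 ltxx.
Qed.

End SmoothHamiltonian.

(** * Differentials from expansions, convergence of near-minimizers, linear forms *)

Lemma is_derive_affine (R : realType) (W : normedModType R) (u w : W) (t : R) :
  is_derive t (1 : R) (fun s : R => u + s *: w) w.
Proof.
have di : differentiable (@idfun W) (u + t *: w) by exact: ex_diff.
by have := is_derive_line di; rewrite derive_id.
Qed.

Section Differentiability.
Variables (R : realType) (U : normedModType R).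

Lemma differentiable_expansion (f : U -> R) (x : U) (df : {linear U -> R}) :
  continuous df ->
  (forall e, 0 < e -> exists2 d, 0 < d & forall h, `|h| < d ->
     `|f (x + h) - f x - df h| <= e * `|h|) ->
  differentiable f x /\ 'd f x = df :> (U -> R).
Proof.
move=> cdf Hf.
have E : f \o shift x = cst (f x) + df +o_ 0 id.
  apply/eqaddoP => e e0; have [d d0 Hd] := Hf _ e0.
  near=> h.
  have -> : (f \o shift x - (cst (f x) + df)) h = f (x + h) - f x - df h.
    by rewrite -[LHS]/(f (h + x) - (f x + df h)) [h + x]addrC; lra.
  apply: Hd; have : ball 0 d h by near: h; apply: nbhsx_ballx.
  by rewrite -ball_normE /= sub0r normrN.
have D := diff_unique cdf E.
by split => //; apply/diff_locallyP; rewrite D.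
Unshelve. all: by end_near. Qed.

Lemma diff_unique_expansion (f : U -> R) (x : U) : differentiable f x ->
  forall e, 0 < e -> exists2 d, 0 < d & forall h, `|h| < d ->
     `|f (x + h) - f x - 'd f x h| <= e * `|h|.
Proof.
move=> /diff_locally/eqaddoP H e e0; have /nbhs_ballP[d /= d0 Hd] := H _ e0.
exists d => // h hd.
have -> : f (x + h) - f x - 'd f x h = (f \o shift x - (cst (f x) + 'd f x)) h.
  by rewrite -[RHS]/(f (h + x) - (f x + 'd f x h)) [h + x]addrC; lra.
by apply: Hd; rewrite -ball_normE /= sub0r normrN.
Qed.

End Differentiability.

Section ArgminContinuity.
Variables (R : realType) (n : nat) (T U : topologicalType).
Notation V := 'rV[R]_n.

Lemma cvg_unique_cluster (F : set_system T) (f : T -> V) M q0 :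
  ProperFilter F -> (\forall t \near F, `|f t| <= M) ->
  (forall q, cluster (f @ F) q -> q = q0) -> f @ F --> q0.
Proof.
move=> FF fM Hq.
(* The ball is enlarged so as to be a neighbourhood of [q0] as well. *)
have cM := @compact_cball R n (Num.max M (`|q0| + 1)).
have FK : (f @ F) [set p : V | `|p| <= Num.max M (`|q0| + 1)].
  by apply: filterS fM => t tM; rewrite /= le_max tM.
apply: (compact_cluster_set1 _ cM _ _ FK).
- exact: norm_hausdorff.
- apply/nbhs_ballP; exists 1 => //= p; rewrite -ball_normE /= => qp.
  rewrite le_max; apply/orP; right.
  by rewrite -[p](subrK q0) (le_trans (ler_normD _ _))// addrC lerD2l distrC ltW.
- apply/seteqP; split => [q /Hq ->//|_ ->].
  by have [q [_ qF]] := cM _ _ FK; rewrite -(Hq _ qF).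
Qed.

(** By continuity every cluster point [q] of [f] satisfies [Phi (u0, q) <= 0], which leaves only
    [q0], and [f] is bounded. With the gap in Fenchel's inequality as [Phi], near equality turns
    into convergence of velocities. *)
Lemma cvg_argmin (F : set_system T) (u : T -> U) u0 (f : T -> V) M
    (Phi : U * V -> R) q0 : ProperFilter F ->
  u @ F --> u0 -> continuous Phi -> (\forall t \near F, `|f t| <= M) ->
  (forall e, 0 < e -> \forall t \near F, Phi (u t, f t) < e) ->
  (forall q, Phi (u0, q) <= 0 -> q = q0) -> f @ F --> q0.
Proof.
move=> FF uu0 cPhi fM Hphi Hq; apply: (cvg_unique_cluster FF fM) => q qF.
apply: Hq; rewrite leNgt; apply/negP => P0.
pose e := Phi (u0, q) / 2.
have e0 : 0 < e by rewrite divr_gt0.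
have /cvgrPdist_lt/(_ _ e0)[[A B] /= [Au Bq] AB] :
  Phi z @[z --> (u0, q)] --> Phi (u0, q) by exact: cPhi.
have FA : F (u @^-1` A) by exact: uu0.
have FS : F (u @^-1` A `&` [set t | Phi (u t, f t) < e]).
  by apply: filterI => //; exact: Hphi.
have G : F (f @^-1` (f @` (u @^-1` A `&` [set t | Phi (u t, f t) < e]))).
  by apply: filterS FS => t [ta te]; exists t.
have [_ [[t [ta te] <-] Bt]] := qF _ _ G Bq.
have := AB (u t, f t) (conj ta Bt); rewrite /= ltr_norml => /andP[_].
rewrite ltrBlDr => /lt_trans/(_ (_ : e + Phi (u t, f t) < e + e)).
by rewrite ltrD2l => /(_ te); rewrite /e -splitr ltxx.
Qed.

End ArgminContinuity.

Lemma cvgZ_cst (R : realType) (W : normedModType R) (T : Type) (F : set_system T)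
    {FF : Filter F} (f : T -> W) (l : W) (r : R) :
  f @ F --> l -> (fun t => r *: f t) @ F --> r *: l.
Proof. by move=> fl; exact: (cvg_comp _ _ fl (@scaler_continuous _ _ r l)). Qed.

Lemma cvg_affine (R : realType) (W : normedModType R) (b : W) (r : R) (z : W) :
  b + r *: y @[y --> z] --> b + r *: z.
Proof.
have c1 : r *: y @[y --> z] --> r *: z by exact: scaler_continuous.
exact: cvgD (cvg_cst b) c1.
Qed.

Lemma continuousI (T U : topologicalType) (f : T -> U) :
  (forall w, f q @[q --> w] --> f w) -> continuous f.
Proof. by []. Qed.

Section DotContinuity.
Variables (R : realType) (n : nat).
Notation V := 'rV[R]_n.

Lemma cvg_dotv (T : Type) (F : set_system T) (f g : T -> V) (u w : V) {FF : Filter F} :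
  f @ F --> u -> g @ F --> w -> (fun t => dotv (f t) (g t)) @ F --> dotv u w.
Proof.
move=> fu gw; rewrite dotvE.
have -> : (fun t => dotv (f t) (g t)) = (fun t => \sum_i f t 0 i * g t 0 i).
  by apply/funext => t; rewrite dotvE.
apply: cvg_big => [|i _]; first exact: add_continuous.
apply: cvgM.
  exact: (cvg_comp _ _ fu (@coord_continuous _ _ _ 0 i u)).
exact: (cvg_comp _ _ gw (@coord_continuous _ _ _ 0 i w)).
Qed.

Lemma cvg_comp_pair (T : Type) (U1 U2 W : topologicalType) (F : set_system T)
    (G : U1 * U2 -> W) (f : T -> U1) (g : T -> U2) u w {FF : Filter F} :
  continuous G -> f @ F --> u -> g @ F --> w ->
  (fun t => G (f t, g t)) @ F --> G (u, w).
Proof.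
move=> cG fu gw.
have H : (fun t => (f t, g t)) @ F --> (u, w) by exact: cvg_pair.
exact: (cvg_comp _ _ H (cG (u, w))).
Qed.

Lemma continuousB_fun (U : topologicalType) (W : normedModType R) (f g : U -> W) :
  continuous f -> continuous g -> continuous (fun p => f p - g p).
Proof.
move=> cf cg p.
have c1 : f q @[q --> p] --> f p by exact: cf.
have c2 : g q @[q --> p] --> g p by exact: cg.
exact: cvgB c1 c2.
Qed.

Lemma continuous_dotvr (b : V) : continuous (fun w => dotv b w).
Proof. by apply: continuousI => w; exact: (cvg_dotv (cvg_cst b) (@cvg_id _ (nbhs w))). Qed.

End DotContinuity.

Section PairingLinear.
Variables (R : realType) (n : nat).
Notation V := 'rV[R]_n.

(** Packaged as a linear map, like [rdot] below, so that it can be the differential in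
    [differentiable_expansion]. *)
Definition pairing (a b : V) (z : V * V) : R := dotv z.1 a + dotv z.2 b.

Lemma pairing_is_linear a b : linear (pairing a b).
Proof.
move=> r z z'; rewrite /pairing /= !dotvDl !dotvZl.
by rewrite -[r *: _]/(r * _) mulrDr addrACA.
Qed.

HB.instance Definition _ a b := GRing.isLinear.Build R (V * V)%type R _ (pairing a b)
  (pairing_is_linear a b).

Lemma norm_pairing a b z : `|pairing a b z| <= n%:R * (`|a| + `|b|) * `|z|.
Proof.
rewrite /pairing; apply: le_trans (ler_normD _ _) _.
rewrite mulrDr mulrDl; apply: lerD; apply: le_trans (norm_dotv _ _) _;
  rewrite -mulrA ler_wpM2l// mulrC ler_wpM2l// prod_normE le_max lexx ?orbT//.
Qed.

Lemma continuous_pairing a b : continuous (pairing a b).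
Proof.
apply/linear_bounded_continuous/linear_boundedP.
near=> r => x; apply: le_trans (norm_pairing _ _ _) _.
by rewrite ler_wpM2r//; near: r; apply: nbhs_pinfty_ge; rewrite num_real.
Unshelve. all: by end_near. Qed.

Definition rdot (b w : V) : R := dotv w b.

Lemma rdot_is_linear b : linear (rdot b).
Proof. by move=> r z z'; rewrite /rdot dotvDl dotvZl. Qed.

HB.instance Definition _ b := GRing.isLinear.Build R V R _ (rdot b) (rdot_is_linear b).

Lemma continuous_rdot b : continuous (rdot b).
Proof.
apply/linear_bounded_continuous/linear_boundedP.
near=> r => x; rewrite /rdot; apply: le_trans (norm_dotv _ _) _.
rewrite [`|x| * _]mulrC mulrA; apply: ler_wpM2r; first by [].
by near: r; apply: nbhs_pinfty_ge; rewrite num_real.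
Unshelve. all: by end_near. Qed.

End PairingLinear.

(** * Legendre transform *)

Section Legendre.
Variables (R : realType) (n : nat).
Notation V := 'rV[R]_n.
Variable H : V -> V -> R.
Hypothesis C2F : C2 (fun z : V * V => H z.1 z.2).
Hypothesis posH : forall x p, posdef (Hpp H x p).
Hypothesis supH : superlinear H.
Hypothesis perH : periodic_x H.

Lemma Ham_bounded M : exists2 C, 0 <= C & forall x p, `|p| <= M -> `|H x p| <= C.
Proof. exact: (periodic_bounded (continuous_Ham C2F) perH). Qed.

Lemma Ham_ge_linear B : exists2 C, 0 <= C & forall x p, B * `|p| - C <= H x p.
Proof.
have [R0 HR0] := supH B.
(* [R0] may be negative; beyond [R1] the norm of [p] is positive and the quotient can be cleared. *)
pose R1 := Num.max R0 0.
have R10 : 0 <= R1 by rewrite le_max lexx orbT.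
have [C C0 HC] := Ham_bounded R1.
exists (C + `|B| * R1) => [|x p]; first by rewrite addr_ge0 ?mulr_ge0.
have [pR|pR] := lerP `|p| R1.
  have := HC x p pR; rewrite ler_norml => /andP[HC1 _].
  apply: le_trans HC1; rewrite opprD addrCA -[leRHS]addr0 lerD2l subr_le0.
  apply: le_trans (ler_norm _) _; rewrite normrM normr_id.
  by rewrite ler_wpM2l.
move: pR; rewrite gt_max => /andP[pR p0].
have := HR0 x p pR; rewrite ler_pdivlMr// => /(le_trans _); apply.
by rewrite lerBlDr lerDl addr_ge0 ?mulr_ge0.
Qed.

Lemma dotv_le (u w : V) : dotv u w <= n%:R * `|u| * `|w|.
Proof. by apply: le_trans (ler_norm _) _; rewrite -mulrA; exact: norm_dotv. Qed.

Lemma Fenchel_max x xi : exists p, forall q, dotv xi q - H x q <= dotv xi p - H x p.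
Proof.
(* As [dotv xi q <= n |xi| |q|], this growth rate leaves a margin [|q|], which makes the function
   coercive. *)
have [C C0 HC] := Ham_ge_linear (n%:R * `|xi| + 1).
pose r := C + `|H x 0|.
have r0 : 0 <= r by rewrite addr_ge0.
have c : {within [set p : V | `|p| <= r], continuous (fun p => dotv xi p - H x p)}.
  apply: continuous_subspaceT; apply: continuousB_fun; first exact: continuous_dotvr.
  by apply: continuousI => p; exact: (cvg_comp_pair (continuous_Ham C2F) (cvg_cst x) (@cvg_id _ (nbhs p))).
have [|p _ Hp] := EVT_max_rV _ (@compact_cball R n r) c.
  by exists 0; rewrite /= normr0.
exists p => q; have [qr|qr] := lerP `|q| r.
  by apply: Hp; rewrite inE.
apply: le_trans (Hp 0 _); last by rewrite inE /= normr0.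
have := HC x q; have := dotv_le xi q; have := ler_norm (H x 0).
rewrite dotv0 /r in qr *; nra.
Qed.

(** The inverse of [Hp H x], by [Hp_Pmax] and [Pmax_Hp]; [LxiE] later identifies it with [Lxi]. The
    default 0 never occurs, since [Fenchel_max] provides a maximizer. *)
Definition Pmax x xi : V := xget 0 [set p | forall q, dotv xi q - H x q <= dotv xi p - H x p].

Lemma PmaxP x xi q : dotv xi q - H x q <= dotv xi (Pmax x xi) - H x (Pmax x xi).
Proof.
rewrite /Pmax; case: xgetP => [p -> /=|]; first exact.
by have [p Hp] := Fenchel_max x xi => /(_ p).
Qed.

Lemma LagE x xi : Lag H x xi = dotv xi (Pmax x xi) - H x (Pmax x xi).
Proof.
apply/eqP; rewrite eq_le; apply/andP; split.
  apply: ge_sup; first by exists (dotv xi 0 - H x 0); exists 0.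
  by move=> _ [q _ <-]; exact: PmaxP.
apply: ub_le_sup; last by exists (Pmax x xi).
by exists (dotv xi (Pmax x xi) - H x (Pmax x xi)) => _ [q _ <-]; exact: PmaxP.
Qed.

Lemma Fenchel x xi p : dotv xi p <= Lag H x xi + H x p.
Proof. by rewrite -lerBlDr LagE; exact: PmaxP. Qed.

Lemma Hp_of_max x xi p : (forall q, dotv xi q - H x q <= dotv xi p - H x p) ->
  Hp H x p = xi.
Proof.
move=> pmax.
apply: dotv_inj => w; apply/eqP; rewrite eq_sym -subr_eq0; apply/eqP.
pose f t := dotv xi (p + t *: w) - H x (p + t *: w).
have df t : is_derive t (1 : R) f (dotv w xi - dotv w (Hp H x (p + t *: w))).
  apply: is_deriveB.
    have -> : (fun t => dotv xi (p + t *: w)) = (fun t => dotv xi p + t *: dotv w xi).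
      by apply/funext => r; rewrite dotvDr dotvZr (dotvC w).
    exact: is_derive_affine.
  have := @is_derive_line R _ _ (fun z => H z.1 z.2) (x, p) (0, w) t.
  have -> : (fun s : R => H ((x, p) + s *: (0, w)).1 ((x, p) + s *: (0, w)).2)
      = (fun s => H x (p + s *: w)) by apply/funext => s /=; rewrite scaler0 addr0.
  rewrite (_ : (x, p) + t *: (0, w) = (x, p + t *: w)); last first.
    by congr pair; rewrite /= scaler0 addr0.
  rewrite (derive_Ham C2F) dot0v add0r; apply.
  by case: C2F.
have i0 : (0 : R) \in `](-1), 1[%R by rewrite in_itv /= ltrN10 ltr01.
have D0 : is_derive (0:R) (1 : R) f 0.
  apply: (derive1_at_max _ _ i0) => [|t _|t _]; first by lra.
    by case: (df t).
  by rewrite /f scale0r addr0; exact: pmax.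
have [_ <-] := D0; have [_ ->] := df 0.
by rewrite scale0r addr0.
Qed.

Lemma Hp_Pmax x xi : Hp H x (Pmax x xi) = xi.
Proof. by apply: Hp_of_max => q; exact: PmaxP. Qed.

Lemma Pmax_Hp x p : Pmax x (Hp H x p) = p.
Proof. by apply: (Hp_inj C2F posH (x := x)); rewrite Hp_Pmax. Qed.

Lemma Lag_Hp x p : Lag H x (Hp H x p) = dotv (Hp H x p) p - H x p.
Proof. by rewrite LagE Pmax_Hp. Qed.

(** Equality in Fenchel's inequality makes [p] a maximizer, and injectivity of [Hp H x] makes
    maximizers unique. Limit velocities of calibrated curves are identified this way. *)
Lemma Fenchel_eq x xi p : Lag H x xi + H x p <= dotv xi p -> p = Pmax x xi.
Proof.
move=> E; apply: (Hp_inj C2F posH (x := x)); rewrite Hp_Pmax.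
by apply: Hp_of_max => q; have := Fenchel x xi q; lra.
Qed.

Lemma Pmax_periodic k x xi : intvec k -> Pmax (x + k) xi = Pmax x xi.
Proof.
move=> ki; apply: (Hp_inj C2F posH (x := x)).
by rewrite -(Hp_periodic perH x _ ki) !Hp_Pmax.
Qed.

Lemma Lag_periodic k x xi : intvec k -> Lag H (x + k) xi = Lag H x xi.
Proof. by move=> ki; rewrite !LagE Pmax_periodic// perH. Qed.

Lemma Lag_convex x xi eta : Lag H x xi + dotv (eta - xi) (Pmax x xi) <= Lag H x eta.
Proof.
have := Fenchel x eta (Pmax x xi).
by rewrite (LagE x xi) dotvBl; lra.
Qed.

(** The maximizer is compared with the competitor 0; growth of [H] at a rate above [n M] then bounds
    it. *)
Lemma Pmax_bounded M : exists2 C, 0 <= C & forall x xi, `|xi| <= M -> `|Pmax x xi| <= C.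
Proof.
have [C C0 HC] := Ham_ge_linear (n%:R * M + 1).
have [C' C'0 HC'] := Ham_bounded 0.
exists (C + C') => [|x xi xiM]; first exact: addr_ge0.
set p := Pmax x xi.
have := PmaxP x xi 0; rewrite dotv0 -/p.
have := HC x p; have := dotv_le xi p.
have : `|0 : V| <= 0 by rewrite normr0.
move=> /(HC' x); rewrite ler_norml => /andP[_ h0].
have : n%:R * `|xi| * `|p| <= n%:R * M * `|p| by rewrite ler_wpM2r// ler_wpM2l.
lra.
Qed.

(** The gap [|xi - Hp H x q|] vanishes exactly at [q = Pmax x xi], so [cvg_argmin] does the work of
    an inverse function theorem. *)
Lemma continuous_Pmax : continuous (fun z : V * V => Pmax z.1 z.2).
Proof.
move=> -[x xi]; have [C C0 HC] := Pmax_bounded (`|xi| + 1).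
have cPhi : continuous (fun z : (V * V) * V => `|z.1.2 - Hp H z.1.1 z.2|).
  apply: continuousI => z.
  have c0 : z'.1 @[z' --> z] --> z.1 by exact: cvg_fst.
  have c1 : z'.1.1 @[z' --> z] --> z.1.1.
    by apply: (cvg_comp _ _ c0 (H := nbhs z.1.1)); exact: cvg_fst.
  have c2 : z'.1.2 @[z' --> z] --> z.1.2.
    by apply: (cvg_comp _ _ c0 (H := nbhs z.1.2)); exact: cvg_snd.
  have c3' : z'.2 @[z' --> z] --> z.2 by exact: cvg_snd.
  have c3 : Hp H z'.1.1 z'.2 @[z' --> z] --> Hp H z.1.1 z.2 by exact: (cvg_comp_pair (continuous_Hp C2F) c1 c3').
  exact: cvg_norm (cvgB c2 c3).
apply: (cvg_argmin (u := id) (u0 := (x, xi)) (M := C) _ _ cPhi).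
- exact: cvg_id.
- have N : nbhs (x, xi) (ball (x, xi) (1 : R)) by exact: nbhsx_ballx.
  apply: filterS N => z [_]; rewrite -ball_normE /= => h; apply: HC.
  by rewrite -[z.2](subrK xi) (le_trans (ler_normD _ _))// addrC lerD2l distrC ltW.
- by move=> e e0; near=> z; rewrite /= Hp_Pmax subrr normr0.
- move=> q /=; rewrite normr_le0 subr_eq0 => /eqP ->; by rewrite Pmax_Hp.
Unshelve. all: by end_near. Qed.

End Legendre.

Section LagrangianRegularity.
Variables (R : realType) (n : nat).
Notation V := 'rV[R]_n.
Variable H : V -> V -> R.
Hypothesis C2F : C2 (fun z : V * V => H z.1 z.2).
Hypothesis posH : forall x p, posdef (Hpp H x p).
Hypothesis supH : superlinear H.
Hypothesis perH : periodic_x H.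
Notation P := (Pmax H).

Lemma Ham_mean_value x h q : exists2 t, 0 < t < 1 &
  H (x + h) q - H x q = dotv h (Hx H (x + t *: h) q).
Proof.
have dF : forall z : V * V, differentiable (fun z => H z.1 z.2) z by case: C2F.
have [t t01 E] := mean_value_line (x, q) (h, 0) dF.
exists t => //; move: E => /=; rewrite addr0 => ->.
rewrite (_ : (x, q) + t *: (h, 0) = (x + t *: h, q)); last first.
  by congr pair; rewrite /= scaler0 addr0.
by rewrite (derive_Ham C2F) dot0v addr0.
Qed.

Lemma dotv_small (e : R) (u w : V) : `|w| <= e / n.+1%:R -> `|dotv u w| <= e * `|u|.
Proof.
move=> we; apply: le_trans (norm_dotv _ _) _.
rewrite mulrCA [e * _]mulrC; apply: ler_wpM2l => //.
apply: le_trans (ler_wpM2l _ we) _ => //.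
have e0 : 0 <= e by have := le_trans (normr_ge0 w) we; rewrite pmulr_lge0 ?invr_gt0.
by rewrite mulrCA ler_piMr// ler_pdivrMr// mul1r ler_nat.
Qed.

Lemma Lag_expansion M e : 0 < e -> exists2 d, 0 < d & forall x xi h eta,
  `|xi| <= M -> `|h| < d -> `|eta| < d ->
  `|Lag H (x + h) (xi + eta) - Lag H x xi
     - (dotv h (- Hx H x (P x xi)) + dotv eta (P x xi))| <= e * (`|h| + `|eta|).
Proof.
move=> e0; pose e' := e / n.+1%:R.
have e'0 : 0 < e' by rewrite divr_gt0.
have [C C0 HC] := Pmax_bounded C2F supH perH M.
have [d2 d20 H2] := periodic_unif_cont (continuous_Hx C2F)
  (Hx_periodic perH) C e'0.
have m0 : 0 < Num.min e' d2 by rewrite lt_min e'0.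
have [d1 d10 H1] := periodic_unif_cont (continuous_Pmax C2F posH supH perH)
  (Pmax_periodic C2F posH supH perH) M m0.
exists (Num.min d1 d2) => [|x xi h eta xiM]; first by rewrite lt_min d10.
rewrite !lt_min => /andP[hd1 hd2] /andP[etad1 _].
set p := P x xi; set p' := P (x + h) (xi + eta).
have pC : `|p| <= C by exact: HC.
have /H1 : `|x - (x + h)| < d1 by rewrite opprD addNKr normrN.
have : `|xi - (xi + eta)| < d1 by rewrite opprD addNKr normrN.
move=> h1 /(_ _ _ xiM h1); rewrite /= -/p -/p' lt_min => /andP[pp'e pp'd].
have Hxe t q : 0 < t < 1 -> `|p - q| < d2 -> `|Hx H x p - Hx H (x + t *: h) q| <= e'.
  move=> /andP[t0 t1] pq; apply/ltW/H2 => //.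
  rewrite opprD addNKr normrN normrZ gtr0_norm//.
  by apply: le_lt_trans hd2; rewrite ler_piMl// ltW.
have [t t01 Ht] := Ham_mean_value x h p.
have [t' t'01 Ht'] := Ham_mean_value x h p'.
have d20' : `|p - p| < d2 by rewrite subrr normr0.
have /(dotv_small h) := Hxe t p t01 d20'.
have /(dotv_small h) := Hxe t' p' t'01 pp'd.
have /(dotv_small eta) : `|p' - p| <= e' by rewrite distrC ltW.
have F1 := Fenchel C2F supH perH (x + h) (xi + eta) p.
have F2 := Fenchel C2F supH perH x xi p'.
have L1 := LagE C2F supH perH x xi.
have L2 := LagE C2F supH perH (x + h) (xi + eta).
rewrite -/p in L1; rewrite -/p' in L2; move: F1 L2.
rewrite !dotvBr !dotvDl !dotvNr mulrDr !ler_norml.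
have := mulr_ge0 (ltW e0) (normr_ge0 eta).
lra.
Qed.

Lemma Lag_differentiable_d z :
  differentiable (fun z => Lag H z.1 z.2) z /\
  'd (fun z => Lag H z.1 z.2) z =
     pairing (- Hx H z.1 (P z.1 z.2)) (P z.1 z.2) :> (V * V -> R).
Proof.
apply: differentiable_expansion; first exact: continuous_pairing.
move=> e e0; have e20 : 0 < e / 2 by rewrite divr_gt0.
have [d d0 Hd] := Lag_expansion (`|z.2|) e20.
exists d => // -[h eta]; rewrite prod_normE /= gt_max => /andP[hd etad].
apply: le_trans (Hd _ _ _ _ (lexx _) hd etad) _.
rewrite -mulrA ler_wpM2l// ?(ltW e0)// ler_pdivrMl//.
by rewrite mulr_natl mulr2n lerD// le_max lexx ?orbT.
Qed.

Lemma Lag_differentiable z : differentiable (fun z => Lag H z.1 z.2) z.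
Proof. by case: (Lag_differentiable_d z). Qed.

Lemma LxiE x xi : Lxi H x xi = P x xi.
Proof.
apply/rowP => i; rewrite -[LHS]/(Hp (Lag H) x xi 0 i) HpE deriveE; last exact: Lag_differentiable.
have [_ ->] := Lag_differentiable_d (x, xi).
rewrite /pairing /= dot0v add0r dotvE (bigD1 i)//= big1 ?addr0.
  by rewrite mxE !eqxx mul1r.
by move=> j /negPf ji; rewrite mxE ji andbF mul0r.
Qed.

Lemma LxE x xi : Lx H x xi = - Hx H x (P x xi).
Proof.
apply/rowP => i; rewrite -[LHS]/(Hx (Lag H) x xi 0 i) HxE deriveE; last exact: Lag_differentiable.
have [_ ->] := Lag_differentiable_d (x, xi).
rewrite /pairing /= dot0v addr0 dotvE (bigD1 i)//= big1 ?addr0.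
  by rewrite [delta_mx _ _ _ _]mxE !eqxx mul1r.
by move=> j /negPf ji; rewrite [delta_mx _ _ _ _]mxE ji andbF mul0r.
Qed.

Lemma continuous_Lag : continuous (fun z : V * V => Lag H z.1 z.2).
Proof. by move=> z; apply: differentiable_continuous; exact: Lag_differentiable. Qed.

Lemma Lag_bounded M : exists2 C, 0 <= C & forall x xi, `|xi| <= M -> `|Lag H x xi| <= C.
Proof.
exact: (periodic_bounded continuous_Lag (Lag_periodic C2F posH supH perH)).
Qed.

Lemma Lag_ge_linear B : 0 <= B ->
  exists2 C, 0 <= C & forall x xi, B * `|xi| - C <= Lag H x xi.
Proof.
move=> B0; have [C C0 HC] := Ham_bounded C2F perH B.
exists C => // x xi; have [u u1 xiu] := norm_dual xi.
have uB : `|B *: u| <= B by rewrite normrZ ger0_norm// ler_piMr.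
have := Fenchel C2F supH perH x xi (B *: u).
rewrite dotvZr (dotvC xi).
have := HC x _ uB; rewrite ler_norml => /andP[_ h1].
have := ler_wpM2l B0 xiu; lra.
Qed.

(** One formula for both test functions: [step_cost] in its end point ([r1 = 0], [r2 = t^-1]) and,
    up to sign, in its starting point ([r1 = 1], [r2 = - t^-1]). *)
Lemma Lag_test_C1 (b1 b2 q : V) (r1 r2 m k : R) :
  let phi z := m * Lag H (b1 + r1 *: z) (b2 + r2 *: z) + dotv z q + k in
  C1 phi /\ forall z, grad phi z =
    m *: (r1 *: (- Hx H (b1 + r1 *: z) (P (b1 + r1 *: z) (b2 + r2 *: z)))
          + r2 *: P (b1 + r1 *: z) (b2 + r2 *: z)) + q.
Proof.
move=> phi.
pose g z := m *: (r1 *: (- Hx H (b1 + r1 *: z) (P (b1 + r1 *: z) (b2 + r2 *: z)))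
          + r2 *: P (b1 + r1 *: z) (b2 + r2 *: z)) + q.
have D z : differentiable phi z /\ 'd phi z = rdot (g z) :> (V -> R).
  apply: differentiable_expansion; first exact: continuous_rdot.
  move=> e e0; pose r := `|r1| + `|r2|.
  have r0 : 0 <= r by rewrite addr_ge0.
  have k0 : 0 < `|m| * r + 1 by rewrite ltr_wpDl// mulr_ge0.
  have e'0 : 0 < e / (`|m| * r + 1) by rewrite divr_gt0.
  have [d d0 Hd] := Lag_expansion (`|b2 + r2 *: z|) e'0.
  have r10 : 0 < r + 1 by rewrite ltr_wpDl.
  exists (d / (r + 1)) => [|h]; first by rewrite divr_gt0.
  rewrite ltr_pdivlMr// => hd.
  have h1 : `|r1 *: h| < d.
    rewrite normrZ; apply: le_lt_trans hd; rewrite mulrC ler_wpM2l//.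
    by rewrite -addrA lerDl addr_ge0.
  have h2 : `|r2 *: h| < d.
    rewrite normrZ; apply: le_lt_trans hd; rewrite mulrC ler_wpM2l//.
    by rewrite addrAC lerDr addr_ge0.
  have := Hd (b1 + r1 *: z) _ _ _ (lexx _) h1 h2.
  set A := (X in `|X| <= _ -> _); move=> HA.
  have -> : phi (z + h) - phi z - rdot (g z) h = m * A.
    rewrite /rdot /g /phi /A !scalerDr !addrA dotvDl !dotvDr !dotvZr !dotvZl.
    ring.
  rewrite normrM; apply: le_trans (ler_wpM2l _ HA) _ => //.
  rewrite !normrZ -mulrDl -/r.
  have -> : `|m| * (e / (`|m| * r + 1) * (r * `|h|)) = e * `|h| * (`|m| * r / (`|m| * r + 1)).
    by ring.
  by rewrite ler_piMr ?mulr_ge0 ?(ltW e0)// ler_pdivrMr// mul1r lerDl.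
have G z : grad phi z = g z.
  have [dphi E] := D z.
  apply/rowP => i; rewrite mxE deriveE// E /rdot dotvE (bigD1 i)//= big1 ?addr0.
    by rewrite [delta_mx _ _ _ _]mxE !eqxx mul1r.
  by move=> j /negPf ji; rewrite [delta_mx _ _ _ _]mxE ji andbF mul0r.
split; last exact: G.
split; first by move=> z; case: (D z).
have -> : grad phi = g by apply/funext.
apply: continuousI => z.
have c1 : b1 + r1 *: y @[y --> z] --> b1 + r1 *: z.
  exact: cvg_affine.
have c2 : b2 + r2 *: y @[y --> z] --> b2 + r2 *: z.
  exact: cvg_affine.
have c3 : P (b1 + r1 *: y) (b2 + r2 *: y) @[y --> z] --> P (b1 + r1 *: z) (b2 + r2 *: z).
  by exact: (cvg_comp_pair (continuous_Pmax C2F posH supH perH) c1 c2).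
have c4 : Hx H (b1 + r1 *: y) (P (b1 + r1 *: y) (b2 + r2 *: y)) @[y --> z]
     --> Hx H (b1 + r1 *: z) (P (b1 + r1 *: z) (b2 + r2 *: z)).
  by exact: (cvg_comp_pair (continuous_Hx C2F) c1 c3).
exact: cvgD (cvgZ_cst (r := m) (cvgD (cvgZ_cst (r := r1) (cvgN c4))
  (cvgZ_cst (r := r2) c3))) (cvg_cst q).
Qed.

End LagrangianRegularity.

(** * One-step inequalities from the viscosity inequalities *)

(** Passing from duration [r * t] to [t] costs [(1 - r) t (A t + e)]; over the grid [r ^+ k * t] the
    factors [(1 - r) r ^+ k t] sum to at most [t], whence [A t^2]. A fixed ratio is used because the
    slopes for durations [r * t] and [t] are then uniformly close when [r] is close to 1. *)
Lemma geometric_iteration (R : realType) (Q : R -> R -> Prop) (T A m0 : R) :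
  0 <= A -> (forall t m m', Q t m -> m <= m' -> Q t m') ->
  (forall e, 0 < e -> exists2 r, 0 < r < 1 & forall t m, 0 < t -> t <= T ->
     Q (r * t) m -> Q t (m + (1 - r) * t * (A * t + e))) ->
  (forall e, 0 < e -> exists2 s, 0 < s & forall t, 0 < t -> t <= s -> Q t (m0 + e)) ->
  forall t e, 0 < t -> t <= T -> 0 < e -> Q t (m0 + A * t ^+ 2 + e).
Proof.
move=> A0 Qm Qstep Qstart t e t0 tT e0.
(* Half of [e] is spent on the start of the iteration, half on its steps, as [t * e1 <= e / 2]. *)
pose e1 := e / (2 * (t + 1)).
have t10 : 0 < t + 1 by rewrite ltr_wpDl ?ltW.
have e10 : 0 < e1 by rewrite divr_gt0// mulr_gt0.
have [r /andP[r0 r1] Hr] := Qstep _ e10.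
have [s s0 Hs] := Qstart (e / 2) (divr_gt0 e0 (ltr0Sn _ 1)).
have iter k m : Q (r ^+ k * t) m -> Q t (m + (1 - r ^+ k) * t * (A * t + e1)).
  elim: k m => [|k IH] m; first by rewrite expr0 mul1r subrr !mul0r addr0.
  rewrite exprS -mulrA => /Hr Hk.
  have rk0 : 0 < r ^+ k by rewrite exprn_gt0.
  have rk1 : r ^+ k <= 1 by rewrite exprn_ile1// ltW.
  have rkt : r ^+ k * t <= t by rewrite ler_piMl// ltW.
  have := Hk (mulr_gt0 rk0 t0) (le_trans rkt tT) => /IH /Qm; apply.
  rewrite -addrA lerD2l.
  have -> : (1 - r * r ^+ k) * t * (A * t + e1) =
    (1 - r) * (r ^+ k * t) * (A * t + e1) + (1 - r ^+ k) * t * (A * t + e1) by ring.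
  rewrite lerD2r ler_wpM2l//; last by rewrite lerD2r ler_wpM2l.
  by rewrite !mulr_ge0 ?subr_ge0 ?ltW.
have [k Hk] : exists k, r ^+ k * t <= s.
  have := @cvg_expr R r; rewrite ger0_norm ?ltW// => /(_ r1).
  move=> /cvgrPdist_lt/(_ _ (divr_gt0 s0 t10)) [k _ /(_ k (leqnn k))].
  rewrite sub0r normrN ger0_norm ?exprn_ge0 ?ltW// => Hk; exists k.
  have rk0 : 0 < r ^+ k by rewrite exprn_gt0.
  move: Hk; rewrite ltr_pdivlMr// => /ltW; apply: le_trans.
  by rewrite ler_wpM2l ?ltW// ltrDl.
have rk0 : 0 < r ^+ k by rewrite exprn_gt0.
have rk1 : r ^+ k <= 1 by rewrite exprn_ile1// ltW.
have /iter/Qm := Hs _ (mulr_gt0 rk0 t0) Hk; apply.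
have te1 : t * e1 <= e / 2.
  rewrite /e1 mulrA ler_pdivrMr ?mulr_gt0//.
  have -> : e / 2 * (2 * (t + 1)) = e * (t + 1) by field.
  by rewrite mulrC ler_pM2l// lerDl.
have h : (1 - r ^+ k) * (t * (A * t + e1)) <= t * (A * t + e1).
  apply: ler_piMl; last by rewrite gerBl ltW.
  apply: mulr_ge0; first exact: ltW.
  by apply: addr_ge0; [apply: mulr_ge0 => //; exact: ltW|exact: ltW].
have E : t * (A * t + e1) = A * t ^+ 2 + t * e1 by ring.
rewrite -[_ * t * _]mulrA; lra.
Qed.

Section OneStep.
Variables (R : realType) (n : nat).
Notation V := 'rV[R]_n.
Variable H : V -> V -> R.
Hypothesis C2F : C2 (fun z : V * V => H z.1 z.2).
Hypothesis posH : forall x p, posdef (Hpp H x p).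
Hypothesis supH : superlinear H.
Hypothesis perH : periodic_x H.
Variables (c : V) (a : R) (v : V -> R).
Hypothesis perv : periodicT v.
Hypothesis vv : visc_sol H c a v.
Notation P := (Pmax H).
Notation L := (Lag H).

(* Action of the segment from [y] to [x] run in time [t], with the base point of
   the Lagrangian frozen at [y]. *)
Definition step_cost (t : R) (y x : V) : R :=
  t * L y (t^-1 *: (x - y)) - dotv c (x - y) + t * a.

Let cv : continuous v. Proof. by case: vv. Qed.

Lemma v_bounded : exists2 B, 0 <= B & forall x, `|v x| <= B.
Proof.
have cF : continuous (fun z : V * V => v z.1).
  apply: continuousI => z; have h : v y @[y --> z.1] --> v z.1 by exact: cv.
  by apply: (cvg_comp _ _ _ h); exact: cvg_fst.
have perF k x (p : V) : intvec k -> (fun z : V * V => v z.1) (x + k, p) = v x.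
  exact: perv.
have [B B0 HB] := periodic_bounded cF perF 0.
by exists B => // x; apply: (HB x 0); rewrite normr0.
Qed.

Lemma v_unif_cont e : 0 < e -> exists2 d, 0 < d & forall x y, `|x - y| < d -> `|v x - v y| < e.
Proof.
move=> e0.
have cF : continuous (fun z : V * V => v z.1).
  apply: continuousI => z; have h : v y @[y --> z.1] --> v z.1 by exact: cv.
  by apply: (cvg_comp _ _ _ h); exact: cvg_fst.
have perF k x (p : V) : intvec k -> (fun z : V * V => v z.1) (x + k, p) = v x.
  exact: perv.
have [d d0 Hd] := periodic_unif_cont cF perF 0 e0.
by exists d => // x y xy; apply: (Hd x y 0 0); rewrite ?subrr ?normr0.
Qed.

(** The perspective [t L(y, d / t)] is convex in [t], with derivative [- H y p] at the momentum [p]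
    of the step. The bound is Fenchel's inequality for duration [t], tested with the momentum that
    is optimal for duration [s]. *)
Lemma rho_perspective s t y x : 0 < s -> 0 < t ->
  step_cost s y x - step_cost t y x <= (t - s) * (H y (P y (s^-1 *: (x - y))) - a).
Proof.
move=> s0 t0; set d := x - y; set p := P y _.
have E : s * L y (s^-1 *: d) = dotv d p - s * H y p.
  rewrite (LagE C2F supH perH) -/p dotvZl mulrBr mulrA divff ?gt_eqF//.
  by rewrite mul1r.
have := ler_wpM2l (ltW t0) (Fenchel C2F supH perH y (t^-1 *: d) p).
rewrite dotvZl mulrA divff ?gt_eqF// mul1r mulrDr /step_cost -/d E.
lra.
Qed.

Lemma rho_ge_linear B : 0 <= B -> exists2 C, 0 <= C & forall t y x, 0 < t ->
  B * `|x - y| - C * t <= step_cost t y x.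
Proof.
move=> B0; have B'0 : 0 <= B + n%:R * `|c| by rewrite addr_ge0 ?mulr_ge0.
have [C C0 HC] := Lag_ge_linear C2F supH perH B'0.
exists (C + `|a|) => [|t y x t0]; first exact: addr_ge0.
have := ler_wpM2l (ltW t0) (HC y (t^-1 *: (x - y))).
have ti0 : 0 <= t^-1 by rewrite invr_ge0 ltW.
have E : t * (t^-1 * `|x - y|) = `|x - y| by rewrite mulrA divff ?gt_eqF// mul1r.
rewrite normrZ (ger0_norm ti0) mulrBr mulrCA E.
have := dotv_le c (x - y); have := ler_wpM2l (ltW t0) (ler_norm (- a)).
rewrite normrN /step_cost; nra.
Qed.

Lemma rho_diag t y : step_cost t y y = t * (L y 0 + a).
Proof. by rewrite /step_cost subrr scaler0 dotv0 subr0 mulrDr. Qed.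

Lemma rho_C1_r t y : 0 < t -> C1 (step_cost t y) /\
  forall x, c + grad (step_cost t y) x = P y (t^-1 *: (x - y)).
Proof.
move=> t0.
have := Lag_test_C1 C2F posH supH perH y (- (t^-1 *: y)) (- c) 0 t^-1 t (dotv c y + t * a).
rewrite /= (_ : (fun z => _) = step_cost t y); last first.
  apply/funext => x; rewrite /step_cost scale0r addr0 [_ + t^-1 *: x]addrC -scalerBr.
  by rewrite dotvBr dotvNr (dotvC x); lra.
move=> [h1 h2]; split => // x; rewrite h2 !scale0r add0r addr0.
by rewrite scalerA divff ?gt_eqF// scale1r [_ + t^-1 *: x]addrC -scalerBr addrC subrK.
Qed.

Lemma rho_C1_l t x : 0 < t -> C1 (fun y => - step_cost t y x) /\
  forall y, c + grad (fun y => - step_cost t y x) y =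
    P y (t^-1 *: (x - y)) + t *: Hx H y (P y (t^-1 *: (x - y))).
Proof.
move=> t0.
have := Lag_test_C1 C2F posH supH perH 0 (t^-1 *: x) (- c) 1 (- t^-1) (- t) (dotv c x - t * a).
have E (y : V) : t^-1 *: x + - t^-1 *: y = t^-1 *: (x - y).
  by rewrite scaleNr -scalerBr.
rewrite /= (_ : (fun z => _) = (fun y => - step_cost t y x)); last first.
  apply/funext => y; rewrite /step_cost scale1r add0r E.
  by rewrite dotvBr dotvNr (dotvC y); lra.
move=> [h1 h2]; split => // y; rewrite h2 E scale1r add0r scale1r scalerDr.
rewrite scalerN scaleNr opprK scalerA mulrNN divff ?gt_eqF// scale1r.
by rewrite addrCA subrr addr0 addrC.
Qed.

Lemma C1_continuous (f : V -> R) : C1 f -> continuous f.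
Proof. by case=> df _ x; apply: differentiable_continuous; exact: df. Qed.

Lemma coercive_max (f : V -> R) (y : V) K : continuous f ->
  (forall x, f x <= K - `|x - y|) -> exists x0, forall x, f x <= f x0.
Proof.
move=> cf Hf; pose r := `|y| + (`|K| + `|f y|).
have [|x0 _ Hx0] := EVT_max_rV _ (@compact_cball R n r) (continuous_subspaceT cf).
  by exists y; rewrite /= lerDl addr_ge0.
have yr : y \in [set p : V | `|p| <= r] by rewrite inE /= lerDl addr_ge0.
exists x0 => x; have [xr|xr] := lerP `|x| r; first by apply: Hx0; rewrite inE.
apply: le_trans (Hx0 _ yr); apply: le_trans (Hf x) _.
have := ler_normD (x - y) y; rewrite subrK.
have := ler_norm K; have := ler_norm (- f y); rewrite normrN; rewrite /r in xr *.
lra.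
Qed.

Lemma sub_max t y : 0 < t -> exists x0,
  (forall x, v x - step_cost t y x <= v x0 - step_cost t y x0) /\ H x0 (P y (t^-1 *: (x0 - y))) <= a.
Proof.
move=> t0; have [C1r g1] := rho_C1_r y t0.
have [B B0 HB] := v_bounded; have [C C0 HC] := rho_ge_linear (@ler01 R).
have [x0 Hx0] : exists x0, forall x, v x - step_cost t y x <= v x0 - step_cost t y x0.
  apply: (@coercive_max (fun x => v x - step_cost t y x) y (B + C * t)).
    exact: continuousB_fun (C1_continuous C1r).
  move=> x; have := HC t y x t0; have := HB x; rewrite ler_norml => /andP[_].
  by rewrite mul1r; lra.
exists x0; split => //; rewrite -g1; case: vv => _ [sub _]; apply: sub => //.
by near=> x; exact: Hx0.
Unshelve. all: by end_near. Qed.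

Lemma super_min t x : 0 < t -> exists y0,
  (forall y, v y0 + step_cost t y0 x <= v y + step_cost t y x) /\
  a <= H y0 (P y0 (t^-1 *: (x - y0)) + t *: Hx H y0 (P y0 (t^-1 *: (x - y0)))).
Proof.
move=> t0; have [C1r g1] := rho_C1_l x t0.
have [B B0 HB] := v_bounded; have [C C0 HC] := rho_ge_linear (@ler01 R).
have [y0 Hy0] : exists y0, forall y, - step_cost t y x - v y <= - step_cost t y0 x - v y0.
  apply: (@coercive_max (fun y => - step_cost t y x - v y) x (B + C * t)).
    exact: continuousB_fun (C1_continuous C1r) cv.
  move=> y; have := HC t y x t0; have := HB y; rewrite ler_norml => /andP[+ _].
  by rewrite mul1r distrC; lra.
exists y0; split => [y|]; first by have := Hy0 y; lra.
rewrite -g1; case: vv => _ [_ sup]; apply: sup => //.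
by near=> y; have := Hy0 y; lra.
Unshelve. all: by end_near. Qed.

End OneStep.

Section OneStepEstimates.
Variables (R : realType) (n : nat).
Notation V := 'rV[R]_n.
Variable H : V -> V -> R.
Hypothesis C2F : C2 (fun z : V * V => H z.1 z.2).
Hypothesis posH : forall x p, posdef (Hpp H x p).
Hypothesis supH : superlinear H.
Hypothesis perH : periodic_x H.
Variables (c : V) (a : R) (v : V -> R).
Hypothesis perv : periodicT v.
Hypothesis vv : visc_sol H c a v.
Notation P := (Pmax H).
Notation L := (Lag H).
Notation rho := (step_cost H c a).

Let cv : continuous v. Proof. by case: vv. Qed.

Lemma HamPmax_unif_cont M e : 0 < e -> exists2 d, 0 < d & forall x xi xi',
  `|xi| <= M -> `|xi - xi'| < d -> `|H x (P x xi) - H x (P x xi')| < e.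
Proof.
move=> e0.
have cG : continuous (fun z : V * V => H z.1 (P z.1 z.2)).
  apply: continuousI => z.
  have c1 : z'.1 @[z' --> z] --> z.1 by exact: cvg_fst.
  have c2 : P z'.1 z'.2 @[z' --> z] --> P z.1 z.2.
    exact: (continuous_Pmax C2F posH supH perH).
  exact: (cvg_comp_pair (continuous_Ham C2F) c1 c2).
have perG (k x xi : V) : intvec k -> (fun z : V * V => H z.1 (P z.1 z.2)) (x + k, xi) = H x (P x xi).
  by move=> ki /=; rewrite perH// (Pmax_periodic C2F posH supH perH).
have [d d0 Hd] := periodic_unif_cont cG perG M e0.
exists d => // x xi xi' xiM xixi'; apply: Hd => //.
by rewrite subrr normr0.
Qed.

Lemma Hp_bounded M : exists2 C, 0 <= C & forall x p, `|p| <= M -> `|Hp H x p| <= C.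
Proof. exact: (periodic_bounded (continuous_Hp C2F) (Hp_periodic perH)). Qed.

Lemma Hx_bounded M : exists2 C, 0 <= C & forall x p, `|p| <= M -> `|Hx H x p| <= C.
Proof. exact: (periodic_bounded (continuous_Hx C2F) (Hx_periodic perH)). Qed.

Lemma sublevel_bounded E : exists2 M, 0 <= M & forall x p, H x p <= E -> `|p| <= M.
Proof.
have [C C0 HC] := Ham_ge_linear C2F supH perH 1.
exists `|C + E| => // x p Hxp; have := HC x p; have := ler_norm (C + E).
rewrite mul1r; lra.
Qed.

(** At the maximizer [x0] for duration [t] the subsolution inequality gives [H x0 p <= a], whereas
    [rho_perspective] asks for [H] at [y] and the momentum for duration [r * t]. Moving from [x0] to
    [y] costs [K * Xi * t], since [H x0 p <= a] also bounds the speed by [Xi]; changing the momentum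
    costs [e]. *)
Lemma sub_step : exists2 C, 0 <= C & forall t y x, 0 < t ->
  v x <= v y + rho t y x + C * t ^+ 2.
Proof.
have [M M0 HM] := sublevel_bounded a.
have [Xi Xi0 HXi] := Hp_bounded M.
have [K K0 HK] := Ham_lipschitz C2F perH M.
exists (K * Xi); first exact: mulr_ge0.
move=> T y x T0; apply/ler_addgt0Pr => e e0.
pose Q t m := forall x, v x - rho t y x <= m.
suff : Q T (v y + K * Xi * T ^+ 2 + e) by move=> /(_ x); lra.
apply: geometric_iteration (lexx T) e0 => //; first exact: mulr_ge0.
- by move=> t m m' Hm mm' z; apply: le_trans mm'.
- move=> {}e e0; have [d d0 Hd] := HamPmax_unif_cont Xi e0.
  have Xi10 : 0 < Xi + 1 by rewrite ltr_wpDl.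
  (* Then [(r^-1 - 1) * Xi < d], so the slopes for the two durations are within the modulus [d]. *)
  pose r := (1 + d / (Xi + 1))^-1.
  have dX0 : 0 < d / (Xi + 1) by rewrite divr_gt0.
  have r10 : 0 < 1 + d / (Xi + 1) by rewrite ltr_wpDl.
  have r0 : 0 < r by rewrite invr_gt0.
  have r1 : r < 1 by rewrite invf_lt1// ltrDl.
  exists r; first by rewrite r0.
  move=> t m t0 _ Hm z.
  have [x0 [Hx0 Hxa]] := sub_max C2F posH supH perH perv vv y t0.
  apply: le_trans (Hx0 z) _.
  have rt0 : 0 < r * t by rewrite mulr_gt0.
  have := Hm x0; have := rho_perspective C2F supH perH c a y x0 rt0 t0.
  move: Hxa; set xi := t^-1 *: (x0 - y); set p := P y xi => Hxa.
  have -> : (r * t)^-1 *: (x0 - y) = r^-1 *: xi by rewrite invfM scalerA.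
  have pM : `|p| <= M by exact: HM Hxa.
  have xiE : Hp H y p = xi by exact: Hp_Pmax.
  have xiX : `|xi| <= Xi by rewrite -xiE HXi.
  have h1 : `|H y p - H y (P y (r^-1 *: xi))| < e.
    apply: Hd => //; rewrite -[X in X - _]scale1r -scalerBl normrZ.
    rewrite /r invrK opprD addrA subrr sub0r normrN gtr0_norm//.
    rewrite mulrAC ltr_pdivrMr// ltr_pM2l//.
    by apply: le_lt_trans xiX _; rewrite ltrDl.
  have h2 : `|H y p - H x0 p| <= K * (Xi * t).
    apply: le_trans (HK _ _ _ _ pM pM) _; rewrite subrr normr0 addr0 ler_wpM2l//.
    have -> : y - x0 = - (t *: xi) by rewrite scalerA divff ?gt_eqF// scale1r opprB.
    by rewrite normrN normrZ gtr0_norm// mulrC ler_wpM2r// ltW.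
  move: h1 h2; rewrite ltr_norml ler_norml => /andP[h1 _] /andP[_ h2].
  have rt1 : 0 < (1 - r) * t by rewrite mulr_gt0 ?subr_gt0.
  have -> : t - r * t = (1 - r) * t by rewrite mulrBl mul1r.
  have h3 : (1 - r) * t * (H y (P y (r^-1 *: xi)) - a) <= (1 - r) * t * (K * Xi * t + e).
    rewrite ler_pM2l//; rewrite -[K * Xi * t]mulrA; lra.
  move: h3; lra.
- move=> {}e e0; have e20 : 0 < e / 2 by rewrite divr_gt0.
  have [d d0 Hd] := v_unif_cont perv vv e20.
  have [B B0 HB] := v_bounded perv vv.
  (* The bound [e / 2 + 2 B / d * |z - y|] on the increment of [v] covers points closer than [d], by
     the modulus, and the others, by the oscillation [2 B]. A cost growing at rate [2 B / d] absorbs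
     it. *)
  have B20 : 0 <= 2 * B / d by rewrite divr_ge0 ?mulr_ge0// ltW.
  have [C C0 HC] := rho_ge_linear C2F supH perH c a B20.
  have C10 : 0 < C + 1 by rewrite ltr_wpDl.
  exists (e / 2 / (C + 1)); first by rewrite divr_gt0.
  move=> t t0; rewrite ler_pdivlMr// => te z.
  have := HC t y z t0.
  have : v z - v y <= e / 2 + 2 * B / d * `|z - y|.
    have [zy|zy] := ltP `|z - y| d.
      have := Hd _ _ zy; rewrite ltr_norml => /andP[_ /ltW h].
      by apply: le_trans h _; rewrite lerDl mulr_ge0.
    have h1 : v z - v y <= 2 * B.
      have := HB z; have := HB y; rewrite !ler_norml => /andP[? ?] /andP[? ?]; lra.
    have h2 : 2 * B <= 2 * B / d * `|z - y|.
      by rewrite mulrAC ler_pdivlMr// ler_wpM2l// mulr_ge0.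
    lra.
  lra.
Qed.

(** A segment of unit speed, [t = |x - y|], has cost linear in the distance; beyond distance 1
    boundedness of [v] suffices. *)
Lemma v_lipschitz : exists2 K, 0 <= K & forall x y, v x - v y <= K * `|x - y|.
Proof.
have [C C0 HC] := sub_step.
have [B B0 HB] := v_bounded perv vv.
have [D D0 HD] := Lag_bounded C2F posH supH perH 1.
exists (D + n%:R * `|c| + `|a| + C + 2 * B); first by rewrite !addr_ge0 ?mulr_ge0.
move=> x y; have [->|xy] := eqVneq x y; first by rewrite !subrr normr0 mulr0.
set t := `|x - y|; have t0 : 0 < t by rewrite normr_gt0 subr_eq0.
have [t1|t1] := lerP 1 t.
  have h1 : v x - v y <= 2 * B.
    have := HB x; have := HB y; rewrite !ler_norml => /andP[? ?] /andP[? ?]; lra.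
  apply: le_trans h1 _; apply: le_trans (_ : 2 * B * t <= _); first by rewrite ler_peMr ?mulr_ge0.
  by rewrite ler_pM2r// lerDr !addr_ge0 ?mulr_ge0.
have := HC t y x t0; rewrite /step_cost.
have : `|t^-1 *: (x - y)| <= 1 by rewrite normrZ gtr0_norm ?invr_gt0// mulVf ?gt_eqF.
move=> /(HD y) /(le_trans (ler_norm _)) /(ler_wpM2l (ltW t0)) h1.
have h2 := dotv_le (- c) (x - y); rewrite dotvNl normrN -/t in h2.
have h3 := ler_wpM2l (ltW t0) (ler_norm a).
have h4 : C * t ^+ 2 <= C * t by rewrite ler_wpM2l// expr2 ler_piMr// ltW.
have h5 := mulr_ge0 B0 (ltW t0).
lra.
Qed.

(** Mirrors [sub_step], with the minimizer taken at the shorter duration. The inequality [a <= H]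
    does not bound momenta, so the speed bound comes from comparing the minimizer with [y = x] and
    from [v_lipschitz], which rests on [sub_step]. *)
Lemma super_step : exists2 C, 0 <= C & exists2 Xi, 0 <= Xi & forall t x, 0 < t -> t <= 1 ->
  exists y, v y + rho t y x <= v x + C * t ^+ 2 /\ `|x - y| <= Xi * t.
Proof.
have [Kv Kv0 HKv] := v_lipschitz.
have [C C0 HC] := rho_ge_linear C2F supH perH c a (addr_ge0 Kv0 (@ler01 R)).
have [D D0 HD] := Lag_bounded C2F posH supH perH 1.
pose Xi := C + D + `|a|.
have Xi0 : 0 <= Xi by rewrite !addr_ge0.
have [P1 P10 HP1] := Pmax_bounded C2F supH perH Xi.
have [X1 X10 HX1] := Hx_bounded P1.
(* [P1 + X1] bounds the perturbed momentum [p + (r * t) *: Hx H y p], as [r * t <= 1]. *)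
have [K K0 HK] := Ham_lipschitz C2F perH (P1 + X1).
have minb t x y0 : 0 < t -> (forall y, v y0 + rho t y0 x <= v y + rho t y x) ->
    `|x - y0| <= Xi * t.
  move=> t0 /(_ x); rewrite rho_diag; have := HC t y0 x t0; have := HKv x y0.
  have : `|0 : V| <= 1 by rewrite normr0.
  move=> /(HD x) /(le_trans (ler_norm _)) /(ler_wpM2l (ltW t0)).
  have := ler_wpM2l (ltW t0) (ler_norm a); rewrite /Xi; lra.
exists (K * X1); first exact: mulr_ge0.
exists Xi => // T x T0 T1.
have [y0 [miny0 _]] := super_min C2F posH supH perH perv vv x T0.
exists y0; split; last exact: minb miny0.
apply/ler_addgt0Pr => e e0.
pose Q t m := exists y, v y + rho t y x <= m.
suff [y Hy] : Q T (v x + K * X1 * T ^+ 2 + e) by apply: le_trans (miny0 y) _.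
apply: (@geometric_iteration _ _ 1) => //; first exact: mulr_ge0.
- by move=> t m m' [y Hy] mm'; exists y; apply: le_trans mm'.
- move=> {e e0} e e0; have [d d0 Hd] := HamPmax_unif_cont Xi e0.
  have Xi10 : 0 < Xi + 1 by rewrite ltr_wpDl.
  have dX0 : 0 < d / (Xi + 1) by rewrite divr_gt0.
  have dX1 : 0 < 1 + d / (Xi + 1) by rewrite ltr_wpDl.
  pose r := (1 + d / (Xi + 1))^-1.
  have r0 : 0 < r by rewrite invr_gt0.
  have r1 : r < 1 by rewrite invf_lt1// ltrDl.
  have rX : Xi * (1 - r) < d.
    have rE : r * (1 + d / (Xi + 1)) = 1 by rewrite mulVf// gt_eqF.
    have -> : 1 - r = r * (d / (Xi + 1)) by move: rE; rewrite mulrDr mulr1; lra.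
    have Xd : Xi * (d / (Xi + 1)) < d.
      by rewrite mulrA ltr_pdivrMr// mulrC ltr_pM2l// ltrDl.
    have Xd0 : 0 <= Xi * (d / (Xi + 1)) by rewrite mulr_ge0// ltW.
    by apply: le_lt_trans Xd; rewrite mulrCA; apply: ler_piMl => //; exact: ltW.
  exists r; first by rewrite r0.
  move=> t m t0 t1 [y1 Hy1].
  have s0 : 0 < r * t by rewrite mulr_gt0.
  have s1 : r * t <= 1 by apply: mulr_ile1 => //; exact: ltW.
  have [y [miny Hya]] := super_min C2F posH supH perH perv vv x s0.
  exists y; have Hm := le_trans (miny y1) Hy1.
  have yb := minb _ _ _ s0 miny.
  have := rho_perspective C2F supH perH c a y x t0 s0.
  move: Hya; set xi := (r * t)^-1 *: (x - y); set p := P y xi => Hya.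
  have -> : t^-1 *: (x - y) = r *: xi.
    by rewrite scalerA invfM mulrA divff ?gt_eqF// mul1r.
  have xiX : `|xi| <= Xi.
    by rewrite normrZ gtr0_norm ?invr_gt0// mulrC ler_pdivrMr.
  have h1 : `|H y p - H y (P y (r *: xi))| < e.
    apply: Hd => //; rewrite -[X in X - _]scale1r -scalerBl normrZ.
    rewrite gtr0_norm ?subr_gt0//; apply: le_lt_trans rX.
    by rewrite mulrC ler_wpM2r// subr_ge0 ltW.
  have pP : `|p| <= P1 by exact: HP1.
  have XX : `|Hx H y p| <= X1 by exact: HX1.
  have h2 : `|H y (p + (r * t) *: Hx H y p) - H y p| <= K * (X1 * t).
    have b1 : `|(r * t) *: Hx H y p| <= r * t * X1.
      by rewrite normrZ gtr0_norm// ler_pM2l.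
    apply: le_trans (HK _ _ _ _ _ _) _.
    - apply: le_trans (ler_normD _ _) _; rewrite lerD//.
      by apply: le_trans b1 _; rewrite ler_piMl.
    - by apply: le_trans pP _; rewrite lerDl.
    - rewrite subrr normr0 add0r addrAC subrr add0r ler_wpM2l//.
      apply: le_trans b1 _; rewrite mulrC ler_wpM2l// ler_piMl// ltW//.
  move: h1 h2; rewrite ltr_norml ler_norml => /andP[_ h1] /andP[_ h2].
  have rt1 : 0 < (1 - r) * t by rewrite mulr_gt0 ?subr_gt0.
  have -> : r * t - t = - ((1 - r) * t) by ring.
  have h3 : (1 - r) * t * (a - H y (P y (r *: xi))) <= (1 - r) * t * (K * X1 * t + e).
    rewrite ler_pM2l//; rewrite -[K * X1 * t]mulrA; lra.
  move: h3; lra.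
- move=> {e e0} e e0; pose E := `|L x 0 + a| + 1.
  have E0 : 0 < E by rewrite ltr_wpDl.
  exists (e / E); first by rewrite divr_gt0.
  move=> t t0; rewrite ler_pdivlMr// => tE; exists x; rewrite rho_diag lerD2l.
  apply: le_trans tE; rewrite ler_pM2l// /E (le_trans (ler_norm _))// lerDl//.
Qed.

End OneStepEstimates.

(** * Regularity along calibrated curves *)

Section Gradients.
Variables (R : realType) (n : nat).
Notation V := 'rV[R]_n.

Lemma diff_grad (f : V -> R) x h : differentiable f x -> 'd f x h = dotv h (grad f x).
Proof.
move=> df; rewrite {1}(row_sum_delta h) linear_sum dotvE.
by apply: eq_bigr => i _; rewrite linearZ mxE deriveE.
Qed.

Lemma grad_expansion (f : V -> R) x : differentiable f x ->
  forall e, 0 < e -> exists2 d, 0 < d & forall h, `|h| < d ->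
    `|f (x + h) - f x - dotv h (grad f x)| <= e * `|h|.
Proof.
move=> df e e0; have [d d0 Hd] := diff_unique_expansion df e0.
by exists d => // h /Hd; rewrite diff_grad.
Qed.

Lemma differentiable_of_expansion (f : V -> R) x q :
  (forall e, 0 < e -> exists2 d, 0 < d & forall h, `|h| < d ->
    `|f (x + h) - f x - dotv h q| <= e * `|h|) ->
  differentiable f x /\ grad f x = q.
Proof.
move=> Hq; have [df E] := @differentiable_expansion _ _ f x (rdot q) (@continuous_rdot _ _ q) Hq.
by split => //; apply: dotv_inj => h; rewrite -diff_grad// E.
Qed.

Lemma dotv_littleo (q : V) : (forall e, 0 < e -> exists2 d, 0 < d & forall h, `|h| < d ->
    dotv h q <= e * `|h|) -> q = 0.
Proof.
move=> Hq; apply/eqP; rewrite -normr_le0; apply/ler_addgt0Pr => e e0; rewrite add0r.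
have [d d0 Hd] := Hq _ e0; have [u u1 qu] := norm_dual q.
have d20 : 0 < d / 2 by rewrite divr_gt0.
have ud : `|(d / 2) *: u| <= d / 2.
  by rewrite normrZ gtr0_norm// ler_piMr// ltW.
have ud' : `|(d / 2) *: u| < d by apply: le_lt_trans ud _; rewrite ltr_pdivrMr// ltr_pMr// ltr1n.
have := Hd _ ud'; rewrite dotvZl => h.
have h1 := ler_wpM2l (ltW d20) qu; have h2 := ler_wpM2l (ltW e0) ud.
by rewrite -(ler_pM2l d20); lra.
Qed.

Lemma two_sided_differentiable (f : V -> R) x q1 q2 :
  (forall e, 0 < e -> exists2 d, 0 < d & forall h, `|h| < d ->
    f (x + h) - f x <= dotv h q1 + e * `|h|) ->
  (forall e, 0 < e -> exists2 d, 0 < d & forall h, `|h| < d ->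
    f x - f (x + h) <= dotv h q2 + e * `|h|) ->
  differentiable f x /\ grad f x = q1.
Proof.
move=> H1 H2.
(* Adding the two expansions cancels [f] and leaves [dotv h (- (q1 + q2)) <= e |h|] for small
   [h]. *)
have q12 : - (q1 + q2) = 0.
  apply: dotv_littleo => e e0; have e20 : 0 < e / 2 by rewrite divr_gt0.
  have [d1 d10 Hd1] := H1 _ e20; have [d2 d20 Hd2] := H2 _ e20.
  exists (Num.min d1 d2) => [|h]; first by rewrite lt_min d10.
  rewrite lt_min => /andP[/Hd1 h1 /Hd2 h2]; rewrite dotvNr dotvDr; lra.
have {}q12 : q2 = - q1 by apply/eqP; rewrite -addr_eq0 addrC -oppr_eq0 q12.
apply: differentiable_of_expansion => e e0.
have [d1 d10 Hd1] := H1 _ e0; have [d2 d20 Hd2] := H2 _ e0.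
exists (Num.min d1 d2) => [|h]; first by rewrite lt_min d10.
rewrite lt_min => /andP[/Hd1 h1 /Hd2]; rewrite q12 dotvNr => h2.
rewrite ler_norml; apply/andP; split; lra.
Qed.

Lemma bounded_accumulation (f : nat -> V) M : (forall N, `|f N| <= M) ->
  exists q, forall N0 d, 0 < d -> exists2 N, (N0 <= N)%N & `|f N - q| < d.
Proof.
move=> fM; have FM : (f @ \oo) [set p : V | `|p| <= M] by exists 0%N => // N _; exact: fM.
have [q [_ qF]] := @compact_cball R n M _ _ FM.
exists q => N0 d d0.
have FN : (f @ \oo) (f @` [set N | (N0 <= N)%N]) by exists N0 => // N NN; exists N.
have [_ [[N NN <-]]] := qF _ _ FN (nbhsx_ballx q d d0).
by rewrite -ball_normE /= distrC; exists N.
Qed.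

End Gradients.

Section Calibrated.
Variables (R : realType) (n : nat).
Notation V := 'rV[R]_n.
Variable H : V -> V -> R.
Hypothesis C2F : C2 (fun z : V * V => H z.1 z.2).
Hypothesis posH : forall x p, posdef (Hpp H x p).
Hypothesis supH : superlinear H.
Hypothesis perH : periodic_x H.
Variables (c : V) (a : R) (v : V -> R).
Hypothesis perv : periodicT v.
Hypothesis vv : visc_sol H c a v.
Notation P := (Pmax H).
Notation L := (Lag H).
Notation rho := (step_cost H c a).

(* The quadratic error is what the viscosity inequalities yield for one step;
   summed over [N] steps of length [t / N] it is [C t^2 / N], hence harmless. *)
Definition qcal (C Xi : R) (g : R -> V) : Prop := forall r s, r < s -> s <= 0 ->
  `|g s - g r| <= Xi * (s - r) /\
  (s - r <= 1 -> v (g r) + rho (s - r) (g r) (g s) <= v (g s) + C * (s - r) ^+ 2).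

(** The velocity [Hp H x p] gives equality in Fenchel's inequality, so [sub_step] in that direction,
    divided by [t], becomes [H x p <= a]. This avoids constructing a [C1] function that touches [v]
    at [x]. *)
Lemma Ham_grad_le x : differentiable v x -> H x (c + grad v x) <= a.
Proof.
move=> dv; have [C C0 HC] := sub_step C2F posH supH perH perv vv.
set p := c + grad v x; pose eta := Hp H x p.
apply/ler_addgt0Pr => e e0.
have e1 : 0 < e / (2 * (`|eta| + 1)) by rewrite divr_gt0// mulr_gt0// ltr_wpDl.
have [d d0 Hd] := grad_expansion dv e1.
pose t := Num.min (d / (`|eta| + 1)) (e / (2 * (C + 1))).
have eta1 : 0 < `|eta| + 1 by rewrite ltr_wpDl.
have C1 : 0 < C + 1 by rewrite ltr_wpDl.
have t0 : 0 < t by rewrite lt_min !divr_gt0// mulr_gt0.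
have td : t * (`|eta| + 1) <= d by rewrite -ler_pdivlMr// ge_min lexx.
have te : t * (2 * (C + 1)) <= e by rewrite -ler_pdivlMr ?mulr_gt0// ge_min lexx orbT.
have hd : `|t *: eta| < d.
  by rewrite normrZ gtr0_norm//; apply: lt_le_trans td; rewrite ltr_pM2l// ltrDl.
have := Hd _ hd; rewrite ler_norml => /andP[h1 _].
have := HC t x (x + t *: eta) t0.
rewrite /step_cost (_ : x + t *: eta - x = t *: eta); last by rewrite addrAC subrr add0r.
rewrite scalerA mulVf ?gt_eqF// scale1r dotvZr.
rewrite {1}/eta (Lag_Hp C2F posH supH perH) -/eta.
move: h1; rewrite dotvZl normrZ gtr0_norm// => h1 h2.
have h3 : e / (2 * (`|eta| + 1)) * (t * `|eta|) <= t * (e / 2).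
  rewrite mulrCA ler_pM2l// mulrAC ler_pdivrMr ?mulr_gt0//.
  have -> : e / 2 * (2 * (`|eta| + 1)) = e * (`|eta| + 1) by field.
  by rewrite ler_pM2l// lerDl.
have h4 : C * t ^+ 2 <= t * (e / 2).
  rewrite expr2 mulrCA ler_pM2l//.
  have := mulr_ge0 (ltW t0) C0; lra.
rewrite -(ler_pM2l t0); move: h2; rewrite /p dotvDr (dotvC eta c); lra.
Qed.

Section NStep.
Variables (C Xi : R) (g : R -> V).
Hypotheses (C0 : 0 <= C) (Xi0 : 0 <= Xi) (qg : qcal C Xi g).

Lemma slope_bounded r s : r < s -> s <= 0 -> `|(s - r)^-1 *: (g s - g r)| <= Xi.
Proof.
move=> rs s0; have sr0 : 0 < s - r by rewrite subr_gt0.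
rewrite normrZ gtr0_norm ?invr_gt0// mulrC ler_pdivrMr//.
by case: (qg rs s0).
Qed.

(* Translating the curve by [(al + be * s) h] changes the cost of the step from
   [r] to [s] by [(s - r) * dotv h (mixed_slope al be r s)] at first order. *)
Definition mixed_slope (al be r s : R) : V :=
  let p := P (g r) ((s - r)^-1 *: (g s - g r)) in
  (al + be * r) *: (- Hx H (g r) p) + be *: (p - c).

(** Calibration bounds the increment of [v] along the chain from below and [sub_step] bounds it
    along the translated chain from above. The difference is linear in [h], up to [o(h)] and [K t^2]
    per step. With [N] steps the latter sum to [K T^2 / N], while the linear parts stay bounded; one
    of their cluster points as [N] grows is [q]. *)
Lemma n_step r0 s0 al be b eps : r0 < s0 -> s0 <= 0 -> s0 - r0 <= 1 ->
  (forall r s, r0 <= r -> r < s -> s <= s0 -> `|mixed_slope al be r s - b| <= eps) ->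
  exists2 q, `|q - (s0 - r0) *: b| <= (s0 - r0) * eps &
    forall e, 0 < e -> exists2 d, 0 < d & forall h, `|h| < d ->
      (v (g s0 + (al + be * s0) *: h) - v (g s0))
      - (v (g r0 + (al + be * r0) *: h) - v (g r0)) <= dotv h q + e * `|h|.
Proof.
move=> rs0 s00 T1 Hb; set T := s0 - r0 in T1 *.
have T0 : 0 < T by rewrite subr_gt0.
have [Cs Cs0 HCs] := sub_step C2F posH supH perH perv vv.
pose K := Cs + C; have K0 : 0 <= K by rewrite addr_ge0.
pose La := `|al| + `|be| * `|r0| + `|be| * `|s0| + `|be| + 1.
have La0 : 0 < La by rewrite ltr_wpDl// !addr_ge0// mulr_ge0.
pose G s h := v (g s + (al + be * s) *: h) - v (g s).
(* The modulus [D] is fixed before [N], so the final [d] does not shrink as the chain is refined. *)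
have /choice[D HD] : forall e : R, exists d : R, 0 < e -> 0 < d /\ forall x xi h eta,
    `|xi| <= Xi -> `|h| < d -> `|eta| < d ->
    L (x + h) (xi + eta) - L x xi <= dotv h (- Hx H x (P x xi)) + dotv eta (P x xi)
       + e * (`|h| + `|eta|).
  move=> e; have [e0|] := pselect (0 < e); last by exists 0.
  have [d d0 Hd] := Lag_expansion C2F posH supH perH Xi e0.
  exists d => _; split => // x xi h eta h1 h2 h3.
  by have := Hd x xi h eta h1 h2 h3; rewrite ler_norml => /andP[_]; lra.
have lam r : r0 <= r -> r <= s0 -> `|al + be * r| + `|be| <= La.
  move=> r0r rs; rewrite /La -addrA -addrA -addrA.
  have : `|r| <= `|r0| + `|s0|.
    rewrite ler_norml; apply/andP; split.
      have := ler_norm (- r0); rewrite normrN; have := normr_ge0 s0; lra.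
    have := ler_norm s0; have := normr_ge0 r0; lra.
  move=> /(ler_wpM2l (normr_ge0 be)); rewrite -normrM.
  have := ler_normD al (be * r); lra.
have step r s e h : r0 <= r -> r < s -> s <= s0 -> 0 < e -> `|h| < D e / La ->
    G s h - G r h <= (s - r) * (dotv h (mixed_slope al be r s) + e * La * `|h|)
       + K * (s - r) ^+ 2.
  move=> r0r rs ss e0; rewrite ltr_pdivlMr// => hD.
  have [De0 HDe] := HD _ e0.
  have s0' : s <= 0 by apply: le_trans ss _.
  have t0 : 0 < s - r by rewrite subr_gt0.
  have t1 : s - r <= 1 by apply: le_trans T1; rewrite /T lerB.
  have [_ /(_ t1) cal] := qg rs s0'.
  set t := s - r in t0 t1 cal *.
  have := HCs t (g r + (al + be * r) *: h) (g s + (al + be * s) *: h) t0.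
  rewrite /G; move: cal; rewrite /step_cost /mixed_slope -/t.
  set xi := t^-1 *: (g s - g r); set p := P (g r) xi.
  have -> : g s + (al + be * s) *: h - (g r + (al + be * r) *: h)
     = (g s - g r) + (t * be) *: h.
    rewrite opprD addrACA -scalerBl; congr (_ + _ *: _); rewrite /t; ring.
  have E2 : t^-1 *: ((t * be) *: h) = be *: h.
    by rewrite scalerA mulrA mulVf ?gt_eqF// mul1r.
  rewrite scalerDr -/xi E2; set dd := g s - g r; rewrite dotvDr dotvZr.
  have lr := lam r r0r (le_trans (ltW rs) ss).
  have l1 : `|al + be * r| <= La by apply: le_trans lr; rewrite lerDl.
  have l2 : `|be| <= La by apply: le_trans lr; rewrite lerDr.
  have hh1 : `|(al + be * r) *: h| < D e.
    by rewrite normrZ; apply: le_lt_trans hD; rewrite mulrC ler_wpM2l.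
  have hh2 : `|be *: h| < D e.
    by rewrite normrZ; apply: le_lt_trans hD; rewrite mulrC ler_wpM2l.
  have := HDe (g r) xi _ _ (slope_bounded rs s0') hh1 hh2.
  rewrite -/p !normrZ -mulrDl !dotvZl => h1.
  have h2 : e * ((`|al + be * r| + `|be|) * `|h|) <= e * La * `|h|.
    by rewrite -mulrA ler_pM2l// ler_wpM2r.
  have := ler_wpM2l (ltW t0) (le_trans h1 (lerD (lexx _) h2)).
  have E3 A X : dotv h (A *: X + be *: (p - c)) = A * dotv h X + be * (dotv h p - dotv c h).
    by rewrite dotvDr !dotvZr dotvBr (dotvC h c).
  rewrite E3 /K; lra.
have Nq N : exists q, `|q - T *: b| <= T * eps /\ forall e h, 0 < e -> `|h| < D e / La ->
    G s0 h - G r0 h <= dotv h q + T * (e * La * `|h|) + K * T ^+ 2 / N.+1%:R.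
  pose t := T / N.+1%:R; have t0 : 0 < t by rewrite divr_gt0.
  have tT : t * N.+1%:R = T by rewrite mulfVK.
  pose sk k := r0 + k%:R * t.
  have sk0 : sk 0%N = r0 by rewrite /sk mul0r addr0.
  have skS k : sk k.+1 - sk k = t by rewrite /sk -natr1; ring.
  have claim k : (k <= N.+1)%N -> exists q, `|q - (k%:R * t) *: b| <= k%:R * t * eps /\
     forall e h, 0 < e -> `|h| < D e / La -> G (sk k) h - G r0 h <= dotv h q +
       k%:R * t * (e * La * `|h|) + k%:R * (K * t ^+ 2).
    elim: k => [_|k IH kN].
      exists 0; rewrite !mul0r scale0r subrr normr0; split => // e h _ _.
      by rewrite sk0 subrr dotv0 !mul0r !addr0.
    have [q [q1 q2]] := IH (ltnW kN).
    have k1 : r0 <= sk k by rewrite lerDl mulr_ge0// ltW.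
    have k2 : sk k < sk k.+1 by rewrite -subr_gt0 skS.
    have k3 : sk k.+1 <= s0.
      by rewrite /sk -lerBrDl -/T -tT mulrC ler_pM2l// ler_nat.
    exists (q + t *: mixed_slope al be (sk k) (sk k.+1)); split.
      have -> : q + t *: mixed_slope al be (sk k) (sk k.+1) - (k.+1%:R * t) *: b
        = (q - (k%:R * t) *: b) + t *: (mixed_slope al be (sk k) (sk k.+1) - b).
        by rewrite -natr1 mulrDl mul1r scalerDl scalerBr opprD addrACA.
      apply: le_trans (ler_normD _ _) _.
      rewrite normrZ (gtr0_norm t0) -natr1 2!mulrDl mul1r lerD// ler_pM2l//.
      exact: Hb.
    move=> e h e0 hD; have := q2 _ _ e0 hD; have := step _ _ _ _ k1 k2 k3 e0 hD.
    rewrite skS; set S := mixed_slope _ _ _ _; clearbody S.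
    by rewrite dotvDr dotvZr -natr1; lra.
  have [q [q1 q2]] := claim _ (leqnn N.+1); rewrite ![N.+1%:R * t]mulrC tT in q1 q2.
  exists q; split => //.
  move=> e h e0 hD; have := q2 _ _ e0 hD.
  have -> : sk N.+1 = s0 by rewrite /sk mulrC tT /T addrC subrK.
  suff -> : K * T ^+ 2 / N.+1%:R = N.+1%:R * (K * t ^+ 2) by [].
  rewrite -tT; have : N.+1%:R != 0 :> R by rewrite pnatr_eq0.
  by move: (N.+1%:R : R) => M M0; field.
have [qN HqN] := choice Nq.
have qNb N : `|qN N| <= T * eps + `|T *: b|.
  by rewrite -[qN N](subrK (T *: b)) (le_trans (ler_normD _ _))// lerD2r; case: (HqN N).
have [q Hq] := bounded_accumulation qNb.
exists q.
  apply/ler_addgt0Pr => e e0; have [N _ HN] := Hq 0%N e e0.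
  have -> : q - T *: b = - (qN N - q) + (qN N - T *: b) by rewrite opprB addrA subrK.
  apply: le_trans (ler_normD _ _) _; rewrite normrN addrC lerD ?(ltW HN)//.
  by case: (HqN N).
move=> e e0; pose e1 := e / (T * La).
have e10 : 0 < e1 by rewrite divr_gt0// mulr_gt0.
exists (D e1 / La); first by rewrite divr_gt0//; case: (HD _ e10).
move=> h hD; apply/ler_addgt0Pr => e2 e20.
have nh0 : 0 < 2 * (n%:R * `|h| + 1) by rewrite mulr_gt0// ltr_wpDl// mulr_ge0.
have e30 : 0 < e2 / (2 * (n%:R * `|h| + 1)) by rewrite divr_gt0.
pose N0 := Num.bound (2 * (K * T ^+ 2) / e2).
have [N N0N HN] := Hq N0 _ e30.
have h1 : K * T ^+ 2 / N.+1%:R <= e2 / 2.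
  have A0 : 0 <= 2 * (K * T ^+ 2) / e2.
    by rewrite divr_ge0 ?mulr_ge0 ?exprn_ge0// ltW.
  have := archi_boundP A0; rewrite -/N0 ltr_pdivrMr// => hb.
  have hN : N0%:R <= N.+1%:R :> R by rewrite ler_nat ltnW.
  rewrite ler_pdivrMr//; have := ler_wpM2r (ltW e20) hN; lra.
have h2 : dotv h (qN N) <= dotv h q + e2 / 2.
  rewrite -lerBlDl -dotvBr; apply: le_trans (dotv_le _ _) _.
  have nh : 0 <= n%:R * `|h| by rewrite mulr_ge0.
  apply: le_trans (ler_wpM2l nh (ltW HN)) _.
  rewrite mulrA ler_pdivrMr//; nra.
have [_ /(_ _ _ e10 hD)] := HqN N.
have -> : T * (e1 * La * `|h|) = e * `|h|.
  by rewrite /e1; field; rewrite !gt_eqF.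
move=> h3; apply: le_trans h3 _; move: h1; set Z := K * _ / _; move: Z => Z h1.
by lra.
Qed.

End NStep.
End Calibrated.

Lemma is_derive_expansion (R : realType) (W : normedModType R) (f : R -> W) (s : R) (l : W) :
  (forall e, 0 < e -> exists2 d, 0 < d & forall t, `|t| < d ->
     `|f (s + t) - f s - t *: l| <= e * `|t|) -> is_derive s (1 : R) f l.
Proof.
move=> Hf.
have Hc : (fun h : R => h^-1 *: ((f \o shift s) (h *: (1 : R)) - f s)) @ 0^' --> l.
  apply/cvgrPdist_le => e e0; have [d d0 Hd] := Hf _ e0.
  near=> t.
  have t0 : t != 0 by near: t; exact: nbhs_dnbhs_neq.
  have td : `|t| < d by near: t; exact: dnbhs0_lt.
  rewrite /= [t *: 1]mulr1 [t + s]addrC distrC.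
  have -> : t^-1 *: (f (s + t) - f s) - l = t^-1 *: (f (s + t) - f s - t *: l).
    by rewrite [RHS]scalerBr scalerA mulVf// scale1r.
  by rewrite normrZ normfV mulrC ler_pdivrMr ?normr_gt0// Hd.
by split; [apply/cvg_ex; exists l|exact: cvg_lim].
Unshelve. all: by end_near. Qed.

Lemma near_left0 (R : realType) (Q : R -> Prop) (d : R) : 0 < d ->
  (forall t, 0 < t -> t < d -> Q (- t)) -> \forall t \near (0 : R)^'-, Q t.
Proof.
move=> d0 HQ; near=> t; rewrite -[t]opprK; apply: HQ.
  by rewrite oppr_gt0; near: t; exact: nbhs_left_lt.
by rewrite ltrNl; near: t; apply: nbhs_left_gt; rewrite oppr_lt0.
Unshelve. all: by end_near. Qed.

Lemma near_right0 (R : realType) (Q : R -> Prop) (d : R) : 0 < d ->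
  (forall t, 0 < t -> t < d -> Q t) -> \forall t \near (0 : R)^'+, Q t.
Proof.
move=> d0 HQ; near=> t; apply: HQ; first by near: t; exact: nbhs_right_gt.
by near: t; exact: nbhs_right_lt.
Unshelve. all: by end_near. Qed.

Section Regularity.
Variables (R : realType) (n : nat).
Notation V := 'rV[R]_n.
Variable H : V -> V -> R.
Hypothesis C2F : C2 (fun z : V * V => H z.1 z.2).
Hypothesis posH : forall x p, posdef (Hpp H x p).
Hypothesis supH : superlinear H.
Hypothesis perH : periodic_x H.
Variables (c : V) (a : R) (v : V -> R).
Hypothesis perv : periodicT v.
Hypothesis vv : visc_sol H c a v.
Notation P := (Pmax H).
Notation L := (Lag H).
Notation rho := (step_cost H c a).
Variables (C Xi : R) (g : R -> V).
Hypotheses (C0 : 0 <= C) (Xi0 : 0 <= Xi) (qg : qcal H c a v C Xi g).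
Notation shift_grad := (mixed_slope H c g).

Lemma shift_grad_bounded : exists2 X, 0 <= X & exists2 Y, 0 <= Y & forall al be r s,
  r < s -> s <= 0 -> `|shift_grad al be r s| <= `|al + be * r| * X + `|be| * Y.
Proof.
have [P1 P10 HP1] := Pmax_bounded C2F supH perH Xi.
have [X X0 HX] := Hx_bounded C2F perH P1.
exists X => //; exists (P1 + `|c|) => [|al be r s rs s0]; first exact: addr_ge0.
have Pb := HP1 (g r) _ (slope_bounded qg rs s0).
apply: le_trans (ler_normD _ _) _; rewrite !normrZ normrN lerD// ler_wpM2l//.
  exact: HX.
by apply: le_trans (ler_normB _ _) _; rewrite lerD2r.
Qed.

Lemma superdifferential s : s <= 0 -> exists q, forall e, 0 < e ->
  exists2 d, 0 < d & forall h, `|h| < d -> v (g s + h) - v (g s) <= dotv h q + e * `|h|.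
Proof.
move=> s0; have [X X0 [Y Y0 HXY]] := shift_grad_bounded.
have Ts : s - (s - 1) = 1 by rewrite opprB addrCA subrr addr0.
(* The weight [1 - s + r] is 0 at [r = s - 1] and 1 at [r = s]: only the last point of the chain
   moves fully, the first stays fixed. *)
have [||r s' h1 h2 h3|q _ Hq] := n_step C2F posH supH perH perv vv C0 qg
  (r0 := s - 1) (al := 1 - s) (be := 1) (b := 0) (eps := X + Y) _ s0.
- by rewrite ltrBlDr ltrDl.
- by rewrite Ts.
- rewrite subr0; apply: le_trans (HXY _ _ _ _ h2 (le_trans h3 s0)) _.
  rewrite normr1 !mul1r lerD2r ler_piMl// ler_norml; apply/andP; split; lra.
exists q => e e0; have [d d0 Hd] := Hq _ e0; exists d => // h /Hd.
have -> : 1 - s + 1 * s = 1 by ring.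
have -> : 1 - s + 1 * (s - 1) = 0 by ring.
by rewrite scale1r scale0r addr0 subrr subr0.
Qed.

(** The weight now falls from 1 at [s] to 0 at [s + T], which requires room to the right of [s]; at
    time 0 only the superdifferential is available. *)
Lemma subdifferential s : s < 0 -> exists q, forall e, 0 < e ->
  exists2 d, 0 < d & forall h, `|h| < d -> v (g s) - v (g s + h) <= dotv h q + e * `|h|.
Proof.
move=> s0; have [X X0 [Y Y0 HXY]] := shift_grad_bounded.
pose T := Num.min 1 (- s).
have T0 : 0 < T by rewrite lt_min ltr01 oppr_gt0.
have T1 : T <= 1 by rewrite ge_min lexx.
have sT : s + T <= 0 by rewrite -lerBrDl sub0r ge_min lexx orbT.
have E1 : (s + T) / T + - T^-1 * s = 1 by field; rewrite gt_eqF.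
have E2 : (s + T) / T + - T^-1 * (s + T) = 0 by field; rewrite gt_eqF.
have [||r s' h1 h2 h3|q _ Hq] := n_step C2F posH supH perH perv vv C0 qg
  (r0 := s) (al := (s + T) / T) (be := - T^-1) (b := 0) (eps := X + T^-1 * Y) _ sT.
- by rewrite ltrDl.
- by rewrite addrAC subrr add0r.
- rewrite subr0; apply: le_trans (HXY _ _ _ _ h2 (le_trans h3 sT)) _.
  have Ti0 : 0 < T^-1 by rewrite invr_gt0.
  rewrite normrN (gtr0_norm Ti0) lerD2r ler_piMl//.
  have -> : (s + T) / T + - T^-1 * r = (s + T - r) / T by field; rewrite gt_eqF.
  have h4 : 0 <= s + T - r by rewrite subr_ge0 (le_trans (ltW h2)).
  rewrite ger0_norm ?divr_ge0 ?(ltW T0)// ler_pdivrMr// mul1r; lra.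
exists q => e e0; have [d d0 Hd] := Hq _ e0; exists d => // h /Hd.
by rewrite E1 E2 scale1r scale0r addr0 subrr sub0r opprB.
Qed.

Definition momentum s := c + grad v (g s).

Lemma qcal_differentiable s : s < 0 -> differentiable v (g s).
Proof.
move=> s0; have [q1 H1] := superdifferential (ltW s0); have [q2 H2] := subdifferential s0.
by case: (two_sided_differentiable H1 H2).
Qed.

(** A constant translation moves both ends by the same [h], so the covector of [n_step] is the
    difference of the two gradients. This is the integrated form of [p' = - Hx], with [b] standing
    for [- Hx] up to [eps]. *)
Lemma pg_translation r s b eps : r < s -> s < 0 -> s - r <= 1 ->
  (forall r' s', r <= r' -> r' < s' -> s' <= s -> `|shift_grad 1 0 r' s' - b| <= eps) ->
  `|momentum s - momentum r - (s - r) *: b| <= (s - r) * eps.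
Proof.
move=> rs s0 T1 Hb.
have [q q1 q2] := n_step C2F posH supH perH perv vv C0 qg rs (ltW s0) T1 Hb.
suff -> : momentum s - momentum r = q by [].
apply/eqP; rewrite -subr_eq0; apply/eqP; apply: dotv_littleo => e e0.
have e30 : 0 < e / 3 by rewrite divr_gt0.
have [d1 d10 Hd1] := q2 _ e30.
have [d2 d20 Hd2] := grad_expansion (qcal_differentiable s0) e30.
have [d3 d30 Hd3] := grad_expansion (qcal_differentiable (lt_trans rs s0)) e30.
exists (Num.min d1 (Num.min d2 d3)) => [|h]; first by rewrite !lt_min d10 d20.
rewrite !lt_min => /and3P[/Hd1 h1 /Hd2 h2 /Hd3].
move: h1 h2; rewrite !mul0r !addr0 !scale1r !ler_norml => h1 /andP[h2 _] /andP[_ h3].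
rewrite dotvBr /momentum opprD addrACA subrr add0r dotvBr; lra.
Qed.

Lemma qcal_lipschitz r s : r <= s -> s <= 0 -> `|g s - g r| <= Xi * (s - r).
Proof.
rewrite le_eqVlt => /predU1P[->|rs] s0; first by rewrite !subrr normr0 mulr0.
by case: (qg rs s0).
Qed.

Lemma Fenchel_gap_continuous p k :
  continuous (fun z : V * V => L z.1 z.2 + k - dotv z.2 p).
Proof.
apply: continuousB_fun; last first.
  by apply: continuousI => z; apply: cvg_dotv; [exact: cvg_snd|exact: cvg_cst].
apply: continuousI => z; apply: cvgD; last exact: cvg_cst.
exact: (continuous_Lag C2F posH supH perH).
Qed.


Lemma pg_bounded : exists2 M, 0 <= M & forall x, differentiable v x -> `|c + grad v x| <= M.
Proof.
have [M M0 HM] := sublevel_bounded C2F supH perH a.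
by exists M => // x dv; apply: (HM x); exact: (Ham_grad_le C2F posH supH perH perv vv dv).
Qed.

(** Calibration and the expansion of [v] at [g s] make the Fenchel gap of the backward slopes at
    most [e], because [H (g s) p <= a]; [cvg_argmin] then yields the velocity. Differentiability is
    a premise, rather than [s < 0], because the lemma is also applied at time 0. *)
Lemma slope_left s : s <= 0 -> differentiable v (g s) ->
  t^-1 *: (g (s + t) - g s) @[t --> (0 : R)^'-] --> Hp H (g s) (momentum s).
Proof.
move=> s0 dv; set p := momentum s.
have Hle : H (g s) p <= a by exact: (Ham_grad_le C2F posH supH perH perv vv dv).
have Xi1 : 0 < Xi + 1 by rewrite ltr_wpDl.
have slE t : 0 < t -> (- t)^-1 *: (g (s - t) - g s) = (s - (s - t))^-1 *: (g s - g (s - t)).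
  move=> t0; have -> : s - (s - t) = t by lra.
  by rewrite invrN scaleNr -scalerN opprB.
have sl t : 0 < t -> `|(- t)^-1 *: (g (s - t) - g s)| <= Xi.
  by move=> t0; rewrite slE//; apply: (slope_bounded qg) => //; rewrite ltrBlDr ltrDl.
apply: (cvg_argmin (F := (0 : R)^'-) (f := fun t => t^-1 *: (g (s + t) - g s))
  (u := fun t => g (s + t)) (u0 := g s) (M := Xi) _ _
  (@Fenchel_gap_continuous p (H (g s) p))).
- apply/cvgrPdist_le => e e0; apply: (@near_left0 _ _ (e / (Xi + 1))) => [|t t0 td].
    by rewrite divr_gt0.
  have := @qcal_lipschitz (s - t) s _ s0; rewrite lerBlDr lerDl ltW// => /(_ isT) /le_trans; apply.
  have -> : s - (s - t) = t by lra.
  by move: td; rewrite ltr_pdivlMr//; nra.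
- apply: (@near_left0 _ _ 1) => // t t0 _; exact: sl.
- move=> e e0.
  have e1 : 0 < e / (2 * (Xi + 1)) by rewrite divr_gt0// mulr_gt0.
  have [d d0 Hd] := grad_expansion dv e1.
  have C1 : 0 < 2 * (C + 1) by rewrite mulr_gt0// ltr_wpDl.
  apply: (@near_left0 _ _ (Num.min 1 (Num.min (d / (Xi + 1)) (e / (2 * (C + 1)))))).
    by rewrite !lt_min ltr01 !divr_gt0.
  move=> t t0; rewrite !lt_min => /and3P[t1]; rewrite !ltr_pdivlMr// => td te /=.
  set xi := (- t)^-1 *: _; have xiX : `|xi| <= Xi by exact: sl.
  have rs : s - t < s by rewrite ltrBlDr ltrDl.
  have [_] := qg rs s0; rewrite (_ : s - (s - t) = t); last by lra.
  move=> /(_ (ltW t1)); rewrite /step_cost.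
  have -> : t^-1 *: (g s - g (s - t)) = xi by rewrite /xi slE//; congr (_^-1 *: _); lra.
  have gE : g s - g (s - t) = t *: xi.
    by rewrite /xi invrN scaleNr -scalerN opprB scalerA divff ?gt_eqF// scale1r.
  rewrite gE dotvZr.
  have hd : `|- (t *: xi)| < d.
    by rewrite normrN normrZ gtr0_norm//; nra.
  have := Hd _ hd; rewrite -{1}gE opprB addrCA subrr addr0 normrN normrZ (gtr0_norm t0).
  rewrite ler_norml => /andP[h1 _] h2; move: h1; rewrite dotvNl dotvZl.
  have h3 : e / (2 * (Xi + 1)) * (t * `|xi|) <= t * (e / 2).
    rewrite mulrCA ler_pM2l// mulrAC ler_pdivrMr ?mulr_gt0//; nra.
  have h4 : C * t ^+ 2 < t * (e / 2).
    rewrite expr2 mulrCA ltr_pM2l//; nra.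
  move=> h1; rewrite -(ltr_pM2l t0).
  have := ler_wpM2l (ltW t0) Hle.
  rewrite /p /momentum dotvDr (dotvC xi c); lra.
- move=> q /= h; rewrite (_ : p = P (g s) q) ?(Hp_Pmax C2F supH perH)//.
  by apply: (Fenchel_eq C2F posH supH perH); lra.
Qed.

Lemma slope_right s : s < 0 ->
  t^-1 *: (g (s + t) - g s) @[t --> (0 : R)^'+] --> Hp H (g s) (momentum s).
Proof.
move=> s0; have dv := qcal_differentiable s0; set p := momentum s.
have Hle : H (g s) p <= a by exact: (Ham_grad_le C2F posH supH perH perv vv dv).
have Xi1 : 0 < Xi + 1 by rewrite ltr_wpDl.
have s0' : 0 < - s by rewrite oppr_gt0.
have stt t : s + t - s = t by lra.
have sl t : 0 < t -> t < - s -> `|t^-1 *: (g (s + t) - g s)| <= Xi.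
  move=> t0 ts; have := @slope_bounded _ _ _ _ _ _ _ _ _ qg s (s + t).
  by rewrite stt; apply; [rewrite ltrDl|lra].
apply: (cvg_argmin (F := (0 : R)^'+) (f := fun t => t^-1 *: (g (s + t) - g s))
  (u := fun t => g s) (u0 := g s) (M := Xi) _ _
  (@Fenchel_gap_continuous p (H (g s) p))).
- exact: cvg_cst.
- by apply: (near_right0 s0') => t t0 ts; exact: sl.
- move=> e e0.
  have e1 : 0 < e / (2 * (Xi + 1)) by rewrite divr_gt0// mulr_gt0.
  have [d d0 Hd] := grad_expansion dv e1.
  have C1 : 0 < 2 * (C + 1) by rewrite mulr_gt0// ltr_wpDl.
  apply: (@near_right0 _ _ (Num.min (- s) (Num.min 1 (Num.min (d / (Xi + 1)) (e / (2 * (C + 1))))))).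
    by rewrite !lt_min ltr01 s0' !divr_gt0.
  move=> t t0; rewrite !lt_min => /and4P[ts t1]; rewrite !ltr_pdivlMr// => td te /=.
  set xi := t^-1 *: _; have xiX : `|xi| <= Xi by exact: sl.
  have rs : s < s + t by rewrite ltrDl.
  have st0 : s + t <= 0 by lra.
  have [_] := qg rs st0; rewrite stt => /(_ (ltW t1)); rewrite /step_cost -/xi.
  have gE : g (s + t) - g s = t *: xi by rewrite scalerA divff ?gt_eqF// scale1r.
  rewrite gE dotvZr.
  have hd : `|t *: xi| < d by rewrite normrZ gtr0_norm//; nra.
  have := Hd _ hd; rewrite -{1}gE addrCA subrr addr0 normrZ (gtr0_norm t0).
  rewrite ler_norml => /andP[_ h1] h2; move: h1; rewrite dotvZl.
  have h3 : e / (2 * (Xi + 1)) * (t * `|xi|) <= t * (e / 2).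
    rewrite mulrCA ler_pM2l// mulrAC ler_pdivrMr ?mulr_gt0//; nra.
  have h4 : C * t ^+ 2 < t * (e / 2).
    rewrite expr2 mulrCA ltr_pM2l//; nra.
  move=> h1; rewrite -(ltr_pM2l t0).
  have := ler_wpM2l (ltW t0) Hle.
  rewrite /p /momentum dotvDr (dotvC xi c); lra.
- move=> q /= h; rewrite (_ : p = P (g s) q) ?(Hp_Pmax C2F supH perH)//.
  by apply: (Fenchel_eq C2F posH supH perH); lra.
Qed.

Lemma qcal_is_derive (s : R) : s < 0 -> is_derive s (1 : R) g (Hp H (g s) (momentum s)).
Proof.
move=> s0.
have cl := slope_left (ltW s0) (qcal_differentiable s0).
have cr := slope_right s0.
apply: is_derive_expansion => e e0.
move/cvgrPdist_le : cl => /(_ _ e0) /nbhs_ballP[d1 /= d10 Hd1].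
move/cvgrPdist_le : cr => /(_ _ e0) /nbhs_ballP[d2 /= d20 Hd2].
exists (Num.min d1 d2) => [|t]; first by rewrite lt_min d10.
rewrite lt_min => /andP[td1 td2].
have b1 : ball (0 : R) d1 t by rewrite -ball_normE /= sub0r normrN.
have b2 : ball (0 : R) d2 t by rewrite -ball_normE /= sub0r normrN.
set l := Hp H _ _ in Hd1 Hd2 *.
have [->|t0] := eqVneq t 0; first by rewrite addr0 subrr scale0r subrr !normr0 mulr0.
have E : g (s + t) - g s - t *: l = - (t *: (l - t^-1 *: (g (s + t) - g s))).
  by rewrite scalerBr scalerA divff// scale1r opprB.
rewrite E normrN normrZ mulrC ler_pM2r ?normr_gt0//.
by move: t0; rewrite neq_lt => /orP[t0|t0]; [exact: Hd1|exact: Hd2].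
Qed.

Lemma pg_lipschitz : exists2 K, 0 <= K & forall r s, r <= s -> s < 0 -> s - r <= 1 ->
  `|momentum s - momentum r| <= K * (s - r).
Proof.
have [X X0 [Y Y0 HXY]] := shift_grad_bounded.
exists X => // r s; rewrite le_eqVlt => /predU1P[->|rs] s0 T1.
  by rewrite !subrr normr0 mulr0.
have := @pg_translation r s 0 X rs s0 T1.
rewrite scaler0 subr0 mulrC; apply => r' s' h1 h2 h3; rewrite subr0.
apply: le_trans (HXY _ _ _ _ h2 (le_trans h3 (ltW s0))) _.
by rewrite mul0r addr0 normr1 normr0 mul0r addr0 mul1r.
Qed.

(** Strict differentiability of [g]: [pg_translation] needs the slopes on all small intervals near
    [s], not only on those with end point [s]. The velocity [Hp H (g t) (momentum t)] varies in a
    Lipschitz way, and the mean value theorem is applied to each coordinate. *)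
Lemma slope_near (s e : R) : s < 0 -> 0 < e -> exists2 d, 0 < d &
  forall r' s', s - d < r' -> r' < s' -> s' < s + d ->
    s' < 0 /\ `|g r' - g s| < e /\
    `|(s' - r')^-1 *: (g s' - g r') - Hp H (g s) (momentum s)| < e.
Proof.
move=> s0 e0.
have [Kp Kp0 HKp] := pg_lipschitz.
have [M M0 HM] := pg_bounded.
have [K K0 HK] := gradHam_lipschitz C2F perH M.
pose A := K * (Xi + Kp) + Xi + 1.
have A0 : 0 < A by rewrite ltr_wpDl// addr_ge0// mulr_ge0// addr_ge0.
pose d := Num.min 1 (Num.min (- s) (e / (2 * A))).
have d0 : 0 < d by rewrite !lt_min ltr01 oppr_gt0 s0 divr_gt0// mulr_gt0.
have d1 : d <= 1 by rewrite ge_min lexx.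
have ds : d <= - s by rewrite !ge_min lexx orbT.
have de : d * (2 * A) <= e by rewrite -ler_pdivlMr ?mulr_gt0// !ge_min lexx !orbT.
have close t : s - d < t -> t < s + d -> t < 0 /\ `|g t - g s| <= Xi * d /\ `|momentum t - momentum s| <= Kp * d.
  move=> t1 t2; have t0 : t < 0 by lra.
  split=> //; have [ts|/ltW st] := lerP t s.
    split; rewrite distrC.
      by apply: le_trans (qcal_lipschitz ts (ltW s0)) _; rewrite ler_wpM2l//; lra.
    by apply: le_trans (HKp _ _ ts s0 _) _; [lra|rewrite ler_wpM2l//; lra].
  split.
    by apply: le_trans (qcal_lipschitz st (ltW t0)) _; rewrite ler_wpM2l//; lra.
  by apply: le_trans (HKp _ _ st t0 _) _; [lra|rewrite ler_wpM2l//; lra].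
exists d => // r' s' h1 h2 h3.
have [r'0 [r'1 _]] := close r' h1 (lt_trans h2 h3).
have [s'0 _] := close s' (lt_trans h1 h2) h3.
split=> //; split.
  apply: le_lt_trans r'1 _.
  have := mulr_ge0 K0 (addr_ge0 Xi0 Kp0); have := mulr_gt0 d0 A0; rewrite /A in de *; nra.
have sr0 : 0 < s' - r' by rewrite subr_gt0.
apply: (@le_lt_trans _ _ (d * A)); last by have := mulr_gt0 d0 A0; lra.
apply: norm_le_coord => [|i]; first by rewrite mulr_ge0 ?ltW.
have gi (t : R) : t < 0 -> is_derive t (1 : R) (fun t => g t 0 i) (Hp H (g t) (momentum t) 0 i).
  move=> /qcal_is_derive [dg Eg].
  have dgi := (derivable_mxP g t (1 : R)).1 dg 0 i.
  by apply: DeriveDef => //; rewrite -Eg derive_mx// mxE.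
have ci : {within `[r', s'], continuous (fun t => g t 0 i)}.
  apply: derivable_within_continuous => t; rewrite in_itv /= => /andP[_ ts'].
  by case: (gi t (le_lt_trans ts' s'0)).
have di (t : R) : t \in `]r', s'[ -> is_derive t (1 : R) (fun t => g t 0 i) (Hp H (g t) (momentum t) 0 i).
  by rewrite in_itv /= => /andP[_ ts']; exact: gi (lt_trans ts' s'0).
have [t] := MVT h2 di ci; rewrite in_itv /= => /andP[t1 t2] Et.
rewrite coordB mxE coordB Et mulrC mulfK ?gt_eqF//.
have [t0 [tg tp]] := close t (lt_trans h1 t1) (lt_trans t2 h3).
rewrite -coordB; apply: le_trans (coord_le_norm _ _) _.
have b1 : `|momentum t| <= M by apply: HM; exact: qcal_differentiable.
have b2 : `|momentum s| <= M by apply: HM; exact: qcal_differentiable.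
have [h _] := HK (g t) (g s) _ _ b1 b2.
apply: le_trans h _; rewrite /A.
have := ler_wpM2l K0 (lerD tg tp); have := mulr_ge0 (ltW d0) Xi0; lra.
Qed.

Lemma pg_is_derive (s : R) : s < 0 -> is_derive s (1 : R) momentum (- Hx H (g s) (momentum s)).
Proof.
move=> s0; apply: is_derive_expansion => e e0.
have cF : continuous (fun z : V * V => Hx H z.1 (P z.1 z.2)).
  apply: continuousI => z.
  have c1 : z'.1 @[z' --> z] --> z.1 by exact: cvg_fst.
  have c2 : P z'.1 z'.2 @[z' --> z] --> P z.1 z.2.
    exact: (continuous_Pmax C2F posH supH perH).
  exact: (cvg_comp_pair (continuous_Hx C2F) c1 c2).
have perF (k x xi : V) : intvec k ->
    (fun z : V * V => Hx H z.1 (P z.1 z.2)) (x + k, xi) = Hx H x (P x xi).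
  by move=> ki /=; rewrite (Hx_periodic perH)// (Pmax_periodic C2F posH supH perH).
have [d d0 Hd] := periodic_unif_cont cF perF (`|Hp H (g s) (momentum s)|) e0.
have [d1 d10 Hd1] := slope_near s0 d0.
have b r' s' : s - d1 < r' -> r' < s' -> s' < s + d1 ->
    `|shift_grad 1 0 r' s' - (- Hx H (g s) (momentum s))| <= e.
  move=> h1 h2 h3; have [_ [h4 h5]] := Hd1 _ _ h1 h2 h3.
  rewrite /mixed_slope mul0r addr0 scale1r scale0r addr0 opprK addrC.
  have := Hd (g s) (g r') _ _ (lexx _); rewrite /= (Pmax_Hp C2F posH supH perH) => /(_ _).
  by move=> hh; apply/ltW/hh; rewrite distrC.
exists (Num.min 1 (Num.min d1 (- s))) => [|t]; first by rewrite !lt_min ltr01 d10 oppr_gt0.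
rewrite !lt_min => /and3P[t1 td ts].
have [t0|t0] := lerP 0 t.
  move: t0; rewrite le_eqVlt => /predU1P[<-|t0].
    by rewrite addr0 subrr scale0r subrr !normr0 mulr0.
  rewrite (gtr0_norm t0) in t1 td ts *.
  have stt : s + t - s = t by lra.
  have := @pg_translation s (s + t) (- Hx H (g s) (momentum s)) e.
  rewrite stt [e * _]mulrC; apply; [lra|lra|lra|move=> r' s' h1 h2 h3].
  by apply: b => //; lra.
rewrite (ltr0_norm t0) in t1 td ts *.
have stt : s - (s + t) = - t by lra.
have := @pg_translation (s + t) s (- Hx H (g s) (momentum s)) e.
rewrite stt [e * _]mulrC => h.
set Y := - Hx H _ _ in h *.
have -> : momentum (s + t) - momentum s - t *: Y = - (momentum s - momentum (s + t) - (- t) *: Y).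
  move: (momentum (s + t)) (momentum s) => A B.
  by rewrite scaleNr opprK opprD opprB.
rewrite normrN; apply: h; [lra|lra|lra|move=> r' s' h1 h2 h3].
by apply: b => //; lra.
Qed.

End Regularity.

(** * Existence of calibrated curves *)

Section PointwiseAccumulation.
Variables (R : realType) (n : nat).
Notation V := 'rV[R]_n.

(** The discretized curves are step functions, so compactness is taken in the product topology
    instead of a uniform one. Approximation at two times by the same [N] is enough, since [qcal]
    constrains pairs of times. *)
Lemma pointwise_accumulation (f : nat -> R -> V) (M : R -> R) :
  (forall N s, `|f N s| <= M s) ->
  exists g : R -> V, forall r s N0 d, 0 < d ->
    exists2 N, (N0 <= N)%N & `|f N r - g r| < d /\ `|f N s - g s| < d.
Proof.
move=> fM.
pose A (s : R) := [set p : V | `|p| <= M s].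
pose W : topologicalType := prod_topology (fun _ : R => V).
have cA : @compact W [set h | forall s, A s (h s)].
  by apply: tychonoff => s; exact: compact_cball.
have FA : (f @ \oo) [set h | forall s, A s (h s)].
  by exists 0%N => // N _ s; exact: fM.
have [g [_ gF]] := cA _ _ FA.
exists g => r s N0 d d0.
have FN : (f @ \oo) (f @` [set N | (N0 <= N)%N]) by exists N0 => // N NN; exists N.
have nb t : nbhs (g : W) [set h : W | ball (g t) d (h t)].
  have := @proj_continuous R (fun _ => V) t g.
  by apply; exact: nbhsx_ballx.
have [_ [[N NN <-]]] := gF _ _ FN (filterI (nb r) (nb s)).
rewrite /= -!ball_normE /= => -[h1 h2]; exists N => //.
by rewrite distrC h1 distrC.
Qed.

End PointwiseAccumulation.

Section CalibratedCurves.
Variables (R : realType) (n : nat).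
Notation V := 'rV[R]_n.
Variable H : V -> V -> R.
Hypothesis C2F : C2 (fun z : V * V => H z.1 z.2).
Hypothesis posH : forall x p, posdef (Hpp H x p).
Hypothesis supH : superlinear H.
Hypothesis perH : periodic_x H.
Variables (c : V) (a : R) (v : V -> R).
Hypothesis perv : periodicT v.
Hypothesis vv : visc_sol H c a v.
Notation P := (Pmax H).
Notation L := (Lag H).
Notation rho := (step_cost H c a).

Lemma Lag_lipschitz_x M : exists2 K, 0 <= K & forall x y xi, `|xi| <= M ->
  L y xi - K * `|x - y| <= L x xi.
Proof.
have [P1 P10 HP1] := Pmax_bounded C2F supH perH M.
have [K K0 HK] := Ham_lipschitz C2F perH P1.
exists K => // x y xi xiM; have pb := HP1 y xi xiM.
have := HK x y _ _ pb pb; rewrite subrr normr0 addr0 ler_norml => /andP[_].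
have := Fenchel C2F supH perH x xi (P y xi).
rewrite (LagE C2F supH perH y); lra.
Qed.

(* The one-step inequality along a chain is convexified by the affine minorant
   of [L y0] at the mean slope [xi0], so that the sum telescopes. *)
Lemma chain_rho (C Xi K t : R) (x : nat -> V) : 0 < t -> 0 <= C -> 0 <= Xi -> 0 <= K ->
  (forall x y xi, `|xi| <= Xi -> L y xi - K * `|x - y| <= L x xi) ->
  (forall k, v (x k.+1) + rho t (x k.+1) (x k) <= v (x k) + C * t ^+ 2 /\
             `|x k - x k.+1| <= Xi * t) ->
  forall i m, `|x i - x (i + m)%N| <= Xi * (m%:R * t) /\
  ((0 < m)%N -> v (x (i + m)%N) + rho (m%:R * t) (x (i + m)%N) (x i) <=
     v (x i) + K * Xi * (m%:R * t) ^+ 2 + C * (m%:R * t) * t).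
Proof.
move=> t0 C0 Xi0 K0 HK Hx.
have near i m : `|x i - x (i + m)%N| <= Xi * (m%:R * t).
  elim: m => [|m IH]; first by rewrite addn0 subrr normr0 mul0r mulr0.
  rewrite addnS; have [_ h] := Hx (i + m)%N.
  rewrite -[x i - _](subrKA (x (i + m)%N)) (le_trans (ler_normD _ _))//.
  by rewrite -natr1; lra.
move=> i m; split=> // m0; set y0 := x (i + m)%N.
set T := m%:R * t; have T0 : 0 < T by rewrite mulr_gt0// ltr0n.
pose xi0 := T^-1 *: (x i - y0); pose p0 := P y0 xi0.
have E0 : x i - y0 = T *: xi0 by rewrite scalerA divff ?gt_eqF// scale1r.
have xi0E : T^-1 *: (x i - y0) = xi0 by [].
have p0E : P y0 xi0 = p0 by [].
clearbody p0 xi0.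
have step k : (k < m)%N -> v (x (i + k).+1) + t * (L y0 xi0 - dotv xi0 p0 + a - K * Xi * T - C * t)
     + dotv (x (i + k)%N - x (i + k).+1) (p0 - c) <= v (x (i + k)%N).
  move=> km; have [h1 h2] := Hx (i + k)%N; move: h1; rewrite /step_cost.
  set xi := t^-1 *: _.
  have xiX : `|xi| <= Xi by rewrite normrZ gtr0_norm ?invr_gt0// mulrC ler_pdivrMr.
  have E : x (i + k)%N - x (i + k).+1 = t *: xi by rewrite scalerA divff ?gt_eqF// scale1r.
  clearbody xi; rewrite E dotvBr !dotvZl !dotvZr.
  have h3 := HK (x (i + k).+1) y0 xi xiX.
  have h4 : `|x (i + k).+1 - y0| <= Xi * T.
    rewrite /y0 -addnS -(subnKC km) addnA; apply: le_trans (near _ _) _.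
    rewrite ler_wpM2l// ler_pM2r// ler_nat; exact: leq_subr.
  have h5 := Lag_convex C2F supH perH y0 xi0 xi; rewrite p0E dotvBl in h5.
  have h6 := ler_wpM2l K0 h4.
  have h7 : L y0 xi0 - dotv xi0 p0 - K * Xi * T + dotv xi p0 <= L (x (i + k).+1) xi by lra.
  have := ler_wpM2l (ltW t0) h7; rewrite (dotvC xi c); lra.
have tele k : (k <= m)%N -> v (x (i + k)%N) + k%:R * t * (L y0 xi0 - dotv xi0 p0 + a - K * Xi * T - C * t)
     + dotv (x i - x (i + k)%N) (p0 - c) <= v (x i).
  elim: k => [_|k IH km]; first by rewrite addn0 subrr dot0v !mul0r !addr0.
  have := IH (ltnW km); have := step k km; rewrite addnS -natr1 !dotvBl; lra.
have := tele m (leqnn m); rewrite -/y0 -/T /step_cost xi0E.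
rewrite E0 dotvBr !dotvZl dotvZr (dotvC xi0 c); lra.
Qed.

Lemma continuous_calibration_gap t :
  continuous (fun z : V * V => v z.1 + rho t z.1 z.2 - v z.2).
Proof.
have cv : continuous v by case: vv.
apply: continuousI => z.
have c1 : z'.1 @[z' --> z] --> z.1 by exact: cvg_fst.
have c2 : z'.2 @[z' --> z] --> z.2 by exact: cvg_snd.
have v1 : v z'.1 @[z' --> z] --> v z.1 by exact: (cvg_comp _ _ c1 (cv z.1)).
have v2 : v z'.2 @[z' --> z] --> v z.2 by exact: (cvg_comp _ _ c2 (cv z.2)).
have c3 : z'.2 - z'.1 @[z' --> z] --> z.2 - z.1 by exact: cvgB c2 c1.
have c4 : dotv c (z'.2 - z'.1) @[z' --> z] --> dotv c (z.2 - z.1).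
  by apply: cvg_dotv; [exact: cvg_cst|exact: c3].
have c5 : t * L z'.1 (t^-1 *: (z'.2 - z'.1)) @[z' --> z] --> t * L z.1 (t^-1 *: (z.2 - z.1)).
  apply: cvgMr; exact: (cvg_comp_pair (continuous_Lag C2F posH supH perH) c1 (cvgZ_cst (r := t^-1) c3)).
exact: cvgB (cvgD v1 (cvgD (cvgB c5 c4) (cvg_cst _))) v2.
Qed.

Lemma exists_qcal x : exists C Xi g,
  [/\ 0 <= C, 0 <= Xi, qcal H c a v C Xi g & g 0 = x].
Proof.
have [C C0 [Xi Xi0 Hs]] := super_step C2F posH supH perH perv vv.
have [K K0 HK] := Lag_lipschitz_x Xi.
pose t N : R := N.+1%:R^-1.
have t0 N : 0 < t N by rewrite invr_gt0.
have t1 N : t N <= 1 by rewrite invf_le1// ler1n.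
have /choice[F HF] : forall z : nat * V, exists y, v y + rho (t z.1) y z.2 <= v z.2 + C * t z.1 ^+ 2
    /\ `|z.2 - y| <= Xi * t z.1 by move=> z; exact: Hs.
pose xs N k := iter k (fun y => F (N, y)) x.
have chain N := chain_rho (t0 N) C0 Xi0 K0 HK (fun k => HF (N, xs N k)).
(* Time [s <= 0] corresponds to step [- s / t N] of the backward chain, rounded down; positive times
   fall on step 0. *)
pose f N s := xs N (Num.trunc (- s / t N)).
have trP N s : s <= 0 -> (Num.trunc (- s / t N))%:R * t N <= - s < (Num.trunc (- s / t N))%:R * t N + t N.
  move=> s0; have h : 0 <= - s / t N by rewrite divr_ge0// ?oppr_ge0// ltW.
  have := truncn_itv h; rewrite -natr1 ler_pdivlMr// ltr_pdivrMr// mulrDl mul1r.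
  by [].
have fE N r s : r < s -> s <= 0 -> exists m, f N r = xs N (Num.trunc (- s / t N) + m)%N
    /\ `|m%:R * t N - (s - r)| <= t N.
  move=> rs s0; have r0 : r <= 0 by rewrite ltW// (lt_le_trans rs).
  exists (Num.trunc (- r / t N) - Num.trunc (- s / t N))%N.
  have le : (Num.trunc (- s / t N) <= Num.trunc (- r / t N))%N.
    by apply: le_truncn; rewrite ler_pM2r ?invr_gt0// lerN2 ltW.
  split; first by rewrite subnKC.
  rewrite natrB// mulrBl; have /andP[? ?] := trP N _ s0; have /andP[? ?] := trP N _ r0.
  by rewrite ler_norml; apply/andP; split; lra.
have fM N s : `|f N s| <= `|x| + Xi * `|s|.
  have [h _] := chain N 0%N (Num.trunc (- s / t N)); rewrite add0n -/(f N s) in h.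
  have cs : (Num.trunc (- s / t N))%:R * t N <= `|s|.
    have [s0|s0] := lerP s 0; first by have /andP[h' _] := trP N s s0; rewrite ler0_norm.
    rewrite truncn_floor ifF; first by rewrite mul0r.
    by apply/negP; rewrite pmulr_lge0 ?invr_gt0// oppr_ge0 leNgt s0.
  have -> : f N s = x - (xs N 0%N - f N s) by rewrite /= opprB addrCA subrr addr0.
  apply: le_trans (ler_normB _ _) _; rewrite lerD2l; apply: le_trans h _.
  by rewrite ler_wpM2l.
have [g Hg] := pointwise_accumulation fM.
have g0 : g 0 = x.
  apply/eqP; rewrite -subr_eq0 -normr_le0; apply/ler_addgt0Pr => e e0; rewrite add0r.
  have [N _ [h _]] := Hg 0 0 0%N e e0.
  by rewrite distrC ltW//; move: h; rewrite /f oppr0 mul0r truncn0.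
have tsmall e : 0 < e -> exists N0, forall N, (N0 <= N)%N -> t N <= e.
  move=> e0; exists (Num.bound e^-1) => N NN.
  have ei0 : 0 <= e^-1 by rewrite invr_ge0 ltW.
  rewrite /t -[e]invrK lef_pV2 ?posrE ?invr_gt0//.
  by rewrite (le_trans (ltW (archi_boundP ei0)))// ler_nat ltnW.
(* The term [C * (m t) * t] of [chain_rho] vanishes as the step [t] tends to 0; only the cost of
   freezing the base point, [K * Xi * (s - r)^2], survives. *)
exists (K * Xi); exists Xi; exists g; split=> //; first exact: mulr_ge0.
move=> r s rs s0; have sr0 : 0 < s - r by rewrite subr_gt0.
split.
  apply/ler_addgt0Pr => e e0.
  have e30 : 0 < e / 3 by rewrite divr_gt0.
  have e40 : 0 < e / 3 / (Xi + 1) by rewrite divr_gt0// ltr_wpDl.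
  have [N0 HN0] := tsmall _ e40.
  have [N /HN0 tN [h1 h2]] := Hg r s N0 _ e30.
  have [m [fr mt]] := fE N r s rs s0.
  have [h3 _] := chain N (Num.trunc (- s / t N)) m.
  rewrite -fr -/(f N s) in h3.
  have -> : g s - g r = (f N s - f N r) - (f N s - g s) + (f N r - g r).
    by apply/rowP => i; rewrite !mxE; ring.
  apply: le_trans (ler_normD _ _) _; apply: le_trans (lerD (ler_normB _ _) (lexx _)) _.
  have h4 : Xi * (m%:R * t N) <= Xi * (s - r) + e / 3.
    move: mt; rewrite ler_norml => /andP[_ mt].
    have := ler_wpM2l Xi0 mt.
    have : Xi * t N <= e / 3.
      by move: tN; rewrite ler_pdivlMr ?ltr_wpDl//; have := t0 N; nra.
    lra.
  lra.
move=> T1; set S := s - r in sr0 T1 *; apply/ler_addgt0Pr => e e0.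
have [P1 P10 HP1] := Pmax_bounded C2F supH perH (2 * Xi).
have [D0 D00 HD0] := Ham_bounded C2F perH P1.
pose D := D0 + `|a|; have DD : 0 <= D by rewrite addr_ge0.
have e20 : 0 < e / 2 by rewrite divr_gt0.
have KX0 : 0 <= K * Xi by rewrite mulr_ge0.
(* Rates of the errors in [t N]: [tau ^+ 2] against [S ^+ 2] gives the first term, the one-step
   errors the second, the change of duration from [tau] to [S] the third. *)
pose B := 3 * (K * Xi) + 2 * C + D + 1.
have B0 : 0 < B by rewrite ltr_wpDl// !addr_ge0// mulr_ge0.
have m0 : 0 < Num.min (S / 2) (e / 2 / B) by rewrite lt_min !divr_gt0.
have [N0 HN0] := tsmall _ m0.
have /cvgrPdist_lt/(_ _ e20)/nbhs_ballP[d /= d0 Hd] :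
    v z.1 + rho S z.1 z.2 - v z.2 @[z --> (g r, g s)] --> v (g r) + rho S (g r) (g s) - v (g s).
  exact: (@continuous_calibration_gap S (g r, g s)).
have [N /HN0 tN [h1 h2]] := Hg r s N0 _ d0.
have [m [fr mt]] := fE N r s rs s0.
have /Hd : ball (g r, g s) d (f N r, f N s).
  by split; rewrite /= -ball_normE /= distrC.
rewrite /= ltr_norml => /andP[_ hc].
move: tN; rewrite le_min => /andP[tS]; rewrite ler_pdivlMr// => tB.
move: mt; rewrite ler_norml -/S => /andP[mt1 mt2].
set tau := m%:R * t N in mt1 mt2 *.
have tau0 : 0 < tau by lra.
have m1 : (0 < m)%N by rewrite lt0n; apply/eqP => m00; move: tau0; rewrite /tau m00 mul0r ltxx.
have [h3 /(_ m1)] := chain N (Num.trunc (- s / t N)) m.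
rewrite -fr -/(f N s) -/tau in h3 * => h4.
have := rho_perspective C2F supH perH c a (f N r) (f N s) sr0 tau0.
set X := H _ _ - a => h5.
have X1 : `|X| <= D.
  apply: le_trans (ler_normB _ _) _; rewrite lerD2r; apply: HD0; apply: HP1.
  rewrite normrZ gtr0_norm ?invr_gt0// mulrC ler_pdivrMr//.
  by apply: le_trans h3 _; have := t0 N; nra.
have h6 : (tau - S) * X <= t N * D.
  apply: le_trans (ler_norm _) _; rewrite normrM ler_pM//.
  by rewrite ler_norml; apply/andP; split; lra.
have t0N := t0 N; have t1N := t1 N.
have h7 : tau ^+ 2 <= S ^+ 2 + 3 * t N by nra.
have h8 := ler_wpM2l KX0 h7.
have tau2 : tau <= 2 by lra.
have h9 : C * tau * t N <= 2 * C * t N.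
  by rewrite ler_pM2r// [2 * C]mulrC ler_wpM2l.
rewrite /B in tB; lra.
Qed.

End CalibratedCurves.

(** * Hamiltonian flow *)

Lemma is_derive_diff_comp (R : realType) (U W : normedModType R) (F : U -> W) (f : R -> U)
    (s : R) (l : U) : differentiable F (f s) -> is_derive s (1 : R) f l ->
  is_derive s (1 : R) (fun t => F (f t)) ('d F (f s) l).
Proof.
move=> dF [df El].
have df' : differentiable f s by apply/derivable1_diffP.
have dFf : differentiable (F \o f) s by exact: differentiable_comp.
apply: DeriveDef; first exact: diff_derivable.
rewrite (deriveE _ dFf) diff_comp//= -El deriveE//.
Qed.

Lemma is_derive_pair (R : realType) (U W : normedModType R) (f : R -> U) (g : R -> W)
    (s : R) (l : U) (m : W) : is_derive s (1 : R) f l -> is_derive s (1 : R) g m ->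
  is_derive s (1 : R) (fun t => (f t, g t)) (l, m).
Proof.
move=> [df El] [dg Em].
have df' : differentiable f s by apply/derivable1_diffP.
have dg' : differentiable g s by apply/derivable1_diffP.
have dfg : differentiable (fun t => (f t, g t)) s by exact: differentiable_pair.
apply: DeriveDef; first exact: diff_derivable.
by rewrite (deriveE _ dfg) diff_pair//= -El -Em !deriveE.
Qed.

Lemma is_derive_shift_arg (R : realType) (W : normedModType R) (f : R -> W) (s t : R) (l : W) :
  is_derive (s + t) (1 : R) f l -> is_derive s (1 : R) (fun r => f (r + t)) l.
Proof.
move=> [df El].
have E : (fun h : R => h^-1 *: (((fun r => f (r + t)) \o shift s) (h *: (1 : R)) - f (s + t)))
       = (fun h : R => h^-1 *: ((f \o shift (s + t)) (h *: (1 : R)) - f (s + t))).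
  by apply/funext => h /=; rewrite addrA.
split; first by rewrite /derivable E; exact: df.
by rewrite /derive E.
Qed.

Section RealLemmas.
Variable R : realType.
Implicit Types (f E : R -> R) (lo hi : R).

Lemma MVT_open f df lo hi s t : lo < s -> s < t -> t < hi ->
  (forall r, lo < r -> r < hi -> is_derive r (1 : R) f (df r)) ->
  exists2 r, s < r < t & f t - f s = df r * (t - s).
Proof.
move=> los st thi Hf.
have H1 (r : R) : r \in `]s, t[ -> is_derive r (1 : R) f (df r).
  rewrite in_itv /= => /andP[sr rt]; apply: Hf; first exact: lt_trans sr.
  exact: lt_trans rt thi.
have H2 : {within `[s, t], continuous f}.
  apply: derivable_within_continuous => r; rewrite in_itv /= => /andP[sr rt].
  by case: (Hf r (lt_le_trans los sr) (le_lt_trans rt thi)).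
have [r] := MVT st H1 H2; rewrite in_itv /= => rst E; by exists r.
Qed.

Lemma is_derive0_cst f lo hi : (forall r, lo < r -> r < hi -> is_derive r (1 : R) f 0) ->
  forall s t, lo < s -> s < hi -> lo < t -> t < hi -> f s = f t.
Proof.
move=> Hf s t; wlog st : s t / s < t.
  move=> W ls sh lt th; case: (ltgtP s t) => [h|h|->//]; first exact: W.
  by rewrite (W t s).
move=> ls sh lt th; have [r _] := @MVT_open f (fun=> 0) lo hi s t ls st th Hf.
by rewrite mul0r => /eqP; rewrite subr_eq0 => /eqP.
Qed.

(** [E * expR (K s)] is nondecreasing and [E * expR (- K s)] is nonincreasing, which covers both
    directions of time. *)
Lemma gronwall E dE lo hi K : 0 <= K ->
  (forall r, lo < r -> r < hi -> is_derive r (1 : R) E (dE r) /\ `|dE r| <= K * E r) ->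
  forall s t, lo < s -> s < hi -> lo < t -> t < hi -> E s <= E t * expR (K * `|s - t|).
Proof.
move=> K0 HE.
have D k r : lo < r -> r < hi ->
    is_derive r (1 : R) (fun r => E r * expR (k * r)) ((dE r + k * E r) * expR (k * r)).
  move=> lr rh; have [h _] := HE r lr rh.
  have h2 : is_derive r (1 : R) (fun r => expR (k * r)) (expR (k * r) * k).
    have h3 : is_derive r (1 : R) (fun r => k * r) k.
      have := is_derive_affine 0 k r; rewrite (_ : (fun s => 0 + _) = (fun r => k * r))//.
      by apply/funext => u; rewrite add0r mulrC.
    exact: (is_derive1_comp (is_derive_expR (k * r)) h3).
  apply: is_derive_eq (is_deriveM h h2) _.
  by rewrite /GRing.scale /=; ring.
have mono k s t : lo < s -> s < t -> t < hi -> exists2 r, `|dE r| <= K * E r &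
   E t * expR (k * t) - E s * expR (k * s) = (dE r + k * E r) * expR (k * r) * (t - s).
  move=> ls st th; have [r /andP[sr rt] Er] := MVT_open ls st th (D k).
  by exists r => //; have [_] := HE r (lt_trans ls sr) (lt_trans rt th).
have expM (k s t : R) : expR (k * s) = expR (k * t) * expR (k * (s - t)).
  by rewrite -expRD -mulrDr addrC subrK.
move=> s t ls sh lt th; case: (ltgtP s t) => [st|ts|->].
- have [r + Er] := mono K s t ls st th; rewrite ler_norml => /andP[h _].
  have h1 : E s * expR (K * s) <= E t * expR (K * t).
    rewrite -subr_ge0 Er mulr_ge0 ?subr_ge0 ?(ltW st)// mulr_ge0 ?expR_ge0//; lra.
  rewrite distrC (gtr0_norm (_ : 0 < t - s)) ?subr_gt0//.
  rewrite -(ler_pM2r (expR_gt0 (K * s))); apply: le_trans h1 _.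
  by rewrite (expM K t s) -mulrA [expR (K * s) * _]mulrC.
- have [r + Er] := mono (- K) t s lt ts sh; rewrite ler_norml => /andP[_ h].
  have h1 : E s * expR (- K * s) <= E t * expR (- K * t).
    rewrite -subr_le0 Er mulr_le0_ge0 ?subr_ge0 ?(ltW ts)// mulr_le0_ge0 ?expR_ge0//; lra.
  rewrite (gtr0_norm (_ : 0 < s - t)) ?subr_gt0//.
  rewrite -(ler_pM2r (expR_gt0 (- K * s))); apply: le_trans h1 _.
  rewrite (expM (- K) t s) -mulrA [expR (- K * s) * _]mulrC.
  by rewrite (_ : - K * (t - s) = K * (s - t))//; ring.
- by rewrite subrr normr0 mulr0 expR0 mulr1.
Qed.

End RealLemmas.

(** Distances between solutions are measured by [dotv], which can be differentiated in time, unlike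
    the maximum norm; this converts the result back. *)
Lemma sqr_norm_le_dotv (R : realType) (n : nat) (u : 'rV[R]_n) : `|u| ^+ 2 <= dotv u u.
Proof.
have uu : 0 <= dotv u u by rewrite dotvE sumr_ge0// => i _; rewrite -expr2 sqr_ge0.
suff h : `|u| <= Num.sqrt (dotv u u).
  by rewrite -[leRHS]sqr_sqrtr// lerXn2r ?nnegrE// sqrtr_ge0.
apply: norm_le_coord => [|i]; first exact: sqrtr_ge0.
rewrite -sqrtr_sqr ler_wsqrtr// dotvE (bigD1 i)//= -expr2 lerDl sumr_ge0// => j _.
by rewrite -expr2 sqr_ge0.
Qed.

Lemma dotv_variation_le (R : realType) (n : nat) (dx dp A B : 'rV[R]_n) (K : R) : 0 <= K ->
  `|A| <= K * (`|dx| + `|dp|) -> `|B| <= K * (`|dx| + `|dp|) ->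
  `|dotv A dx + dotv dx A + (dotv (- B) dp + dotv dp (- B))|
    <= 8 * n%:R * K * (dotv dx dx + dotv dp dp).
Proof.
move=> K0 h1 h2; rewrite dotvNl dotvNr (dotvC A) (dotvC B).
have b1 := le_trans (norm_dotv dx A) (ler_wpM2l (ler0n R n) (ler_wpM2l (normr_ge0 dx) h1)).
have b2 := le_trans (norm_dotv dp B) (ler_wpM2l (ler0n R n) (ler_wpM2l (normr_ge0 dp) h2)).
have nK : 0 <= n%:R * K by rewrite mulr_ge0.
have c1 := sqr_norm_le_dotv dx; have c2 := sqr_norm_le_dotv dp.
move: (dotv dx A) (dotv dp B) (dotv dx dx) (dotv dp dp) `|dx| `|dp| b1 b2 c1 c2.
move: (n%:R : R) nK => N nK X Y DX DP r q b1 b2 c1 c2.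
have h3 : N * K * ((r + q) ^+ 2) <= N * K * (2 * (DX + DP)).
  by apply: ler_wpM2l => //; have := sqr_ge0 (r - q); lra.
by move: b1 b2; rewrite !ler_norml => /andP[b1 b1'] /andP[b2 b2']; apply/andP; split; nra.
Qed.

Section HamiltonianSystem.
Variables (R : realType) (n : nat).
Notation V := 'rV[R]_n.
Variable H : V -> V -> R.
Hypothesis C2F : C2 (fun z : V * V => H z.1 z.2).
Hypothesis posH : forall x p, posdef (Hpp H x p).
Hypothesis supH : superlinear H.
Hypothesis perH : periodic_x H.

(** An open time interval, because a calibrated curve and its momentum are known to solve the system
    only at negative times. *)
Definition Hsol (lo hi : R) (x p : R -> V) : Prop := forall s : R, lo < s -> s < hi ->
  is_derive s (1 : R) x (Hp H (x s) (p s)) /\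
  is_derive s (1 : R) p (- Hx H (x s) (p s)).

Lemma is_derive_dotv (f g : R -> V) (s : R) (l m : V) :
  is_derive s (1 : R) f l -> is_derive s (1 : R) g m ->
  is_derive s (1 : R) (fun t => dotv (f t) (g t)) (dotv l (g s) + dotv (f s) m).
Proof.
move=> [df El] [dg Em].
have -> : (fun t => dotv (f t) (g t)) = (\sum_(i < n) (fun t => f t 0 i * g t 0 i)).
  by apply/funext => t; rewrite dotvE fct_sumE.
rewrite !dotvE -big_split/=.
have dfi i : is_derive s (1 : R) (fun t => f t 0 i) (l 0 i).
  have h := (derivable_mxP f s (1 : R)).1 df 0 i.
  by apply: (DeriveDef h); rewrite -El (derive_mx df) mxE.
have dgi i : is_derive s (1 : R) (fun t => g t 0 i) (m 0 i).
  have h := (derivable_mxP g s (1 : R)).1 dg 0 i.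
  by apply: (DeriveDef h); rewrite -Em (derive_mx dg) mxE.
apply: is_derive_sum => i.
apply: is_derive_eq (is_deriveM (dfi i) (dgi i)) _.
by rewrite /GRing.scale /=; ring.
Qed.

Lemma energy_conserved lo hi x p : Hsol lo hi x p ->
  forall s t, lo < s -> s < hi -> lo < t -> t < hi -> H (x s) (p s) = H (x t) (p t).
Proof.
move=> sol; apply: is_derive0_cst => r lr rh; have [dx dp] := sol r lr rh.
have dF : differentiable (fun z : V * V => H z.1 z.2) (x r, p r) by case: C2F.
have := is_derive_diff_comp dF (is_derive_pair dx dp).
rewrite -deriveE// derive_Ham// dotvNl (dotvC (Hp H _ _)) subrr; exact.
Qed.

Lemma solutions_distance M : exists2 K, 0 <= K & forall lo hi x p x' p',
  Hsol lo hi x p -> Hsol lo hi x' p' ->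
  (forall s, lo < s -> s < hi -> `|p s| <= M /\ `|p' s| <= M) ->
  let E s := dotv (x s - x' s) (x s - x' s) + dotv (p s - p' s) (p s - p' s) in
  forall s t, lo < s -> s < hi -> lo < t -> t < hi -> E s <= E t * expR (K * `|s - t|).
Proof.
have [K K0 HK] := gradHam_lipschitz C2F perH M.
exists (8 * n%:R * K) => [|lo hi x p x' p' sol sol' pM E]; first by rewrite !mulr_ge0.
pose A s := Hp H (x s) (p s) - Hp H (x' s) (p' s).
pose B s := Hx H (x s) (p s) - Hx H (x' s) (p' s).
pose dE s := dotv (A s) (x s - x' s) + dotv (x s - x' s) (A s)
   + (dotv (- B s) (p s - p' s) + dotv (p s - p' s) (- B s)).
apply: (@gronwall _ E dE); first by rewrite !mulr_ge0.
move=> s ls sh; have [dx dp] := sol s ls sh; have [dx' dp'] := sol' s ls sh.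
have [pMs p'Ms] := pM s ls sh.
have [h1 h2] := HK (x s) (x' s) _ _ pMs p'Ms.
split; last exact: (dotv_variation_le K0 h1 h2).
have D1 : is_derive s (1 : R) (fun t => x t - x' t) (A s) by exact: is_deriveB.
have D2 : is_derive s (1 : R) (fun t => p t - p' t) (- B s).
  have D3 : is_derive s (1 : R) (fun t => p t - p' t)
    (- Hx H (x s) (p s) - - Hx H (x' s) (p' s)) by exact: is_deriveB.
  by apply: is_derive_eq D3 _; rewrite opprB opprK addrC.
have D4 := is_derive_dotv D1 D1; have D5 := is_derive_dotv D2 D2.
exact: (is_deriveD D4 D5).
Qed.

(** Conservation of energy confines both momenta to one sublevel of [H], where the vector field is
    Lipschitz and Gronwall's inequality applies. *)
Lemma Hsol_unique lo hi x p x' p' t0 : lo < t0 -> t0 < hi ->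
  Hsol lo hi x p -> Hsol lo hi x' p' -> x t0 = x' t0 -> p t0 = p' t0 ->
  forall s, lo < s -> s < hi -> x s = x' s /\ p s = p' s.
Proof.
move=> lt th sol sol' ex ep s ls sh.
have [M M0 HM] := sublevel_bounded C2F supH perH (H (x t0) (p t0)).
have [K K0 HK] := solutions_distance M.
have b r : lo < r -> r < hi -> `|p r| <= M /\ `|p' r| <= M.
  move=> lr rh; split; first by apply: (HM (x r)); rewrite (energy_conserved sol lr rh lt th).
  by apply: (HM (x' r)); rewrite (energy_conserved sol' lr rh lt th) -ex -ep.
have := HK _ _ _ _ _ _ sol sol' b s t0 ls sh lt th.
rewrite ex ep !subrr !dot0v addr0 mul0r => h.
have h1 := sqr_norm_le_dotv (x s - x' s); have h2 := sqr_norm_le_dotv (p s - p' s).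
have h3 := sqr_ge0 `|x s - x' s|; have h4 := sqr_ge0 `|p s - p' s|.
have e1 : `|x s - x' s| ^+ 2 = 0 by lra.
have e2 : `|p s - p' s| ^+ 2 = 0 by lra.
by split; apply/eqP; rewrite -subr_eq0 -normr_eq0 -sqrf_eq0 ?e1 ?e2.
Qed.

End HamiltonianSystem.

Lemma is_derive_slope_left (R : realType) (W : normedModType R) (f : R -> W) (s : R) (l : W) :
  is_derive s (1 : R) f l -> t^-1 *: (f (s + t) - f s) @[t --> (0 : R)^'-] --> l.
Proof.
move=> [df El]; have c0 : h^-1 *: ((f \o shift s) (h *: (1 : R)) - f s) @[h --> (0 : R)^'] --> l.
  by rewrite -El; exact: df.
apply/cvgrPdist_le => e e0; move/cvgrPdist_le : c0 => /(_ _ e0) /nbhs_ballP[d /= d0 Hd].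
apply: (near_left0 d0) => t t0 td.
have b : ball (0 : R) d (- t) by rewrite -ball_normE /= sub0r opprK gtr0_norm.
have := Hd _ b; rewrite oppr_eq0 gt_eqF// => /(_ isT).
by rewrite [- t *: 1]mulr1 [- t + s]addrC.
Qed.

Lemma is_derive_continuous (R : realType) (W : normedModType R) (f : R -> W) (s : R) (l : W) :
  is_derive s (1 : R) f l -> f t @[t --> s] --> f s.
Proof.
move=> [df _]; have dd : differentiable f s by apply/derivable1_diffP.
exact: (differentiable_continuous dd).
Qed.

Section Flows.
Variables (R : realType) (n : nat).
Notation V := 'rV[R]_n.
Variable H : V -> V -> R.
Hypothesis C2F : C2 (fun z : V * V => H z.1 z.2).
Hypothesis posH : forall x p, posdef (Hpp H x p).
Hypothesis supH : superlinear H.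
Hypothesis perH : periodic_x H.
Variable phiH : R -> V * V -> V * V.
Hypothesis fH : is_Hflow H phiH.

Lemma flow0 z : phiH 0 z = z. Proof. by case: (fH z). Qed.

Lemma flow_Hsol lo hi z : Hsol H lo hi (fun t => (phiH t z).1) (fun t => (phiH t z).2).
Proof. by move=> s _ _; case: (fH z) => _; exact. Qed.

Lemma Hsol_shift lo hi t x p : Hsol H lo hi x p ->
  Hsol H (lo - t) (hi - t) (fun s => x (s + t)) (fun s => p (s + t)).
Proof.
move=> sol s; rewrite ltrBlDr ltrBrDr => ls sh; have [dx dp] := sol _ ls sh.
by split; exact: is_derive_shift_arg.
Qed.

Lemma Hsol_flow lo hi x p : Hsol H lo hi x p -> lo < 0 -> 0 < hi ->
  forall s, lo < s -> s < hi -> phiH s (x 0, p 0) = (x s, p s).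
Proof.
move=> sol l0 h0 s ls sh.
have e0 := flow0 (x 0, p 0).
have [||e1 e2] := Hsol_unique C2F supH perH l0 h0 (@flow_Hsol lo hi (x 0, p 0)) sol _ _ ls sh.
- by rewrite e0.
- by rewrite e0.
- by rewrite [LHS]surjective_pairing e1 e2.
Qed.

Lemma flowD s t z : phiH (s + t) z = phiH s (phiH t z).
Proof.
pose N := `|s| + 1.
have N0 : 0 < N by rewrite ltr_wpDl.
have Nm0 : - N < 0 by rewrite oppr_lt0.
have sN : s < N by rewrite /N (le_lt_trans (ler_norm _))// ltrDl.
have Ns : - N < s.
  by rewrite ltrNl /N (le_lt_trans (ler_norm _))// normrN ltrDl.
have sol : Hsol H (- N) N (fun s => (phiH (s + t) z).1) (fun s => (phiH (s + t) z).2).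
  have := Hsol_shift (t := t) (@flow_Hsol (- N + t) (N + t) z).
  by rewrite !addrK.
have := Hsol_flow sol Nm0 N0 Ns sN.
by rewrite add0r -!surjective_pairing.
Qed.

Lemma flowK s z : phiH s (phiH (- s) z) = z.
Proof. by rewrite -flowD subrr flow0. Qed.

Lemma flow_periodic s z k : intvec k ->
  phiH s (z.1 + k, z.2) = ((phiH s z).1 + k, (phiH s z).2).
Proof.
move=> ki; pose N := `|s| + 1.
have N0 : 0 < N by rewrite ltr_wpDl.
have Nm0 : - N < 0 by rewrite oppr_lt0.
have sN : s < N by rewrite /N (le_lt_trans (ler_norm _))// ltrDl.
have Ns : - N < s.
  by rewrite ltrNl /N (le_lt_trans (ler_norm _))// normrN ltrDl.
have sol : Hsol H (- N) N (fun s => (phiH s z).1 + k) (fun s => (phiH s z).2).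
  move=> r lr rh; have [d1 d2] := @flow_Hsol (- N) N z r lr rh.
  rewrite (Hp_periodic perH)// (Hx_periodic perH)//; split=> //.
  by apply: is_derive_eq (is_deriveD d1 (is_derive_cst k r (1 : R))) _; rewrite addr0.
by have := Hsol_flow sol Nm0 N0 Ns sN; rewrite flow0.
Qed.

Lemma flow_energy s z : H (phiH s z).1 (phiH s z).2 = H z.1 z.2.
Proof.
pose N := `|s| + 1.
have N0 : 0 < N by rewrite ltr_wpDl.
have Nm0 : - N < 0 by rewrite oppr_lt0.
have sN : s < N by rewrite /N (le_lt_trans (ler_norm _))// ltrDl.
have Ns : - N < s.
  by rewrite ltrNl /N (le_lt_trans (ler_norm _))// normrN ltrDl.
by rewrite (energy_conserved C2F (@flow_Hsol (- N) N z) Ns sN Nm0 N0) flow0.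
Qed.

Lemma flow_continuous s : continuous (phiH s).
Proof.
apply: continuousI => z0; apply/cvgrPdist_le => e e0.
(* Initial data near [z0] have energy at most [H z0.1 z0.2 + 1], which is conserved, so one momentum
   bound serves all orbits compared. *)
have [M M0 HM] := sublevel_bounded C2F supH perH (H z0.1 z0.2 + 1).
have [K K0 HK] := solutions_distance C2F perH M.
pose D := 2 * n%:R * expR (K * `|s|) + 1.
have D0 : 0 < D by rewrite ltr_wpDl// !mulr_ge0// expR_ge0.
pose d := Num.min 1 (e ^+ 2 / D).
have d0 : 0 < d by rewrite lt_min ltr01 divr_gt0// exprn_gt0.
have cH : H z.1 z.2 @[z --> z0] --> H z0.1 z0.2 by exact: (continuous_Ham C2F).
have /cvgrPdist_le/(_ _ (@ltr01 R)) nH := cH.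
have nB : nbhs z0 (ball z0 d) by exact: nbhsx_ballx.
apply: filterS2 nB nH => z; rewrite -ball_normE /= => zd.
rewrite ler_norml => /andP[zh _]; have zH : H z.1 z.2 <= H z0.1 z0.2 + 1 by lra.
pose N := `|s| + 1.
have N0 : 0 < N by rewrite ltr_wpDl.
have Nm0 : - N < 0 by rewrite oppr_lt0.
have sN : s < N by rewrite /N (le_lt_trans (ler_norm _))// ltrDl.
have Ns : - N < s.
  by rewrite ltrNl /N (le_lt_trans (ler_norm _))// normrN ltrDl.
have b r : - N < r -> r < N -> `|(phiH r z0).2| <= M /\ `|(phiH r z).2| <= M.
  move=> _ _; split; first by apply: (HM (phiH r z0).1); rewrite flow_energy// lerDl.
  by apply: (HM (phiH r z).1); rewrite flow_energy.
have := HK _ _ _ _ _ _ (@flow_Hsol (- N) N z0) (@flow_Hsol (- N) N z) b s 0 Ns sN Nm0 N0.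
rewrite subr0 !flow0.
set dx := (phiH s z0).1 - _; set dp := (phiH s z0).2 - _.
have z1 : `|z0.1 - z.1| <= `|z0 - z| by rewrite [leRHS]prod_normE le_max lexx.
have z2 : `|z0.2 - z.2| <= `|z0 - z| by rewrite [leRHS]prod_normE le_max lexx orbT.
have sq (u : V) : `|u| <= `|z0 - z| -> dotv u u <= n%:R * (`|z0 - z| * `|z0 - z|).
  move=> h; apply: le_trans (ler_norm _) _; apply: le_trans (norm_dotv _ _) _.
  by rewrite ler_wpM2l// ler_pM.
have := sq _ z1; have := sq _ z2.
set a1 := dotv (z0.1 - _) _; set a2 := dotv (z0.2 - _) _ => h2 h1 h3.
have ex0 := expR_ge0 (K * `|s|).
have h4 : (a1 + a2) * expR (K * `|s|) <= D * (`|z0 - z| * `|z0 - z|).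
  have zz : 0 <= `|z0 - z| * `|z0 - z| by rewrite mulr_ge0.
  apply: le_trans (ler_wpM2r ex0 (lerD h1 h2)) _; rewrite /D; lra.
have h5 : D * (`|z0 - z| * `|z0 - z|) <= e ^+ 2.
  move: zd; rewrite lt_min ltr_pdivlMr// => /andP[/ltW z3 /ltW z4].
  by apply: le_trans z4; rewrite mulrCA ler_wpM2l// mulrC ler_piMl// ltW.
have c1 := sqr_norm_le_dotv dx; have c2 := sqr_norm_le_dotv dp.
have s1 := sqr_ge0 `|dx|; have s2 := sqr_ge0 `|dp|.
have e0' := ltW e0.
rewrite prod_normE /= ge_max -/dx -/dp.
by apply/andP; split; rewrite -(@ler_pXn2r _ 2%N) ?nnegrE//; lra.
Qed.

Variable phiL : R -> V * V -> V * V.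
Hypothesis fL : is_ELflow H phiL.

Definition Legendre (z : V * V) : V * V := (z.1, Hp H z.1 z.2).

(** An Euler-Lagrange orbit, with [Lxi] as momentum, solves Hamilton's equations. Comparing in this
    direction relies only on uniqueness for the Hamiltonian system. *)
Lemma ELflowE s z : phiL s (Legendre z) = Legendre (phiH s z).
Proof.
pose N := `|s| + 1.
have N0 : 0 < N by rewrite ltr_wpDl.
have Nm0 : - N < 0 by rewrite oppr_lt0.
have sN : s < N by rewrite /N (le_lt_trans (ler_norm _))// ltrDl.
have Ns : - N < s.
  by rewrite ltrNl /N (le_lt_trans (ler_norm _))// normrN ltrDl.
have [L0 HL] := fL (Legendre z).
pose X t := (phiL t (Legendre z)).1; pose Y t := (phiL t (Legendre z)).2.
have LP t : Lxi H (X t) (Y t) = Pmax H (X t) (Y t) by rewrite (LxiE C2F posH supH perH).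
have sol : Hsol H (- N) N X (fun t => Pmax H (X t) (Y t)).
  move=> r _ _; have [d1 d2] := HL r.
  rewrite (Hp_Pmax C2F supH perH); split=> //.
  rewrite -(LxE C2F posH supH perH).
  have -> : (fun t => Pmax H (X t) (Y t)) = (fun t => Lxi H (X t) (Y t)).
    by apply/funext => t; rewrite LP.
  exact: d2.
have := Hsol_flow sol Nm0 N0 Ns sN.
rewrite /X /Y L0 /= (Pmax_Hp C2F posH supH perH) -surjective_pairing => ->.
by rewrite /Legendre /= (Hp_Pmax C2F supH perH) -surjective_pairing.
Qed.

End Flows.

Section CalibratedOrbits.
Variables (R : realType) (n : nat).
Notation V := 'rV[R]_n.
Variable H : V -> V -> R.
Hypothesis C2F : C2 (fun z : V * V => H z.1 z.2).
Hypothesis posH : forall x p, posdef (Hpp H x p).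
Hypothesis supH : superlinear H.
Hypothesis perH : periodic_x H.
Variables (c : V) (a : R) (v : V -> R).
Hypothesis perv : periodicT v.
Hypothesis vv : visc_sol H c a v.
Variable phiH : R -> V * V -> V * V.
Hypothesis fH : is_Hflow H phiH.

(** At time 0 the function [v] may fail to be differentiable, so the momentum there is obtained by
    flowing the state at time -1 forward. Uniqueness matches orbit and curve at negative times,
    continuity matches positions at 0. If [v] is differentiable at [g 0], the left velocities agree
    and [Hp_inj] gives the momentum. *)
Lemma qcal_orbit C Xi g : 0 <= C -> 0 <= Xi -> qcal H c a v C Xi g ->
  exists z, [/\ forall s, s <= 0 -> (phiH s z).1 = g s,
    forall s, s < 0 -> graphv c v (phiH s z) &
    differentiable v (g 0) -> z = (g 0, c + grad v (g 0))].
Proof.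
move=> C0 Xi0 qg; pose w := (g (-1), c + grad v (g (-1))); pose z := phiH 1 w.
have E s : s < 0 -> phiH s z = (g s, c + grad v (g s)).
  move=> s0; pose lo := Num.min s (-1) - 1.
  have los : lo < s by rewrite /lo (lt_le_trans (_ : _ < Num.min s (-1)))// ?ge_min ?lexx// gtrBl.
  have lo1 : lo < -1.
    by rewrite /lo (lt_le_trans (_ : _ < Num.min s (-1)))// ?ge_min ?lexx ?orbT// gtrBl.
  have m10 : -1 < 0 :> R by rewrite ltrN10.
  have sol1 : Hsol H lo 0 g (fun t => c + grad v (g t)).
    move=> r lr r0; split.
      exact: (qcal_is_derive C2F posH supH perH perv vv C0 Xi0 qg r0).
    exact: (pg_is_derive C2F posH supH perH perv vv C0 Xi0 qg r0).
  have sol2 : Hsol H lo 0 (fun t => (phiH t z).1) (fun t => (phiH t z).2).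
    exact: flow_Hsol.
  have E1 : phiH (-1) z = w.
    by rewrite -(flowD C2F supH perH fH) addNr (flow0 fH).
  have [||e1 e2] := Hsol_unique C2F supH perH lo1 m10 sol2 sol1 _ _ los s0.
  - by rewrite E1.
  - by rewrite E1.
  - by rewrite [LHS]surjective_pairing e1 e2.
have dphi : is_derive (0 : R) (1 : R) (fun t => (phiH t z).1) (Hp H z.1 z.2).
  by have [E0 /(_ 0) []] := fH z; rewrite E0.
have z1 : z.1 = g 0.
  have cp : (phiH t z).1 @[t --> (0 : R)^'-] --> (phiH 0 z).1.
    exact: (cvg_at_left_filter (is_derive_continuous dphi)).
  rewrite (flow0 fH) in cp.
  have cg : (phiH t z).1 @[t --> (0 : R)^'-] --> g 0.
    apply/cvgrPdist_le => e e0; apply: (@near_left0 _ _ (e / (Xi + 1))) => [|t t0 td].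
      by rewrite divr_gt0// ltr_wpDl.
    rewrite E ?oppr_lt0//=; have := qcal_lipschitz qg (_ : - t <= 0) (lexx 0).
    rewrite oppr_le0 ltW// => /(_ isT); rewrite sub0r opprK => /le_trans; apply.
    by move: td; rewrite ltr_pdivlMr ?ltr_wpDl//; nra.
  exact: (cvg_unique _ cp cg).
exists z; split=> [s s0|s s0|dv].
- move: s0; rewrite le_eqVlt => /predU1P[->|s0]; first by rewrite (flow0 fH).
  by rewrite E.
- rewrite E//; split; last by [].
  exact: (qcal_differentiable C2F posH supH perH perv vv C0 qg s0).
- rewrite [LHS]surjective_pairing z1; congr pair.
  apply: (Hp_inj C2F posH (x := g 0)); rewrite -{1}z1.
  have c1 := slope_left C2F posH supH perH perv vv C0 Xi0 qg (lexx 0) dv.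
  have c2 := is_derive_slope_left dphi.
  have c3 : t^-1 *: ((phiH (0 + t) z).1 - (phiH 0 z).1) @[t --> (0 : R)^'-]
      --> Hp H (g 0) (c + grad v (g 0)).
    apply: cvg_trans c1; apply: near_eq_cvg; apply: (@near_left0 _ _ 1) => // t t0 _.
    by rewrite !add0r E ?oppr_lt0//= (flow0 fH) z1.
  exact: (cvg_unique _ c2 c3).
Qed.

End CalibratedOrbits.

(** * Absolutely continuous functions *)

Section Families.
Variable R : realType.
Implicit Types (I J : seq (R * R)) (f : R -> R).

Definition nonoverlapping I := all (fun i => i.1 <= i.2) I &&
  pairwise (fun i j : R * R => (i.2 <= j.1) || (j.2 <= i.1)) I.

Definition total_length I := \sum_(i <- I) (i.2 - i.1).

Definition family_variation f I := \sum_(i <- I) `|f i.2 - f i.1|.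

(* Global counterpart of [ACon]; a function absolutely continuous on [[s, t]]
   enters through its composition with [clamp s t]. *)
Definition abs_continuous f := forall e, 0 < e -> exists2 d, 0 < d &
  forall I, nonoverlapping I -> total_length I < d -> family_variation f I < e.

Lemma fam_cons i I : nonoverlapping (i :: I) -> i.1 <= i.2 /\ nonoverlapping I.
Proof. by rewrite /nonoverlapping /= => /andP[/andP[i12 aI] /andP[_ pI]]; rewrite i12 aI pI. Qed.

Lemma fam_nth I i0 : nonoverlapping I ->
  (forall i, (i < size I)%N -> (nth i0 I i).1 <= (nth i0 I i).2) /\
  (forall i j, (i < size I)%N -> (j < size I)%N -> i <> j ->
     (nth i0 I i).2 <= (nth i0 I j).1 \/ (nth i0 I j).2 <= (nth i0 I i).1).
Proof.
move=> /andP[/(all_nthP i0) h /(pairwiseP i0) pI]; split; first exact: h.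
move=> i j iI jI ij; case: (ltngtP i j) => // [lij|lji].
  by have /orP := pI _ _ iI jI lij.
by have /orP := pI _ _ jI iI lji; rewrite or_comm.
Qed.

Lemma fam_cat I J : nonoverlapping I -> nonoverlapping J ->
  (forall i j, i \in I -> j \in J -> i.2 <= j.1 \/ j.2 <= i.1) -> nonoverlapping (I ++ J).
Proof.
move=> /andP[aI pI] /andP[aJ pJ] IJ; rewrite /nonoverlapping all_cat aI aJ pairwise_cat pI pJ /= !andbT.
by apply/allrelP => i j iI jJ; apply/orP; exact: IJ.
Qed.

Lemma variation_fam f s x : path <%R x s ->
  exists J, [/\ nonoverlapping J, (forall j, j \in J -> x <= j.1 /\ j.2 <= last x s),
    total_length J = last x s - x & variation x (last x s) f s = family_variation f J].
Proof.
elim: s x => [|y s IH] x /=.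
  move=> _; exists [::]; split => //; rewrite /total_length ?big_nil ?subrr //.
  by rewrite /family_variation variation_nil big_nil.
move=> /andP[xy ys]; have [J [fJ bJ lJ vJ]] := IH _ ys.
have yl : y <= last y s.
  move: ys; rewrite lt_path_sortedE => /andP[/allP h _].
  by have := mem_last y s; rewrite inE => /predU1P[->//|/h/ltW].
exists ((x, y) :: J); split.
- have -> : (x, y) :: J = [:: (x, y)] ++ J by [].
  apply: fam_cat => //; first by rewrite /nonoverlapping /= (ltW xy).
  by move=> i j; rewrite inE => /eqP -> /bJ[yj _]; left.
- move=> j; rewrite inE => /predU1P[-> //=|/bJ[yj jl]]; split => //.
  exact: le_trans (ltW xy) yj.
- by rewrite /total_length big_cons /= -/(total_length J) lJ; ring.
- rewrite /family_variation big_cons -/(family_variation f J) -vJ !variation_zip /=; first by rewrite big_cons.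
    by split.
  by split => //=; rewrite xy ys.
Qed.

Lemma ac_variation f (d e : R) (x y : R) : x <= y ->
  (forall J, nonoverlapping J -> total_length J < d -> family_variation f J < e) -> y - x < d ->
  (total_variation x y f <= e%:E)%E.
Proof.
move=> xy fJ lxy; apply: ge_ereal_sup => _ [_ [s [xs /eqP ly] <-] <-].
rewrite lee_fin; have [J [hJ _ lJ vJ]] := variation_fam f xs.
by rewrite -ly vJ; apply/ltW/fJ => //; rewrite lJ ly.
Qed.

Lemma ac_bounded_variation f x y : abs_continuous f -> x <= y ->
  total_variation x y f \is a fin_num.
Proof.
move=> /(_ 1 ltr01)[d d0 fJ] xy.
have base x' y' : x' <= y' -> y' - x' < d -> total_variation x' y' f \is a fin_num.
  move=> h lxy; rewrite ge0_fin_numE ?total_variation_ge0 //.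
  by apply: le_lt_trans (ac_variation h fJ _) (ltry _).
(* Each induction step cuts off an interval of length [d / 2], on which the variation is finite. *)
have H k : forall x y, x <= y -> y - x < k%:R * (d / 2) + d / 2 ->
    total_variation x y f \is a fin_num.
  elim: k => [|k IH] {}x {}y {}xy; rewrite ?mul0r ?add0r => lxy.
    by apply: base => //; lra.
  have [yx|yx] := ltP (y - x) d; first exact: base.
  rewrite (@total_variationD _ x y (y - d / 2)); [|lra|lra].
  rewrite fin_numD IH ?base //=; [lra|lra|lra|].
  by move: lxy; rewrite -addn1 natrD; lra.
have q0 : 0 <= (y - x) / (d / 2) by apply: divr_ge0; lra.
apply: (H (Num.bound ((y - x) / (d / 2)))) => //.
have := archi_boundP q0; rewrite ltr_pdivrMr; last by lra.
by lra.
Qed.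

(** Each interval is subdivided until its total variation is nearly attained; the allowed excess is
    halved from one interval to the next. A family of small total length stays one, so absolute
    continuity passes from [f] to its variation. *)
Lemma tv_fam f (e : R) I : abs_continuous f -> 0 < e -> nonoverlapping I ->
  exists J, [/\ nonoverlapping J, (forall j, j \in J -> exists2 i, i \in I & i.1 <= j.1 /\ j.2 <= i.2),
    total_length J <= total_length I & \sum_(i <- I) fine (total_variation i.1 i.2 f) <= family_variation f J + e].
Proof.
move=> acf; elim: I e => [|i I IH] e e0 fI.
  by exists [::]; rewrite /total_length /family_variation !big_nil; split => //; lra.
have [i12 fI'] := fam_cons fI.
have [J [fJ bJ lJ vJ]] := IH _ (divr_gt0 e0 (@ltr0n R 2)) fI'.
have tf := ac_bounded_variation acf i12.
have [_ [_ [s [xs /eqP ly] <-] <-] hs] : exists2 y, [set x%:E | x in variations i.1 i.2 f] y &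
    ((fine (total_variation i.1 i.2 f) - e / 2)%:E < y)%E.
  apply: ereal_sup_gt; apply: (@lt_le_trans _ _ (fine (total_variation i.1 i.2 f))%:E).
    by rewrite lte_fin; lra.
  by rewrite fineK.
have [K [fK bK lK vK]] := variation_fam f xs.
exists (K ++ J); split.
- apply: fam_cat => // k j kK /bJ[i' i'I [ij ji]].
  have [ki ik] := bK _ kK; rewrite ly in ik.
  move: fI => /andP[_ /= /andP[/allP h _]]; have /orP[h'|h'] := h _ i'I.
    by left; lra.
  by right; lra.
- move=> j; rewrite mem_cat => /orP[jK|/bJ[i' i'I h]].
    by exists i; [rewrite mem_head|rewrite -ly; exact: bK].
  by exists i' => //; rewrite inE i'I orbT.
- by rewrite /total_length big_cat big_cons -/(total_length K) -/(total_length J) -/(total_length I) /= lK ly lerD2l.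
- rewrite /family_variation big_cat big_cons -/(family_variation f K) -/(family_variation f J) /= -vK ly.
  by move: hs vJ; rewrite lte_fin; lra.
Qed.

Lemma ac_tv f (e : R) : abs_continuous f -> 0 < e -> exists2 d, 0 < d &
  forall I, nonoverlapping I -> total_length I < d -> \sum_(i <- I) fine (total_variation i.1 i.2 f) < e.
Proof.
move=> acf e0; have [d d0 h] := acf _ (divr_gt0 e0 (@ltr0n R 2)).
exists d => // I fI lI.
have e3 : 0 < e / 3 by lra.
have [J [fJ _ lJ vJ]] := tv_fam acf e3 fI.
by have := h _ fJ (le_lt_trans lJ lI); lra.
Qed.

Lemma fam_map (g : R -> R) I : {homo g : x y / x <= y} -> nonoverlapping I ->
  nonoverlapping [seq (g i.1, g i.2) | i <- I].
Proof.
move=> mg /andP[aI pI]; apply/andP; split.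
  by rewrite all_map; apply: sub_all aI => i /=; exact: mg.
rewrite pairwise_map; apply: sub_pairwise pI => i j /= /orP[h|h]; apply/orP; [left|right]; exact: mg.
Qed.

(** Jordan decomposition by the variation counted from [s]. Constancy of [f] outside [[s, t]] keeps
    both parts bounded, so that their Stieltjes measures on the line are finite. *)
Lemma ac_decomposition f s t : s <= t -> abs_continuous f ->
  (forall x, x <= s -> f x = f s) -> (forall x, t <= x -> f x = f t) ->
  exists G1 G2 : R -> R, [/\ f = G1 \- G2,
    {homo G1 : x y / x <= y} /\ {homo G2 : x y / x <= y}, abs_continuous G1 /\ abs_continuous G2,
    (exists B, forall x, `|G1 x| <= B) & exists B, forall x, `|G2 x| <= B].
Proof.
move=> st acf fs ft.
pose G x := fine (total_variation s (Num.max s x) f).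
have sm x : s <= Num.max s x by rewrite le_max lexx.
have mm x y : x <= y -> Num.max s x <= Num.max s y.
  by move=> xy; rewrite ge_max sm /= le_max xy orbT.
have fm x : f x = f (Num.max s x).
  by case: (leP s x) => [//|/ltW /fs].
have GB x y : x <= y -> G y - G x = fine (total_variation (Num.max s x) (Num.max s y) f).
  move=> xy; rewrite /G (total_variationD f (sm x) (mm _ _ xy)) fineD ?ac_bounded_variation //; last exact: mm.
  by ring.
have Gf x y : x <= y -> `|f y - f x| <= G y - G x.
  move=> xy; rewrite GB // (fm x) (fm y) -lee_fin fineK; last exact: ac_bounded_variation (mm _ _ xy).
  exact: total_variation_ge (mm _ _ xy).
have acG : abs_continuous G.
  move=> e e0; have [d d0 h] := ac_tv acf e0; exists d => // I fI lI.
  have fI' : nonoverlapping [seq (Num.max s i.1, Num.max s i.2) | i <- I] by apply: fam_map => // x y; exact: mm.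
  apply: le_lt_trans (h _ fI' _); last first.
    apply: le_lt_trans lI; rewrite /total_length big_map /= !big_seq; apply: ler_sum => i iI.
    have : i.1 <= i.2 by move: fI => /andP[/allP/(_ _ iI)].
    by case: (leP s i.1); case: (leP s i.2); lra.
  rewrite /family_variation big_map /= !big_seq; apply: ler_sum => i iI.
  have i12 : i.1 <= i.2 by move: fI => /andP[/allP/(_ _ iI)].
  by rewrite -GB // ger0_norm //; apply: le_trans (Gf _ _ i12).
have G12 : f = G \- (G \- f) by apply/funext => x /=; ring.
have Gm : {homo G : x y / x <= y}.
  by move=> x y xy; rewrite -subr_ge0; apply: le_trans (Gf _ _ xy).
have Gs : G s = 0 by rewrite /G maxxx total_variationxx.
have Glo x : x <= s -> G x = 0.
  by move=> xs; rewrite /G max_l // total_variationxx.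
have G0 x : 0 <= G x.
  by have [/Glo ->//|/ltW /Gm] := leP x s; rewrite Gs.
have Gt x : G x <= G t.
  have [/Gm //|/ltW tx] := leP x t; rewrite -subr_le0 GB // nondecreasing_total_variation.
  - by rewrite /= (max_r st) (max_r (le_trans st tx)) ft // subrr.
  - exact: mm.
  - move=> y z; rewrite !in_itv /= (max_r st) => /andP[ty _] /andP[tz _] _.
    by rewrite (ft _ ty) (ft _ tz).
have fB x : `|f x - f s| <= G t.
  have [xs|/ltW sx] := leP x s; first by rewrite fs // subrr normr0.
  by apply: le_trans (Gf _ _ sx) _; rewrite Gs subr0.
exists G, (G \- f); split => //; last 2 first.
- by exists (G t) => x; rewrite ger0_norm.
- exists (G t + G t + `|f s|) => x /=; have := fB x; have := Gt x; have := G0 x.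
  have := ler_norm (f s); have := ler_norm (- f s); rewrite normrN !ler_norml; lra.
- split=> // x y xy /=; have := Gf _ _ xy; have := ler_norm (f y - f x); lra.
- split=> // e e0; have e2 : 0 < e / 2 by lra.
  have [d1 d10 h1] := acG _ e2; have [d2 d20 h2] := acf _ e2.
  exists (Num.min d1 d2); first by rewrite lt_min d10.
  move=> I fI; rewrite lt_min => /andP[l1 l2].
  apply: (@le_lt_trans _ _ (family_variation G I + family_variation f I)); last first.
    by have := h1 _ fI l1; have := h2 _ fI l2; lra.
  rewrite /family_variation -big_split /=; apply: ler_sum => i _.
  have -> : G i.2 - f i.2 - (G i.1 - f i.1) = (G i.2 - G i.1) - (f i.2 - f i.1) by ring.
  exact: ler_normB.
Qed.

End Families.

(** * Density of the Stieltjes measure of a monotone absolutely continuous function *)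

Section Stieltjes.
Variable R : realType.
Local Notation mu := (@lebesgue_measure R).
Variables (G : R -> R) (B : R).
Hypothesis Gmono : {homo G : x y / x <= y}.
Hypothesis Gac : abs_continuous G.
Hypothesis GB : forall x, `|G x| <= B.

Lemma ac_continuous x : G y @[y --> x] --> G x.
Proof.
apply/cvgrPdist_lt => e e0; have [d d0 h] := Gac e0.
have N : nbhs x (ball x d) by exact: nbhsx_ballx.
apply: filterS N => y; rewrite /ball /= => xy.
have [l|l] := leP x y.
  have := h [:: (x, y)]; rewrite /nonoverlapping /total_length /family_variation !big_seq1 /= l distrC; apply => //.
  by apply: le_lt_trans xy; rewrite distrC ler_norm.
have := h [:: (y, x)]; rewrite /nonoverlapping /total_length /family_variation !big_seq1 /= (ltW l); apply => //.
by apply: le_lt_trans xy; rewrite ler_norm.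
Qed.

Fact Grc : right_continuous G.
Proof. by apply: right_continuousW => x; exact: ac_continuous. Qed.

Let cum : cumulative R R := HB.pack G (isCumulative.Build R _ R G Gmono Grc).
Let nu := lebesgue_stieltjes_measure cum.

Lemma stieltjes_itv x y : x <= y -> nu `]x, y] = (G y - G x)%:E.
Proof.
move=> xy; rewrite /nu /lebesgue_stieltjes_measure /measure_extension measurable_mu_extE /=.
  by rewrite wlength_itv_bnd.
exact: is_ocitv.
Qed.

Lemma stieltjes_setT : (nu setT <= (B + B)%:E)%E.
Proof.
rewrite -(bigcup_itvT false false).
pose I n : set R := `]- (n%:R), n%:R]%classic.
have c : (nu \o I) n @[n --> \oo] --> nu (\bigcup_n I n).
  apply: nondecreasing_cvg_mu; rewrite /I//; first exact: bigcup_measurable.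
  by move=> *; apply/subsetPset/subset_itv; rewrite leBSide/= ?lerN2 ler_nat.
have hc : cvg ((nu \o I) n @[n --> \oo]) by apply/cvg_ex; eexists; exact: c.
rewrite -(cvg_lim _ c) //; apply: lime_le => //.
apply: nearW => n /=; rewrite /I stieltjes_itv ?lee_fin ?ge0_cp //.
by have := GB n%:R; have := GB (- n%:R); rewrite !ler_norml; lra.
Qed.

Lemma stieltjes_fin : fin_num_fun nu.
Proof.
move=> U mU; rewrite ge0_fin_numE // (le_lt_trans _ (ltry (B + B))) //.
by apply: le_trans stieltjes_setT; apply: le_measure; rewrite ?inE.
Qed.

HB.instance Definition _ := Measure.on nu.
HB.instance Definition _ := Measure_isFinite.Build _ _ _ nu stieltjes_fin.

Lemma bounded_open_itv (I : set R) (d : R) : open I -> is_interval I ->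
  (mu I < d%:E)%E -> exists ab : R * R, I = `]ab.1, ab.2[%classic.
Proof.
move=> oI iI lI; have mI : measurable I by apply: is_interval_measurable.
have H x y : I x -> I y -> y - x < d.
  move=> Ix Iy; have [xy|yx] := ltP x y; last first.
    have : (0%E <= mu I)%E by exact: measure_ge0.
    by move=> /le_lt_trans /(_ lI); rewrite lte_fin; lra.
  rewrite -lte_fin (le_lt_trans _ lI) // EFinB.
  have := lebesgue_measure_itv `[x, y]; rewrite /= lte_fin xy => <-.
  apply: le_measure; rewrite ?inE //.
  by move=> z; rewrite /= in_itv /= => /andP[xz zy]; apply: (iI x y) => //; apply/andP.
have [I0|/set0P[x Ix]] := eqVneq I set0.
  by exists (0, 0); rewrite I0 /= set_itvoo0.
have lb : has_lbound I by exists (x - d) => z Iz; have := H _ _ Iz Ix; lra.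
have ub : has_ubound I by exists (x + d) => z Iz; have := H _ _ Ix Iz; lra.
exists (inf I, sup I); have := interval_bounded_interior iI lb ub.
rewrite (interior_id I).1 // => ->.
Qed.

Lemma itvoo_disjoint (a b a' b' : R) : a < b -> a' < b' ->
  (`]a, b[ `&` `]a', b'[)%classic = set0 -> (b <= a') || (b' <= a).
Proof.
move=> ab ab' E; apply/negP => /negP; rewrite negb_or -!ltNge => /andP[h h'].
have : (set0 : set R) ((Num.max a a' + Num.min b b') / 2).
  rewrite -E /= !in_itv /=.
  by case: (leP a a'); case: (leP b b') => *; split; apply/andP; split; lra.
by [].
Qed.

(** An open set is a countable disjoint union of open intervals. Finitely many of them form a family
    of total length below [d], to which the premise applies; the partial sums then pass to the
    limit. *)
Lemma stieltjes_open (U : set R) (d e : R) : open U ->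
  (forall I, nonoverlapping I -> total_length I < d -> family_variation G I < e) ->
  (mu U < d%:E)%E -> (nu U <= e%:E)%E.
Proof.
move=> oU hG lU; have mU : measurable U by exact: open_measurable.
pose I := open_disjoint_itv oU.
have oI q : open (I q) by exact: open_disjoint_itv_open.
have iI q : is_interval (I q) by exact: open_disjoint_itv_is_interval.
have mI q : measurable (I q) by exact: is_interval_measurable.
have tI : trivIset setT I by exact: open_disjoint_itv_trivIset.
have UE : U = \bigcup_q I q by exact: open_disjoint_itv_bigcup.
have IU q : I q `<=` U by rewrite UE; exact: bigcup_sup.
have /choice[ab Iab] q : exists ab : R * R, I q = `]ab.1, ab.2[%classic.
  apply: (@bounded_open_itv _ d) => //; apply: le_lt_trans lU.
  by apply: le_measure; [exact: mem_set (mI q)|exact: mem_set mU|exact: IU].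
pose P q := (ab q).1 < (ab q).2.
have mE q : mu (I q) = if P q then ((ab q).2 - (ab q).1)%:E else 0%E.
  by rewrite Iab lebesgue_measure_itv /= lte_fin -/(P q); case: (P q) => //; rewrite EFinB.
have nuE q : (nu (I q) <= (if P q then (G (ab q).2 - G (ab q).1)%:E else 0))%E.
  case: ifPn => [Pq|nP]; last first.
    by rewrite Iab set_itv_ge ?measure0 // bnd_simp.
  rewrite -stieltjes_itv ?(ltW Pq) //; apply: le_measure; [exact: mem_set (mI q)|exact: mem_set|rewrite Iab].
  by move=> z; rewrite /= !in_itv /= => /andP[-> /ltW].
rewrite UE measure_bigcup; [|by move=> *; exact: mI|exact: tI].
apply: lime_le; first by apply: is_cvg_nneseries => *; exact: measure_ge0.
apply: nearW => n; apply: (@le_trans _ _ (\sum_(0 <= q < n | q \in [set: nat])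
    (if P q then (G (ab q).2 - G (ab q).1)%:E else 0))%E).
  by apply: lee_sum => q _; exact: nuE.
pose J := [seq ab q | q <- [seq q <- iota 0 n | P q]].
have fJ : nonoverlapping J.
  apply/andP; split.
    by rewrite all_map all_filter; apply/allP => q _ /=; apply/implyP; exact: ltW.
  rewrite pairwise_map; apply: (@sub_in_pairwise _ [pred q | P q] (fun q q' => q != q')).
  - move=> q q' Pq Pq' /= qq'; apply: itvoo_disjoint => //; rewrite -!Iab.
    apply/eqP; apply: contraTT qq' => /eqP/eqP/set0P h; rewrite negbK; apply/eqP.
    exact: (tI q q').
  - by rewrite all_filter; apply/allP => q _ /=; apply/implyP.
  - by rewrite -uniq_pairwise filter_uniq // iota_uniq.
have sE (F : R * R -> R) : (\sum_(0 <= q < n | q \in [set: nat]) (if P q then (F (ab q))%:E else 0) =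
    (\sum_(i <- J) F i)%:E)%E.
  rewrite -big_mkcondr -sumEFin big_map big_filter /index_iota subn0.
  by apply: eq_bigl => q; rewrite in_setT.
have lJ : total_length J < d.
  rewrite -lte_fin; apply: le_lt_trans lU; rewrite -sE.
  rewrite UE measure_bigcup; [|by move=> *; exact: mI|exact: tI].
  under eq_bigr do rewrite -mE.
  by apply: nneseries_lim_ge => *; exact: measure_ge0.
rewrite (sE (fun i => G i.2 - G i.1)) lee_fin; apply: le_trans (ltW (hG _ fJ lJ)).
by apply: ler_sum => i _; exact: ler_norm.
Qed.

(** Outer regularity encloses a null set in an open set of length below [d], whose Stieltjes measure
    is at most [e]. *)
Lemma stieltjes_dominated : nu `<< mu.
Proof.
move=> N N0 A mA AN; have A0 : mu A = 0%E by exact: N0.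
apply/eqP; rewrite eq_le measure_ge0 andbT; apply/lee_addgt0Pr => e e0; rewrite add0e.
have [d d0 hG] := Gac e0.
have lA : (mu A < +oo)%E by rewrite A0 ltry.
have [U [oU AU lU]] := lebesgue_regularity_outer mA lA d0.
have mU : measurable U by exact: open_measurable.
have lU' : (mu U < d%:E)%E.
  have -> : mu U = (mu (U `\` A) + mu A)%E by have := measureDI mu mU mA; rewrite (setIidr AU).
  by rewrite A0 adde0.
apply: le_trans (stieltjes_open oU hG lU').
by apply: le_measure; [exact: mem_set mA|exact: mem_set mU|exact: AU].
Qed.

Lemma ac_mono_integral : exists2 h : R -> R, mu.-integrable setT (EFin \o h) &
  forall x y, x <= y -> (\int[mu]_(t in `]x, y]) (h t)%:E = (G y - G x)%:E)%E.
Proof.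
pose f := Radon_Nikodym (charge_of_finite_measure nu) mu.
have dom : charge_of_finite_measure nu `<< mu by exact: stieltjes_dominated.
have hE : EFin \o (fine \o f) = f.
  by apply/funext => x /=; rewrite fineK //; exact: Radon_Nikodym_fin_num.
exists (fine \o f); first by rewrite hE; exact: Radon_Nikodym_integrable.
move=> x y xy; rewrite -stieltjes_itv //.
have -> : (\int[mu]_(t in `]x, y]) ((fine \o f) t)%:E = \int[mu]_(t in `]x, y]) f t)%E.
  by rewrite -hE.
by rewrite -Radon_Nikodym_integral.
Qed.

End Stieltjes.

Section AC.
Variable R : realType.
Local Notation mu := (@lebesgue_measure R).

Lemma ac_integral (f : R -> R) s t : s <= t -> abs_continuous f ->
  (forall x, x <= s -> f x = f s) -> (forall x, t <= x -> f x = f t) ->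
  exists2 h : R -> R, mu.-integrable setT (EFin \o h) &
  forall x y, x <= y -> (\int[mu]_(t in `]x, y]) (h t)%:E = (f y - f x)%:E)%E.
Proof.
move=> st acf fs ft.
have [G1 [G2 [fE [m1 m2] [ac1 ac2] [B1 b1] [B2 b2]]]] := ac_decomposition st acf fs ft.
have [h1 ih1 e1] := ac_mono_integral m1 ac1 b1.
have [h2 ih2 e2] := ac_mono_integral m2 ac2 b2.
exists (h1 \- h2).
  by have := integrableB measurableT ih1 ih2.
move=> x y xy.
have i1 : mu.-integrable `]x, y] (EFin \o h1) by apply: integrableS ih1.
have i2 : mu.-integrable `]x, y] (EFin \o h2) by apply: integrableS ih2.
have mI : measurable (`]x, y]%classic : set (measurableTypeR R)) by exact: measurable_itv.
have := integralB mI i1 i2.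
rewrite /= => E; rewrite -[LHS]/(\int[mu]_(t in `]x, y]) ((h1 t)%:E - (h2 t)%:E))%E E.
rewrite e1 // e2 // fE /= -EFinB; congr _%:E; ring.
Qed.

End AC.

(** * Comparison of integrals and derivatives of absolutely continuous functions *)

Section AEmono.
Context d (T : measurableType d) (R : realType) (mu : {measure set T -> \bar R}).
Import HBNNSimple.
Local Open Scope ereal_scope.

(* No measurability: the integrals are differences of lower integrals, and a
   simple function below [f] stays below [g] once cut off on the null set. *)
Lemma ae_le_integral_nonmeasurable (D : set T) (f g : T -> \bar R) :
  {ae mu, forall x, D x -> f x <= g x} ->
  \int[mu]_(x in D) f x <= \int[mu]_(x in D) g x.
Proof.
move=> [N [mN N0 fgN]].
have sup_le (f' g' : T -> \bar R) : (forall x, ~ N x -> f' x <= g' x) ->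
    (forall x, 0 <= g' x) ->
    ereal_sup [set sintegral mu h | h in [set h : {nnsfun T >-> R} | forall x, (h x)%:E <= f' x]] <=
    ereal_sup [set sintegral mu h | h in [set h : {nnsfun T >-> R} | forall x, (h x)%:E <= g' x]].
  move=> fg g0; apply: ge_ereal_sup => _ [h hf <-].
  apply: ereal_sup_ubound; exists (proj_nnsfun h (measurableC mN)).
    move=> x; have := mrestrict h (measurableC mN) => /(congr1 (fun f => f x)) <-.
    rewrite /patch; case: ifPn => [|_]; last exact: g0.
    by rewrite inE => nN; apply: le_trans (fg _ nN).
  have mh : measurable_fun setT (EFin \o h) by exact/measurable_EFinP.
  rewrite -(mrestrict h (measurableC mN)) -integral_nnsfun; last exact: measurableC.
  rewrite -[in RHS](patch_setT 0%R h) -integral_nnsfun // (@ge0_negligible_integral _ _ _ mu setT N) //.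
    by rewrite setTD.
  by move=> x _; rewrite lee_fin.
have H x : ~ N x -> D x -> f x <= g x.
  by move=> nN Dx; apply: contrapT => h; apply: nN; apply: fgN => /(_ Dx).
rewrite /integral; apply: leeB; apply: sup_le => x //.
- move=> nN; rewrite !funeposE /patch; case: ifPn => // /set_mem Dx.
  by rewrite ge_max !le_max H // lexx orbT.
- move=> nN; rewrite !funenegE /patch; case: ifPn => // /set_mem Dx.
  by rewrite ge_max !le_max leeN2 H // lexx orbT.
Qed.

End AEmono.

Section AC.
Variable R : realType.
Local Notation mu := (@lebesgue_measure R).

Definition clamp (s t x : R) := Num.max s (Num.min t x).

Lemma clamp_in s t x : s <= t -> s <= clamp s t x <= t.
Proof. by move=> st; rewrite /clamp le_max lexx ge_max st ge_min lexx. Qed.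

Lemma clamp_id s t x : s <= x <= t -> clamp s t x = x.
Proof. by move=> /andP[sx xt]; rewrite /clamp min_r // max_r. Qed.

Lemma clamp_mono s t : {homo clamp s t : x y / x <= y}.
Proof.
by move=> x y xy; rewrite /clamp ge_max !le_max lexx /= le_min !ge_min lexx /= xy !orbT.
Qed.

Lemma clamp_le s t x y : s <= t -> x <= y -> clamp s t y - clamp s t x <= y - x.
Proof.
move=> st xy; rewrite /clamp.
by case: (leP t x); case: (leP t y); case: (leP s t); case: (leP s x); case: (leP s y); lra.
Qed.

(** The two terms of the bound cover the coordinates of [g], the composition [v \o g] (both with
    [K' = 0]), and [dotv p (g u) + k * u]. *)
Lemma ac_of_ACon n (g : R -> 'rV[R]_n) s t (f : R -> R) K K' : s <= t ->
  0 <= K -> 0 <= K' -> ACon g s t ->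
  (forall x y, s <= x <= t -> s <= y <= t ->
     `|f x - f y| <= K * `|g x - g y| + K' * `|x - y|) ->
  abs_continuous (f \o clamp s t).
Proof.
move=> st K0 K'0 acg fK e e0.
have q0 : 0 < e / (2 * (K + 1)) by apply: divr_gt0 => //; lra.
have q'0 : 0 < e / (2 * (K' + 1)) by apply: divr_gt0 => //; lra.
have [d d0 h] := acg _ q0; exists (Num.min d (e / (2 * (K' + 1)))); first by rewrite lt_min d0.
move=> I fI; rewrite lt_min => /andP[l1 l2].
have fI' := fam_map (@clamp_mono s t) fI; set I' := map _ I in fI'.
have lI' : total_length I' <= total_length I.
  rewrite /total_length big_map /= !big_seq; apply: ler_sum => i iI; apply: clamp_le => //.
  by move: fI => /andP[/allP/(_ _ iI)].
have I'st i : i \in I' -> s <= i.1 <= t /\ s <= i.2 <= t.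
  by move=> /mapP[j _ ->]; split; exact: clamp_in.
have -> : family_variation (f \o clamp s t) I = family_variation f I' by rewrite /family_variation big_map.
pose a i := (nth (0, 0) I' i).1; pose b i := (nth (0, 0) I' i).2.
have [n1 n2] := fam_nth (0, 0) fI'.
have ab i : (i < size I')%N -> s <= a i /\ a i <= b i /\ b i <= t.
  by move=> iI; have [/andP[? _] /andP[_ ?]] := I'st _ (mem_nth (0, 0) iI); do !split=> //; exact: n1.
have sE (F : R * R -> R) : \sum_(i <- I') F i = \sum_(i < size I') F (a i, b i).
  rewrite (big_nth (0, 0)) big_mkord; apply: eq_bigr => i _.
  by rewrite /a /b; case: (nth _ _ _).
have := h (size I') a b ab n2; rewrite -(sE (fun i => i.2 - i.1)) -/(total_length I').
move=> /(_ (le_lt_trans lI' l1)); rewrite -(sE (fun i => `|g i.2 - g i.1|)) => hg.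
have : family_variation f I' <= K * (\sum_(i <- I') `|g i.2 - g i.1|) + K' * total_length I'.
  rewrite /family_variation /total_length !mulr_sumr -big_split /= !big_seq; apply: ler_sum => i iI.
  have [i1 i2] := I'st _ iI; apply: le_trans (fK _ _ i2 i1) _.
  by rewrite (ger0_norm (_ : 0 <= i.2 - i.1)) // subr_ge0; move: fI' => /andP[/allP/(_ _ iI)].
move=> /le_lt_trans; apply.
have h1 : K * (\sum_(i <- I') `|g i.2 - g i.1|) <= K * (e / (2 * (K + 1))).
  by apply: ler_wpM2l => //; exact: ltW.
have h2 : K' * total_length I' <= K' * (e / (2 * (K' + 1))).
  by apply: ler_wpM2l => //; lra.
have h3 (k : R) : 0 <= k -> k * (e / (2 * (k + 1))) < e / 2.
  by move=> k0; rewrite invfM mulrA mulrA ltr_pdivrMr; [nra|lra].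
by have := h3 _ K0; have := h3 _ K'0; lra.
Qed.

Lemma ac_is_derive (f : R -> R) s t : s <= t -> abs_continuous (f \o clamp s t) ->
  exists2 h : R -> R, mu.-integrable setT (EFin \o h) &
  (forall x y, s <= x -> x <= y -> y <= t ->
    (\int[mu]_(u in `[x, y]) (h u)%:E = (f y - f x)%:E)%E) /\
  {ae mu, forall u, s < u < t -> is_derive u 1 f (h u)}.
Proof.
move=> st acf; set F := f \o clamp s t in acf.
have cl x : x <= s -> clamp s t x = s.
  by move=> xs; rewrite /clamp max_l // ge_min xs orbT.
have Fs x : x <= s -> F x = F s.
  by move=> xs; rewrite /F /= !cl.
have Ft x : t <= x -> F x = F t.
  by move=> xs; rewrite /F /= /clamp !min_l.
have FE x : s <= x <= t -> F x = f x by move=> h; rewrite /F /= clamp_id.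
have [h ih hE] := ac_integral st acf Fs Ft.
have mh : measurable_fun setT (EFin \o h) by exact: measurable_int ih.
exists h => //; split=> [x y sx xy yt|].
  rewrite -integral_itv_obnd_cbnd; last exact: measurable_funTS.
  by rewrite hE // !FE // ?sx ?yt ?(le_trans xy yt) ?(le_trans sx xy).
have iy y : mu.-integrable `]-oo, y] (EFin \o h) by apply: integrableS ih.
have li : locally_integrable setT h.
  by apply: open_integrable_locally => //; exact: openT.
have := FTC1Ny iy li.
apply: filterS; first exact: (ae_filter_ringOfSetsType mu).
move=> u [du uh] /andP[su ut].
(* The fundamental theorem is used for the integral from [-oo]; [F] is that integral up to a
   constant, fixed at [s]. *)
have c x : F x = Rintegral mu `]-oo, x] h + (F s - Rintegral mu `]-oo, s] h).
  have H y z : y <= z -> F z - F y = Rintegral mu `]-oo, z] h - Rintegral mu `]-oo, y] h.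
    move=> yz; rewrite (Rintegral_itvB (iy z)) ?bnd_simp //.
    by rewrite /Rintegral hE.
  by have [xs|/ltW sx] := leP x s; [have := H _ _ xs|have := H _ _ sx]; lra.
have D : is_derive u 1 (fun x => Rintegral mu `]-oo, x] h) (h u).
  by apply: DeriveDef; [exact: du|rewrite -derive1E; exact: uh].
have D2 : is_derive u 1 F (h u).
  have -> : F = (fun x => Rintegral mu `]-oo, x] h) \+ cst (F s - Rintegral mu `]-oo, s] h).
    by apply/funext => x /=; rewrite c.
  by rewrite -[h u]addr0; apply: is_deriveD.
apply: near_eq_is_derive D2.
have N : nbhs u `]s, t[%classic.
  by apply: open_nbhs_nbhs; split; [exact: interval_open|rewrite /= in_itv /= su].
apply: filterS N => x /=; rewrite in_itv /= => /andP[sx xt].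
by rewrite FE // !ltW.
Qed.

Lemma ae_neq (x : R) : {ae mu, forall u, u != x}.
Proof.
exists [set x]; split; [exact: measurable_set1|exact: lebesgue_measure_set1|].
by move=> u /= /negP; rewrite negbK => /eqP.
Qed.

Lemma ae_itv s t (P : R -> Prop) : {ae mu, forall u, s < u < t -> P u} ->
  {ae mu, forall u, s <= u <= t -> P u}.
Proof.
move=> aeP; have F := ae_filter_ringOfSetsType mu.
apply: filterS (filterI aeP (filterI (ae_neq s) (ae_neq t))).
by move=> u [h [us ut]] /andP[su u_t]; apply: h; rewrite !lt_neqAle eq_sym us su ut u_t.
Qed.

Lemma ac_le_integral (f l : R -> R) s t : s <= t -> abs_continuous (f \o clamp s t) ->
  {ae mu, forall u, s < u < t -> forall df, is_derive u 1 f df -> df <= l u} ->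
  ((f t - f s)%:E <= \int[mu]_(u in `[s, t]) (l u)%:E)%E.
Proof.
move=> st acf ael; have [h ih [hE hd]] := ac_is_derive st acf.
have F := ae_filter_ringOfSetsType mu.
rewrite -hE //; apply: ae_le_integral_nonmeasurable.
have H : {ae mu, forall u, s < u < t -> h u <= l u}.
  by apply: filterS (filterI ael hd) => u [lu hu] sut; apply: lu (hu sut).
by apply: filterS (ae_itv H) => u /= hu; rewrite in_itv /= => /hu; rewrite lee_fin.
Qed.

(* [l] dominates the derivative of [f] off [[x, y]] and that of [g] on [[x, y]]. *)
Lemma ac_calibrated_le (f g l : R -> R) s t x y : s <= x -> x <= y -> y <= t ->
  abs_continuous (f \o clamp s t) -> abs_continuous (g \o clamp s t) ->
  {ae mu, forall u, s < u < t -> forall df, is_derive u 1 f df -> df <= l u} ->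
  {ae mu, forall u, x < u < y -> forall dg, is_derive u 1 g dg -> dg <= l u} ->
  (\int[mu]_(u in `[s, t]) (l u)%:E <= (f t - f s)%:E)%E ->
  g y - g x <= f y - f x.
Proof.
move=> sx xy yt acf acg aef aeg fl.
have st : s <= t by lra.
have F := ae_filter_ringOfSetsType mu.
have [h ih [hE hd]] := ac_is_derive st acf.
have [k ik [kE kd]] := ac_is_derive st acg.
(* No measurability of [l] is available to split its integral at [x] and [y]. Instead the density
   [h] of [f] is changed into the density [k] of [g] on [[x, y]]; the result stays below [l] and is
   integrated over all of [[s, t]]. *)
pose q := EFin \o (k \- h).
have ikh : mu.-integrable setT q by exact: (integrableB measurableT ik ih).
have mI : measurable (`[x, y]%classic : set (measurableTypeR R)) by exact: measurable_itv.
have mJ : measurable (`[s, t]%classic : set (measurableTypeR R)) by exact: measurable_itv.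
have ikhr : mu.-integrable setT (q \_ `[x, y]).
  by apply/(integrable_mkcond _ mI).1; apply: integrableS ikh.
have H : {ae mu, forall u, `[s, t]%classic u ->
    ((h u)%:E + (q \_ `[x, y]) u <= (l u)%:E)%E}.
  have H1 : {ae mu, forall u, s <= u <= t -> h u <= l u}.
    by apply: ae_itv; apply: filterS (filterI aef hd) => u [lu hu] sut; apply: lu (hu sut).
  have H2 : {ae mu, forall u, x <= u <= y -> s < u < t -> k u <= l u}.
    apply: ae_itv; apply: filterS (filterI aeg kd) => u [lu ku] xuy sut.
    exact: lu xuy _ (ku sut).
  apply: filterS (filterI H1 (filterI H2 (filterI (ae_neq s) (ae_neq t)))).
  move=> u [h1 [h2 [us ut]]] /=; rewrite in_itv /= => sut; rewrite /patch.
  case: ifPn => [/set_mem|_]; last by rewrite adde0 lee_fin h1.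
  rewrite /= in_itv /= => xuy; rewrite -EFinD lee_fin addrC subrK h2 //.
  by move: sut; rewrite !lt_neqAle (eq_sym s) us ut.
have := le_trans (ae_le_integral_nonmeasurable H) fl.
rewrite integralD //; [|by apply: integrableS ih|by apply: integrableS ikhr].
rewrite hE // -integral_mkcondr (setIidr _); last first.
  by move=> u /=; rewrite !in_itv /= => /andP[xu uy]; rewrite (le_trans sx xu) (le_trans uy yt).
have -> : (\int[mu]_(u in `[x, y]) q u = (g y - g x)%:E - (f y - f x)%:E)%E.
  rewrite -hE // -kE // -integralB //; [by apply: integrableS ik|by apply: integrableS ih].
by rewrite -EFinB -EFinD lee_fin; lra.
Qed.

End AC.

(** * Action minimizers *)

Lemma is_derive_slope_right (R : realType) (W : normedModType R) (f : R -> W) (s : R) (l : W) :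
  is_derive s (1 : R) f l -> t^-1 *: (f (s + t) - f s) @[t --> (0 : R)^'+] --> l.
Proof.
move=> [df El]; have c0 : h^-1 *: ((f \o shift s) (h *: (1 : R)) - f s) @[h --> (0 : R)^'] --> l.
  by rewrite -El; exact: df.
apply/cvgrPdist_le => e e0; move/cvgrPdist_le : c0 => /(_ _ e0) /nbhs_ballP[d /= d0 Hd].
apply: (near_right0 d0) => t t0 td.
have b : ball (0 : R) d t by rewrite -ball_normE /= sub0r normrN gtr0_norm.
have := Hd _ b; rewrite gt_eqF// => /(_ isT).
by rewrite [t *: 1]mulr1 [t + s]addrC.
Qed.

Section Action.
Variables (R : realType) (n : nat).
Notation V := 'rV[R]_n.
Local Notation mu := (@lebesgue_measure R).

Lemma ACon_is_derive (g : R -> V) (s t : R) : s <= t -> ACon g s t ->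
  {ae mu, forall u, s < u < t -> is_derive u 1 g (derive1 g u)}.
Proof.
move=> st acg; have F := ae_filter_ringOfSetsType mu.
have Hi (i : 'I_n) : {ae mu, forall u, s < u < t -> derivable (fun r => g r 0 i) u 1}.
  have aci : abs_continuous ((fun r => g r 0 i) \o clamp s t).
    apply: (ac_of_ACon st ler01 (lexx 0) acg) => x y _ _.
    by rewrite mul1r mul0r addr0 -coordB; exact: coord_le_norm.
  have [h _ [_ hd]] := ac_is_derive st aci.
  by apply: filterS hd => u hu sut; have [] := hu sut.
have Ha := filter_forall F Hi; apply: filterS Ha => u hu sut.
have dg : derivable g u 1 by apply/derivable_mxP => j i; rewrite (ord1 j); exact: hu.
by rewrite derive1E; exact: (DeriveDef dg).
Qed.

Variable H : V -> V -> R.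
Hypothesis C2F : C2 (fun z : V * V => H z.1 z.2).
Hypothesis posH : forall x p, posdef (Hpp H x p).
Hypothesis supH : superlinear H.
Hypothesis perH : periodic_x H.
Variables (c : V) (a : R) (v : V -> R).
Hypothesis perv : periodicT v.
Hypothesis vv : visc_sol H c a v.

Let lag (g : R -> V) u := Lag H (g u) (derive1 g u) - dotv c (derive1 g u) + a.

(** [sub_step] along the chord from [g u] to [g (u + t)], divided by [t]: the quadratic error
    becomes [C * t] and vanishes. *)
Lemma derive_value_le_lag (g : R -> V) (u : R) (xi : V) (db : R) :
  is_derive u (1 : R) g xi -> is_derive u (1 : R) (v \o g) db -> db <= Lag H (g u) xi - dotv c xi + a.
Proof.
move=> dg db'; have [C C0 HC] := sub_step C2F posH supH perH perv vv.
have s1 := is_derive_slope_right dg; have s2 := is_derive_slope_right db'.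
have c1 : dotv c (t^-1 *: (g (u + t) - g u)) @[t --> (0 : R)^'+] --> dotv c xi.
  by apply: cvg_dotv; [exact: cvg_cst|exact: s1].
have c2 : Lag H (g u) (t^-1 *: (g (u + t) - g u)) @[t --> (0 : R)^'+] --> Lag H (g u) xi.
  exact: (cvg_comp_pair (continuous_Lag C2F posH supH perH) (cvg_cst _) s1).
have c3 : C * t @[t --> (0 : R)^'+] --> C * 0.
  by apply: cvgMr; apply: cvg_at_right_filter; exact: cvg_id.
have c4 : Lag H (g u) (t^-1 *: (g (u + t) - g u)) - dotv c (t^-1 *: (g (u + t) - g u)) + a + C * t
    @[t --> (0 : R)^'+] --> Lag H (g u) xi - dotv c xi + a + C * 0.
  exact: (cvgD (cvgD (cvgB c2 c1) (cvg_cst a)) c3).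
rewrite mulr0 addr0 in c4.
apply: (ler_cvg_to s2 c4); apply: (near_right0 ltr01) => t t0 _.
rewrite -(ler_pM2l t0) /= [t * (t^-1 *: _)]mulVKf ?gt_eqF //.
have := HC t (g u) (g (u + t)) t0; rewrite /step_cost.
rewrite dotvZr; have -> : forall X Y, t * (X - t^-1 * Y + a + C * t) = t * X - Y + t * a + C * t ^+ 2.
  by move=> X Y; field; rewrite gt_eqF.
by lra.
Qed.

Lemma value_ac (g : R -> V) s t : s <= t -> ACon g s t -> abs_continuous ((v \o g) \o clamp s t).
Proof.
move=> st acg; have [K K0 HK] := v_lipschitz C2F posH supH perH perv vv.
apply: (ac_of_ACon st K0 (lexx 0) acg) => x y _ _; rewrite mul0r addr0 ler_norml /=.
by have := HK (g x) (g y); have := HK (g y) (g x); rewrite (distrC (g y)); lra.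
Qed.

Lemma ae_derive_value_le (g : R -> V) s t : s <= t -> ACon g s t ->
  {ae mu, forall u, s < u < t -> forall db, is_derive u 1 (v \o g) db -> db <= lag g u}.
Proof.
move=> st acg; have F := ae_filter_ringOfSetsType mu.
apply: filterS (ACon_is_derive st acg) => u dg sut db dbu.
exact: derive_value_le_lag (dg sut) dbu.
Qed.

Lemma value_le_action (g : R -> V) T : 0 <= T -> ACon g (- T) 0 ->
  ((v (g 0%R) - v (g (- T)%R))%:E <= action H c a g T)%E.
Proof.
move=> T0 acg; have T0' : - T <= 0 by lra.
exact: (ac_le_integral T0' (value_ac T0' acg) (ae_derive_value_le T0' acg)).
Qed.

End Action.

Section Minimizers.
Variables (R : realType) (n : nat).
Notation V := 'rV[R]_n.
Local Notation mu := (@lebesgue_measure R).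
Variable H : V -> V -> R.
Hypothesis C2F : C2 (fun z : V * V => H z.1 z.2).
Hypothesis posH : forall x p, posdef (Hpp H x p).
Hypothesis supH : superlinear H.
Hypothesis perH : periodic_x H.
Variables (c : V) (a : R) (v : V -> R).
Hypothesis perv : periodicT v.
Hypothesis vv : visc_sol H c a v.

Lemma lipschitz_ACon (g : R -> V) (K s t : R) : 0 <= K ->
  (forall x y, s <= x -> x <= y -> y <= t -> `|g y - g x| <= K * (y - x)) -> ACon g s t.
Proof.
move=> K0 gK e e0; have K1 : 0 < K + 1 by lra.
exists (e / (K + 1)); first exact: divr_gt0.
move=> k x y xy _; rewrite ltr_pdivlMr // => l.
apply: le_lt_trans l; rewrite mulr_suml; apply: ler_sum => i _.
have [sx [xy' yt]] := xy i (ltn_ord i); apply: le_trans (gK _ _ sx xy' yt) _.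
by rewrite mulrC; apply: ler_wpM2l; lra.
Qed.

Lemma qcal_derive_value_ge C Xi (g : R -> V) (u : R) (xi : V) (db : R) :
  qcal H c a v C Xi g -> u < 0 -> is_derive u (1 : R) g xi ->
  is_derive u (1 : R) (v \o g) db -> Lag H (g u) xi - dotv c xi + a <= db.
Proof.
move=> qg u0 dg db'.
have s1 := is_derive_slope_right dg; have s2 := is_derive_slope_right db'.
have c1 : dotv c (t^-1 *: (g (u + t) - g u)) @[t --> (0 : R)^'+] --> dotv c xi.
  by apply: cvg_dotv; [exact: cvg_cst|exact: s1].
have c2 : Lag H (g u) (t^-1 *: (g (u + t) - g u)) @[t --> (0 : R)^'+] --> Lag H (g u) xi.
  exact: (cvg_comp_pair (continuous_Lag C2F posH supH perH) (cvg_cst _) s1).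
have c3 : C * t @[t --> (0 : R)^'+] --> C * 0.
  by apply: cvgMr; apply: cvg_at_right_filter; exact: cvg_id.
have c4 : Lag H (g u) (t^-1 *: (g (u + t) - g u)) - dotv c (t^-1 *: (g (u + t) - g u)) + a - C * t
    @[t --> (0 : R)^'+] --> Lag H (g u) xi - dotv c xi + a - C * 0.
  exact: (cvgB (cvgD (cvgB c2 c1) (cvg_cst a)) c3).
rewrite mulr0 subr0 in c4.
have m0 : 0 < Num.min 1 (- u) by rewrite lt_min; lra.
apply: (ler_cvg_to c4 s2); apply: (near_right0 m0) => t t0.
rewrite lt_min => /andP[t1 tu].
rewrite -(ler_pM2l t0) /= [t * (t^-1 *: _)]mulVKf ?gt_eqF //.
have ut : u < u + t by lra.
have ut0 : u + t <= 0 by lra.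
have [_] := qg _ _ ut ut0.
have -> : u + t - u = t by ring.
move=> /(_ (ltW t1)); rewrite /step_cost.
rewrite dotvZr; have -> : forall X Y, t * (X - t^-1 * Y + a - C * t) = t * X - Y + t * a - C * t ^+ 2.
  by move=> X Y; field; rewrite gt_eqF.
by lra.
Qed.

Lemma qcal_ACon C Xi (g : R -> V) T : 0 <= Xi -> qcal H c a v C Xi g -> ACon g (- T) 0.
Proof.
move=> Xi0 qg; apply: (lipschitz_ACon Xi0) => x y _ xy y0.
exact: (qcal_lipschitz qg xy y0).
Qed.

Lemma qcal_action_le C Xi (g : R -> V) T : 0 <= Xi -> qcal H c a v C Xi g -> 0 <= T ->
  (action H c a g T <= (v (g 0%R) - v (g (- T)%R))%:E)%E.
Proof.
move=> Xi0 qg T0; have T0' : - T <= 0 by lra.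
have acg := qcal_ACon T Xi0 qg; have F := ae_filter_ringOfSetsType mu.
have [h _ [hE hd]] := ac_is_derive T0' (value_ac C2F posH supH perH perv vv T0' acg).
rewrite -(hE (- T) 0) //; apply: ae_le_integral_nonmeasurable.
have Hl : {ae mu, forall u, - T < u < 0 ->
    Lag H (g u) (derive1 g u) - dotv c (derive1 g u) + a <= h u}.
  apply: filterS (filterI hd (ACon_is_derive T0' acg)) => u [hu gu] Tu0.
  have u0 : u < 0 by case/andP: Tu0.
  exact: qcal_derive_value_ge qg u0 (gu Tu0) (hu Tu0).
by apply: filterS (ae_itv Hl) => u /= hu; rewrite in_itv /= => /hu; rewrite lee_fin.
Qed.

Lemma qcal_minimizing C Xi (g : R -> V) : 0 <= Xi -> qcal H c a v C Xi g ->
  minimizing H c a v (g 0) g.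
Proof.
move=> Xi0 qg; split=> // T T0; split=> [|eta aceta eta0]; first exact: qcal_ACon qg.
have h1 := qcal_action_le Xi0 qg (ltW T0).
have h2 := value_le_action C2F posH supH perH perv vv (ltW T0) aceta.
apply: (@le_trans _ _ (v (g 0%R))%:E).
  apply: le_trans (leeD2r _ h1) _; rewrite -EFinD lee_fin; lra.
apply: le_trans (leeD2r _ h2); rewrite -EFinD lee_fin eta0; lra.
Qed.

(** The competitor is the calibrated curve through the same point, whose action is bounded by the
    increment of [v]. *)
Lemma minimizing_action_le x (g : R -> V) T : minimizing H c a v x g -> 0 < T ->
  (action H c a g T <= (v (g 0%R) - v (g (- T)%R))%:E)%E.
Proof.
move=> [g0 gm] T0; have [acg gT] := gm T T0.
have [C [Xi [q [C0 Xi0 qq q0]]]] := exists_qcal C2F posH supH perH perv vv x.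
have := le_trans (gT q (qcal_ACon T Xi0 qq) q0) (leeD2r _ (qcal_action_le Xi0 qq (ltW T0))).
rewrite -EFinD -leeBrDr // -EFinB => /le_trans; apply; rewrite lee_fin g0 q0; lra.
Qed.

Section Regularity.
Variables (x : V) (g : R -> V).
Hypothesis gmin : minimizing H c a v x g.

(** Equality of action and increment of [v] is known only over whole windows ending at 0;
    [ac_calibrated_le] localizes it to [[r, s]], with [dotv p (g u) + k * u] as the competing
    function. *)
Lemma affine_minorant (p : V) (k r s : R) : r < s -> s <= 0 ->
  (forall (u : R) (xi : V), r < u -> u < s -> is_derive u (1 : R) g xi ->
     dotv p xi + k <= Lag H (g u) xi - dotv c xi + a) ->
  dotv p (g s - g r) + k * (s - r) <= v (g s) - v (g r).
Proof.
move=> rs s0 hm; pose T := 1 - r; have T0 : 0 < T by rewrite /T; lra.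
have Tr : - T <= r by rewrite /T; lra.
have T0' : - T <= 0 by lra.
have [acg _] := gmin.2 T T0; have F := ae_filter_ringOfSetsType mu.
pose f u := dotv p (g u) + k * u.
have acf : abs_continuous (f \o clamp (- T) 0).
  have np0 : 0 <= n%:R * `|p| by exact: mulr_ge0 (ler0n _ _) (normr_ge0 _).
  apply: (ac_of_ACon T0' np0 (normr_ge0 k) acg).
  move=> y z _ _; have -> : f y - f z = dotv p (g y - g z) + k * (y - z).
    by rewrite /f dotvBr; ring.
  apply: le_trans (ler_normD _ _) _; rewrite normrM lerD2r -mulrA; exact: norm_dotv.
have df (u : R) (xi : V) : is_derive u (1 : R) g xi -> is_derive u (1 : R) f (dotv p xi + k).
  move=> dg; have d1 : is_derive u (1 : R) (fun t => dotv p (g t)) (dotv 0 (g u) + dotv p xi).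
    by apply: is_derive_dotv => //; exact: is_derive_cst.
  rewrite dot0v add0r in d1.
  have d2 : is_derive u (1 : R) (fun t : R => k * t) k.
    have := @is_deriveZ _ _ _ id k u 1 1 (is_derive_id _ _).
    by rewrite /GRing.scale /= mulr1.
  exact: is_deriveD d1 d2.
have aef := ae_derive_value_le C2F posH supH perH perv vv T0' acg.
have aeg : {ae mu, forall u, r < u < s -> forall dg, is_derive u 1 f dg ->
    dg <= Lag H (g u) (derive1 g u) - dotv c (derive1 g u) + a}.
  apply: filterS (ACon_is_derive T0' acg) => u gu /andP[ru us] dg fdg.
  have Tu : - T < u < 0 by apply/andP; split; lra.
  have fd := df _ _ (gu Tu).
  have <- : dotv p (derive1 g u) + k = dg by have [_ <-] := fd; have [_ <-] := fdg.
  exact: (hm u (derive1 g u) ru us (gu Tu)).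
have := ac_calibrated_le Tr (ltW rs) s0 (value_ac C2F posH supH perH perv vv T0' acg) acf aef aeg
  (minimizing_action_le gmin T0).
by rewrite /f dotvBr /=; lra.
Qed.

End Regularity.

Lemma is_derive_norm_le (g : R -> V) (M u : R) (xi : V) : u < 0 ->
  (forall r s, r < s -> s <= 0 -> `|g s - g r| <= M * (s - r)) ->
  is_derive u (1 : R) g xi -> `|xi| <= M.
Proof.
move=> u0 gM dg; have s1 := is_derive_slope_right dg.
apply: (cvgr_to_le (cvg_norm s1)); apply: (@near_right0 _ _ (- u)); first by lra.
move=> t t0 tu; rewrite normrZ gtr0_norm ?invr_gt0 // mulrC ler_pdivrMr //.
have := gM u (u + t); have -> : u + t - u = t by ring.
by apply; lra.
Qed.

Lemma minimizing_lipschitz : exists2 M, 0 <= M & forall x g, minimizing H c a v x g ->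
  forall r s, r < s -> s <= 0 -> `|g s - g r| <= M * (s - r).
Proof.
have [K K0 HK] := v_lipschitz C2F posH supH perH perv vv.
have B0 : 0 <= n%:R * (K + 1) + n%:R * `|c|.
  by apply: addr_ge0; apply: mulr_ge0 => //; lra.
have [C C0 HC] := Lag_ge_linear C2F supH perH B0.
exists (C + `|a|) => [|x g gm r s rs s0]; first by apply: addr_ge0.
have [e e1 ge] := norm_dual (g s - g r).
have := affine_minorant gm (p := (K + 1) *: e) (k := a - C) rs s0.
have hm (u : R) (xi : V) : r < u -> u < s -> is_derive u (1 : R) g xi ->
    dotv ((K + 1) *: e) xi + (a - C) <= Lag H (g u) xi - dotv c xi + a.
  move=> _ _ _; have h1 := HC (g u) xi.
  have h2 : dotv c xi <= n%:R * (`|c| * `|xi|) by apply: le_trans (ler_norm _) (norm_dotv _ _).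
  have h3 : dotv e xi <= n%:R * `|xi|.
    apply: le_trans (ler_norm _) _; apply: le_trans (norm_dotv _ _) _.
    by apply: ler_wpM2l => //; rewrite -[leRHS]mul1r; apply: ler_wpM2r.
  have h4 : (K + 1) * dotv e xi <= (K + 1) * (n%:R * `|xi|) by apply: ler_wpM2l => //; lra.
  rewrite dotvZl; lra.
move=> /(_ hm); rewrite dotvZl => h.
have h5 := HK (g s) (g r).
have h6 : (K + 1) * `|g s - g r| <= (K + 1) * dotv e (g s - g r) by apply: ler_wpM2l => //; lra.
have h7 : - (a * (s - r)) <= `|a| * (s - r).
  by rewrite -mulNr; apply: ler_wpM2r; [lra|rewrite -normrN; exact: ler_norm].
lra.
Qed.

Lemma minimizing_qcal : exists C M, [/\ 0 <= C, 0 <= M & forall x g,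
  minimizing H c a v x g -> qcal H c a v C M g].
Proof.
have [M M0 HM] := minimizing_lipschitz.
have [K K0 HK] := Lag_lipschitz_x C2F supH perH M.
exists (K * M), M; split=> //; first exact: mulr_ge0.
move=> x g gm r s rs s0; split=> [|_]; first exact: HM gm _ _ rs s0.
have sr : s - r != 0 by lra.
set xb := (s - r)^-1 *: (g s - g r).
have xbE : (s - r) *: xb = g s - g r by rewrite /xb scalerA divff // scale1r.
pose k := Lag H (g r) xb - dotv xb (Pmax H (g r) xb) - K * M * (s - r) + a.
have hm (u : R) (xi : V) : r < u -> u < s -> is_derive u (1 : R) g xi ->
    dotv (Pmax H (g r) xb - c) xi + k <= Lag H (g u) xi - dotv c xi + a.
  move=> ru us dg; have u0 : u < 0 by lra.
  have h1 := HK (g u) (g r) xi (is_derive_norm_le u0 (HM _ _ gm) dg).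
  have h2 := Lag_convex C2F supH perH (g r) xb xi.
  have h3 := HM _ _ gm r u ru (ltW u0).
  have h4 : K * `|g u - g r| <= K * (M * (s - r)).
    by apply: ler_wpM2l => //; apply: le_trans h3 _; apply: ler_wpM2l => //; lra.
  rewrite /k dotvBl (dotvC (Pmax _ _ _)); move: h2; rewrite dotvBl; lra.
have := affine_minorant gm rs s0 hm.
rewrite dotvBl -{1}xbE dotvZr (dotvC (Pmax _ _ _)) /step_cost -/xb /k.
lra.
Qed.

End Minimizers.

(** * Alpha-limits and invariant sets *)

Lemma cluster_pair_ge0 (R : realType) (U W : topologicalType) (T : Type) (F : set_system T)
    (X : T -> U) (P : T -> W) (f : U * W -> R) (y : U) (q : W) :
  ProperFilter F -> continuous f -> X @ F --> y -> cluster (P @ F) q ->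
  (\forall t \near F, 0 <= f (X t, P t)) -> 0 <= f (y, q).
Proof.
move=> FF cf Xy Pq nf; rewrite leNgt; apply/negP => f0.
have N : nbhs (y, q) [set z | f z < 0].
  have N0 : nbhs (f (y, q)) [set x : R | x < 0].
    by apply: open_nbhs_nbhs; split => //; exact: open_lt.
  exact: (cf (y, q) _ N0).
case: N => [[A B] /= [Ay Bq] AB].
have FA : F [set t | A (X t)] by exact: Xy.
have h : (P @ F) [set P t | t in [set t | A (X t) /\ 0 <= f (X t, P t)]].
  by apply: filterS (filterI FA nf) => t [h1 h2] /=; exists t.
have [_ [[t [At ft] <-] Bt]] := Pq _ _ h Bq.
by have := AB (X t, P t) (conj At Bt); rewrite /= ltNge ft.
Qed.

Section Calibrated.
Variables (R : realType) (n : nat).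
Notation V := 'rV[R]_n.
Variable H : V -> V -> R.
Hypothesis C2F : C2 (fun z : V * V => H z.1 z.2).
Hypothesis posH : forall x p, posdef (Hpp H x p).
Hypothesis supH : superlinear H.
Hypothesis perH : periodic_x H.
Variables (c : V) (a : R) (v : V -> R).
Hypothesis perv : periodicT v.
Hypothesis vv : visc_sol H c a v.
Variable phiH : R -> V * V -> V * V.
Hypothesis fH : is_Hflow H phiH.
Variables (C M : R).
Hypotheses (C0 : 0 <= C) (M0 : 0 <= M).
Hypothesis minq : forall x g, minimizing H c a v x g -> qcal H c a v C M g.

Definition calibrated_on (r s : R) (z : V * V) : Prop :=
  `|(phiH s z).1 - (phiH r z).1| <= M * (s - r) /\
  (s - r <= 1 -> v (phiH r z).1 + step_cost H c a (s - r) (phiH r z).1 (phiH s z).1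
                 <= v (phiH s z).1 + C * (s - r) ^+ 2).

Definition calibrated (z : V * V) : Prop := forall r s, r < s -> calibrated_on r s z.

Lemma cal_flow r s t z : calibrated_on (r + t) (s + t) z -> calibrated_on r s (phiH t z).
Proof.
rewrite /calibrated_on -!(flowD C2F supH perH fH); have -> : s + t - (r + t) = s - r by ring.
by [].
Qed.

Lemma cal_shift r s z k : intvec k -> calibrated_on r s z -> calibrated_on r s (z.1 + k, z.2).
Proof.
move=> ik; rewrite /calibrated_on !(flow_periodic C2F supH perH fH) //= /step_cost.
have -> : forall A B : V, A + k - (B + k) = A - B by move=> A B; rewrite opprD addrACA subrr addr0.
by rewrite !(perv _ ik) (Lag_periodic C2F posH supH perH _ _ ik).
Qed.

Lemma flow1_continuous (s : R) : continuous (fun z => (phiH s z).1).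
Proof.
apply: continuousI => z.
have cs : phiH s z' @[z' --> z] --> phiH s z by exact: (flow_continuous C2F supH perH fH (s := s) (x := z)).
apply: (cvg_comp _ _ cs); exact: cvg_fst.
Qed.

Lemma cal_cluster (T : Type) (F : set_system T) (X P : T -> V) (y q : V) (r s : R) :
  ProperFilter F -> X @ F --> y -> cluster (P @ F) q ->
  (\forall t \near F, calibrated_on r s (X t, P t)) -> calibrated_on r s (y, q).
Proof.
move=> FF Xy Pq nc.
have cr := @flow1_continuous r; have cs := @flow1_continuous s.
split=> [|sr].
  pose f z := M * (s - r) - `|(phiH s z).1 - (phiH r z).1|.
  have cf : continuous f.
    apply: continuousI => z.
    have c1 : (phiH s z').1 - (phiH r z').1 @[z' --> z] --> (phiH s z).1 - (phiH r z).1.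
      exact: cvgB (cs z) (cr z).
    exact: cvgB (cvg_cst _) (cvg_norm c1).
  have nf : \forall t \near F, 0 <= f (X t, P t).
    by apply: filterS nc => t [h _]; rewrite subr_ge0.
  by have := cluster_pair_ge0 FF cf Xy Pq nf; rewrite subr_ge0.
pose gap z := v z.1 + step_cost H c a (s - r) z.1 z.2 - v z.2.
have cg : continuous gap by exact: continuous_calibration_gap.
pose f z := C * (s - r) ^+ 2 - gap ((phiH r z).1, (phiH s z).1).
have cf : continuous f.
  apply: continuousI => z.
  have c1 : gap ((phiH r z').1, (phiH s z').1) @[z' --> z] --> gap ((phiH r z).1, (phiH s z).1).
    exact: (cvg_comp_pair cg (cr z) (cs z)).
  exact: cvgB (cvg_cst _) c1.
have nf : \forall t \near F, 0 <= f (X t, P t).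
  by apply: filterS nc => t [_ /(_ sr)]; rewrite /f /gap /=; lra.
by have := cluster_pair_ge0 FF cf Xy Pq nf; rewrite /f /gap /=; lra.
Qed.

Lemma calibrated_flow t z : calibrated z -> calibrated (phiH t z).
Proof. by move=> cz r s rs; apply: cal_flow; apply: cz; lra. Qed.

Lemma calibrated_graph z : calibrated z -> graphv c v z.
Proof.
move=> cz; pose g s := (phiH (s + 1) z).1.
have qg : qcal H c a v C M g.
  by move=> r s rs s0; have := cz (r + 1) (s + 1); rewrite /calibrated_on (_ : s + 1 - (r + 1) = s - r); [apply; lra|ring].
have m1 : (-1 : R) < 0 by lra.
have E : g (-1) = z.1 by rewrite /g addNr (flow0 fH).
have dv := qcal_differentiable C2F posH supH perH perv vv C0 qg m1.
have dg := qcal_is_derive C2F posH supH perH perv vv C0 M0 qg m1.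
have dg' : is_derive (-1 : R) (1 : R) g (Hp H z.1 z.2).
  have d0 : is_derive (-1 + 1 : R) (1 : R) (fun t => (phiH t z).1) (Hp H z.1 z.2).
    by rewrite addNr; have [_ /(_ 0)[+ _]] := fH z; rewrite (flow0 fH).
  exact: (is_derive_shift_arg d0).
have e1 : Hp H z.1 z.2 = Hp H (g (-1)) (momentum c v g (-1)).
  by have [_ <-] := dg; have [_ <-] := dg'.
rewrite /momentum E in dv e1; split=> //; exact: (Hp_inj C2F posH e1).
Qed.

(* A cluster point [q] of the momenta makes [(y, q)] calibrated, which forces
   [q = c + grad v y]; hence the momenta converge. *)
Lemma limit_calibrated (T : topologicalType) (F : set_system T) (X P : T -> V) B y :
  ProperFilter F -> X @ F --> y -> (\forall t \near F, `|P t| <= B) ->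
  (forall r s, r < s -> \forall t \near F, calibrated_on r s (X t, P t)) ->
  calibrated (y, c + grad v y) /\ P @ F --> c + grad v y.
Proof.
move=> FF Xy nB nc.
have H1 q : cluster (P @ F) q -> calibrated (y, q).
  by move=> Pq r s rs; apply: cal_cluster Xy Pq (nc r s rs).
have H2 q : cluster (P @ F) q -> q = c + grad v y.
  by move=> /H1 /calibrated_graph[_ /= ->].
have Pc : P @ F --> c + grad v y by exact: (cvg_unique_cluster FF nB H2).
split => //; apply: H1 => A A' FA /Pc FA'; exact: filter_ex (filterI FA FA').
Qed.

Lemma orbit_limit x g z0 (tau : nat -> R) (k : nat -> V) y :
  minimizing H c a v x g -> (forall s, s <= 0 -> (phiH s z0).1 = g s) ->
  (forall s, s < 0 -> graphv c v (phiH s z0)) ->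
  tau @ \oo --> -oo -> (forall j, intvec (k j)) ->
  (fun j => (phiH (tau j) z0).1 - k j) @ \oo --> y ->
  calibrated (y, c + grad v y) /\ (fun j => (phiH (tau j) z0).2) @ \oo --> c + grad v y.
Proof.
move=> gm gE gg tauN ik Xy.
have tN b : \forall j \near \oo, tau j < b by exact: cvgrNy_lt.
have [B B0 HB] := pg_bounded C2F posH supH perH perv vv.
apply: (limit_calibrated (B := B) _ Xy) => [|r s rs].
  by apply: filterS (tN 0) => j /gg[dv ->]; exact: HB.
apply: filterS (tN (- s)) => j tj; apply: (cal_shift (k := - k j)) (intvecN (ik j)) _.
have st : s + tau j <= 0 by lra.
have rt : r + tau j <= 0 by lra.
apply: cal_flow; rewrite /calibrated_on !gE //.
by apply: (minq gm); lra.
Qed.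

Definition alpha_limits : set V :=
  [set y | exists x g, minimizing H c a v x g /\ alpha_limit g y].

Lemma minimizing_orbit x g : minimizing H c a v x g ->
  exists z, [/\ forall s, s <= 0 -> (phiH s z).1 = g s,
    forall s, s < 0 -> graphv c v (phiH s z) &
    differentiable v (g 0) -> z = (g 0, c + grad v (g 0))].
Proof. by move=> /minq; exact: (qcal_orbit C2F posH supH perH perv vv fH C0 M0). Qed.

Lemma alphaS_calibrated y : alpha_limits y -> calibrated (y, c + grad v y).
Proof.
move=> [x [g [gm [tau [k [tN [ik gy]]]]]]]; have [z [gE gg _]] := minimizing_orbit gm.
suff Xy : (fun j => (phiH (tau j) z).1 - k j) @ \oo --> y.
  by have [] := orbit_limit gm gE gg tN ik Xy.
apply: cvg_trans gy; apply: near_eq_cvg.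
have t0 : \forall j \near \oo, tau j <= 0 by exact: cvgrNy_le.
by apply: filterS t0 => j tj; rewrite gE.
Qed.

Lemma alphaS_flow s y : alpha_limits y -> alpha_limits (phiH s (y, c + grad v y)).1.
Proof.
move=> [x [g [gm [tau [k [tN [ik gy]]]]]]]; have [z [gE gg _]] := minimizing_orbit gm.
have t0 b : \forall j \near \oo, tau j <= b by exact: cvgrNy_le.
have Xy : (fun j => (phiH (tau j) z).1 - k j) @ \oo --> y.
  apply: cvg_trans gy; apply: near_eq_cvg.
  by apply: filterS (t0 0) => j tj; rewrite gE.
have [_ Py] := orbit_limit gm gE gg tN ik Xy.
exists x, g; split => //; exists (fun j => tau j + s), k; split.
  apply/cvgrNyPle => A; apply: filterS (t0 (A - s)) => j; lra.
split => //.
have cf : (phiH s ((phiH (tau j) z).1 - k j, (phiH (tau j) z).2)).1 @[j --> \oo]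
    --> (phiH s (y, c + grad v y)).1.
  exact: (cvg_comp_pair (@flow1_continuous s) Xy Py).
apply: cvg_trans cf; apply: near_eq_cvg.
apply: filterS (t0 (- s)) => j tj.
rewrite (flow_periodic C2F supH perH fH s (phiH (tau j) z) (intvecN (ik j))) /= -(flowD C2F supH perH fH) (addrC s) gE //.
by lra.
Qed.

Lemma closure_alphaS y : closure alpha_limits y -> calibrated (y, c + grad v y) /\
  forall s, closure alpha_limits (phiH s (y, c + grad v y)).1.
Proof.
move=> Sy; pose F := within alpha_limits (nbhs y).
have FF : ProperFilter F by exact: within_nbhs_proper.
have Xy : id @ F --> y by exact: cvg_within.
have FS : \forall y' \near F, alpha_limits y' by exact: withinT.
have [B B0 HB] := pg_bounded C2F posH supH perH perv vv.
have nB : \forall y' \near F, `|c + grad v y'| <= B.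
  by apply: filterS FS => y' /alphaS_calibrated/calibrated_graph[/HB].
have nc r s : r < s -> \forall y' \near F, calibrated_on r s (y', c + grad v y').
  by move=> rs; apply: filterS FS => y' /alphaS_calibrated; apply.
have [cy Py] := limit_calibrated FF Xy nB nc.
split => // s B' nB'.
have cf : (phiH s (y', c + grad v y')).1 @[y' --> F] --> (phiH s (y, c + grad v y)).1.
  exact: (cvg_comp_pair (@flow1_continuous s) Xy Py).
have h : \forall y' \near F, B' (phiH s (y', c + grad v y')).1 by exact: cf nB'.
have [y' [/(alphaS_flow s) S1 S2]] := filter_ex (filterI FS h).
by eexists; split; [exact: S1|exact: S2].
Qed.

Notation Mt := (Mtilde H c a v).
Notation Mts := (Mtilde_star H c a v).

Lemma Mtilde_star_flow s z : Mts z -> Mts (phiH s z).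
Proof.
case: z => y p [/= Sy ->]; have [cy Sf] := closure_alphaS Sy.
by split; [exact: Sf|have [] := calibrated_graph (calibrated_flow s cy)].
Qed.

Lemma Mtilde_star_image s : phiH s @` Mts = Mts.
Proof.
apply/seteqP; split=> [_ [z Mz <-]|z Mz]; first exact: Mtilde_star_flow.
by exists (phiH (- s) z); [exact: Mtilde_star_flow|exact: (flowK C2F supH perH fH)].
Qed.

Lemma Mtilde_star_graph : Mts `<=` graphv c v.
Proof.
move=> [y p] [/= Sy ->]; have [cy _] := closure_alphaS Sy; exact: calibrated_graph cy.
Qed.

Lemma Legendre_Mtilde_star : Legendre H @` Mts = Mt.
Proof.
apply/seteqP; split=> [_ [[y p] [/= Sy ->] <-]|[y p] [/= Sy ->]]; first by split.
by exists (y, c + grad v y).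
Qed.

Section Accumulation.
Variables (x : V) (g : R -> V) (z : V * V).
Hypothesis gm : minimizing H c a v x g.
Hypothesis gE : forall s, s <= 0 -> (phiH s z).1 = g s.
Hypothesis gg : forall s, s < 0 -> graphv c v (phiH s z).

Lemma alpha_limit_orbit (tau : nat -> R) (k : nat -> V) y :
  tau @ \oo --> -oo -> (forall j, intvec (k j)) ->
  (fun j => (phiH (tau j) z).1 - k j) @ \oo --> y -> Malpha H c a v y.
Proof.
move=> tN ik Xy; apply: subset_closure; exists x, g; split => //.
exists tau, k; split => //; split => //.
apply: cvg_trans Xy; apply: near_eq_cvg.
have t0 : \forall j \near \oo, tau j <= 0 by exact: cvgrNy_le.
by apply: filterS t0 => j tj; rewrite gE.
Qed.

Lemma accum_Mtilde_star w : accum (fun s => phiH s z) w -> Mts w.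
Proof.
move=> [tau [k [tN [ik [Xy Py]]]]]; split; first exact: alpha_limit_orbit Xy.
have [_ Pc] := orbit_limit gm gE gg tN ik Xy.
by apply: (cvg_unique _ Py Pc); exact: norm_hausdorff.
Qed.

Lemma accum_Mtilde w : accum (fun s => Legendre H (phiH s z)) w -> Mt w.
Proof.
move=> [tau [k [tN [ik [/= Xy Py]]]]]; split; first exact: alpha_limit_orbit Xy.
have [_ Pc] := orbit_limit gm gE gg tN ik Xy.
have Hc : Hp H ((phiH (tau j) z).1 - k j) (phiH (tau j) z).2 @[j --> \oo]
    --> Hp H w.1 (c + grad v w.1) by exact: (cvg_comp_pair (continuous_Hp C2F) Xy Pc).
apply: (cvg_unique _ Py _); first exact: norm_hausdorff.
apply: cvg_trans Hc; apply: near_eq_cvg; apply: nearW => j /=.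
by rewrite (Hp_periodic perH _ _ (intvecN (ik j))).
Qed.

End Accumulation.

End Calibrated.

Theorem theorem2p4 (R : realType) (n : nat) (H : 'rV[R]_n -> 'rV[R]_n -> R)
    (c : 'rV[R]_n) (a : R) (v : 'rV[R]_n -> R)
    (phiL phiH : R -> 'rV[R]_n * 'rV[R]_n -> 'rV[R]_n * 'rV[R]_n) :
  C2 (fun z : 'rV[R]_n * 'rV[R]_n => H z.1 z.2) ->
  (forall x p, posdef (Hpp H x p)) ->
  superlinear H ->
  periodic_x H ->
  periodicT v ->
  visc_sol H c a v ->
  is_ELflow H phiL ->
  is_Hflow H phiH ->
  (* (i) *)
  (forall x : 'rV[R]_n,
     (exists xi : 'rV[R]_n, forall z, accum (fun s => phiL s (x, xi)) z ->
                                      Mtilde H c a v z) /\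
     (differentiable v x ->
        forall z, accum (fun s => phiL s (x, Hp H x (c + grad v x))) z ->
                  Mtilde H c a v z)) /\
  (* (ii) *)
  (forall s : R, phiL s @` Mtilde H c a v = Mtilde H c a v) /\
  (* (iii) *)
  (forall x : 'rV[R]_n,
     (exists p : 'rV[R]_n,
        (forall s : R, s < 0 -> graphv c v (phiH s (x, p))) /\
        (forall z, accum (fun s => phiH s (x, p)) z -> Mtilde_star H c a v z)) /\
     (differentiable v x ->
        (forall s : R, s < 0 -> graphv c v (phiH s (x, c + grad v x))) /\
        (forall z, accum (fun s => phiH s (x, c + grad v x)) z ->
                   Mtilde_star H c a v z))) /\
  (* (iv) *)
  (Mtilde_star H c a v `<=` graphv c v /\
   forall s : R, phiH s @` Mtilde_star H c a v = Mtilde_star H c a v).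
Proof.
move=> C2F posH supH perH perv vv fL fH.
have [C [M [C0 M0 minq]]] := minimizing_qcal C2F posH supH perH perv vv.
have orb x : exists p, [/\ forall s, s < 0 -> graphv c v (phiH s (x, p)),
    forall w, accum (fun s => phiH s (x, p)) w -> Mtilde_star H c a v w,
    forall w, accum (fun s => phiL s (x, Hp H x p)) w -> Mtilde H c a v w &
    differentiable v x -> p = c + grad v x].
  have [C' [Xi [g [C'0 Xi0 qg g0]]]] := exists_qcal C2F posH supH perH perv vv x.
  have gm := qcal_minimizing C2F posH supH perH perv vv Xi0 qg.
  have [[y p] [gE gg gd]] := minimizing_orbit C2F posH supH perH perv vv fH C0 M0 minq gm.
  have yx : y = x by have := gE 0 (lexx 0); rewrite (flow0 fH) g0.
  rewrite yx in gE gg gd; exists p; split => //.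
  - exact: (accum_Mtilde_star C2F posH supH perH perv vv fH C0 M0 minq gm gE gg).
  - move=> w; have -> : (fun s => phiL s (x, Hp H x p)) = (fun s => Legendre H (phiH s (x, p))).
      by apply/funext => s; rewrite -(ELflowE C2F posH supH perH fH fL).
    exact: (accum_Mtilde C2F posH supH perH perv vv fH C0 M0 minq gm gE gg).
  - by rewrite g0 in gd; move=> /gd [].
have Mim := Mtilde_star_image C2F posH supH perH perv vv fH C0 M0 minq.
split=> [x|].
  have [p [_ _ pL pd]] := orb x; split; first by exists (Hp H x p).
  by move=> /pd <-.
split=> [s|].
  rewrite -(Legendre_Mtilde_star H c a v) -[in RHS](Mim s) !image_comp.
  by congr image; apply/funext => z /=; rewrite (ELflowE C2F posH supH perH fH fL).
split=> [x|].
  have [p [momentum pH _ pd]] := orb x; split; first by exists p.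
  by move=> /pd <-.
split; last exact: Mim.
exact: (Mtilde_star_graph C2F posH supH perH perv vv fH C0 M0 minq).
Qed.
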